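(* Let $(Z_t)_{t\in[0,T]}$ be a continuous real-valued centred Gaussian process with covariance function $R:[0,T]^2\to\mathbb R$. Suppose $R$ has finite two-dimensional $\rho$-variation for some $\rho\in[1,2)$. Assume that $Z$ is nondegenerate and that it has nonnegative conditional covariance, i.e. for every $[u,v]\subseteq[s,t]\subseteq[0,S]\subseteq[0,T]$, $$\operatorname{Cov}(Z_{s,t},Z_{u,v}\,|\,\mathcal F_{0,s}\vee\mathcal F_{t,S})\ge0 .$$ Suppose $f\in C^\gamma([0,T],\mathbb R)$, where $\gamma\in(0,1)$ and $\gamma+1/\rho>1$. Then for every $0<S\le T$ at least one of the following is always true: (a) $$\|f\|_{\infty;[0,S]}\le 2\,E[Z_S^2]^{-1/2}\Big(\int_{[0,S]^2}f_sf_t\,dR(s,t)\Big)^{1/2};$$ (b) for some interval $[s,t]\subseteq[0,S]$ of length at least $$\Big(\frac{\|f\|_{\infty;[0,S]}}{2\|f\|_{\gamma;[0,S]}}\Big)^{1/\gamma}$$ we have $$\tfrac14\|f\|^2_{\infty;[0,S]}\operatorname{Var}(Z_{s,t}\,|\,\mathcal F_{0,s}\vee\mathcal F_{t,S})\le\int_{[0,S]^2}f_vf_{v'}\,dR(v,v').$$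
   Context: $Z_{s,t}:=Z_t-Z_s$; $R(s,t)=E[Z_sZ_t]$; $\mathcal F_{a,b}:=\sigma(Z_{v,v'}:a\le v\le v'\le b)$. Conditional variances and covariances of jointly Gaussian variables are deterministic. $\|f\|_{\infty;[0,S]}=\sup_{[0,S]}|f|$, $\|f\|_{\gamma;[0,S]}=\sup_{0\le s<t\le S}|f_t-f_s|/|t-s|^\gamma$, and $C^\gamma([0,T],\mathbb R)$ is the set of functions with $\|f\|_{\gamma;[0,T]}<\infty$. $R$ has finite two-dimensional $\rho$-variation if $\sup_{\mathcal D,\mathcal D'}\sum_{[a,b]\in\mathcal D,\,[a',b']\in\mathcal D'}|E[Z_{a,b}Z_{a',b'}]|^\rho<\infty$, the supremum being over pairs of partitions of $[0,T]$. $Z$ is nondegenerate if for every partition $\{t_i:i=0,\dots,n\}$ of $[0,T]$ the $n\times n$ matrix with entries $E[Z_{t_{i-1},t_i}Z_{t_{j-1},t_j}]$ is positive definite. The integral $\int_{[0,S]^2}f_sf_t\,dR(s,t)$ is the 2D Young integral, i.e. the limit, as the mesh of the partition $\{t_i\}$ of $[0,S]$ tends to $0$, of $\sum_{i,j}f_{t_{i-1}}f_{t_{j-1}}E[Z_{t_{i-1},t_i}Z_{t_{j-1},t_j}]$; it exists when $\gamma+1/\rho>1$.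
   Formalization: The formal theorem additionally assumes that the process starts at zero, Z_0 = 0 almost surely; without this the claim is false (e.g. Brownian motion plus an independent N(0,100) variable, f = 1 + εt, S = T = 1). *)

(* Defs.v *)
From HB Require Import structures.
From mathcomp Require Import all_boot all_order all_algebra.
From mathcomp Require Import all_classical all_reals all_analysis.

Set Implicit Arguments.
Unset Strict Implicit.
Unset Printing Implicit Defensive.

Import Order.TTheory GRing.Theory Num.Theory.
Import numFieldNormedType.Exports.

Local Open Scope classical_set_scope.
Local Open Scope ring_scope.

Section conditioning.
Context {d} {T : measurableType d} {R : realType} (P : probability T R).
Implicit Types (G : set (set T)) (X Y : T -> R).

(* [Y] is a version of E[X | G]; [G] is meant to be a sub-sigma-algebra of the
   measurable sets. *)
Definition is_cond_expectation G X Y : Prop :=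
  [/\ g_sigma_algebra_preimage Y `<=` G,
      P.-integrable setT (EFin \o Y) &
      forall A, G A ->
        (\int[P]_(w in A) (Y w)%:E = \int[P]_(w in A) (X w)%:E)%E].

(* An unspecified version of E[X | G], unique up to P-negligible sets: results
   about it are to be stated almost surely. *)
Definition cond_expectation G X : T -> R :=
  xget (cst 0) [set Y | is_cond_expectation G X Y].

Definition cond_covariance G X Y : T -> R :=
  cond_expectation G
    ((X \- cond_expectation G X) \* (Y \- cond_expectation G Y)).

Definition cond_variance G X : T -> R := cond_covariance G X X.

End conditioning.

Definition sigma_join {T : Type} (G H : set (set T)) : set (set T) :=
  <<s G `|` H >>.

(* Processes are indexed by the whole of [R]; only the indices in the time
   interval [0, tmax] are ever used. *)
Section process.
Context {d} {T : measurableType d} {R : realType} (P : probability T R).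
Implicit Types (Z : R -> {RV P >-> R}) (s t u v : R).

(* [normal_prob m sigma] is the normal law only for sigma != 0, hence the
   separate disjunct for constants. *)
Definition gaussian_rv (X : {RV P >-> R}) : Prop :=
  (exists m : R, forall A : set R, measurable A ->
      distribution P X A = dirac m A) \/
  (exists m sigma : R, 0 < sigma /\ forall A : set R, measurable A ->
      distribution P X A = normal_prob m sigma A).

Definition gaussian_process (tmax : R) Z : Prop :=
  forall (n : nat) (t : 'I_n -> R) (a : 'I_n -> R),
    (forall i, t i \in `[0, tmax]) ->
    gaussian_rv (\sum_(i < n) a i *: (Z (t i) : {mfun T >-> R})).

Definition centred_process (tmax : R) Z : Prop :=
  forall t, t \in `[0, tmax] -> ('E_P[Z t] = 0)%E.

Definition continuous_process (tmax : R) Z : Prop :=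
  {ae P, forall w, {within `[0, tmax], continuous (fun t => Z t w)}}.

Definition increment Z s t : T -> R := fun w => Z t w - Z s w.

Definition increment_cov Z s t u v : R :=
  fine 'E_P[increment Z s t \* increment Z u v].

Definition increment_sigma Z a b : set (set T) :=
  <<s [set A | exists v v' : R, [/\ a <= v, v <= v', v' <= b &
         g_sigma_algebra_preimage (increment Z v v') A]] >>.

(* F_{0,s} \/ F_{t,S} *)
Definition outer_sigma Z s t S : set (set T) :=
  sigma_join (increment_sigma Z 0 s) (increment_sigma Z t S).

Definition nonneg_cond_cov (tmax : R) Z : Prop :=
  forall s t u v S : R,
    0 <= s -> s <= u -> u <= v -> v <= t -> t <= S -> S <= tmax ->
    {ae P, forall w,
      0 <= cond_covariance P (outer_sigma Z s t S)
             (increment Z s t) (increment Z u v) w}.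

End process.

(* As in [itv_partition], a partition a = t_0 < ... < t_n = b is given by the
   list [:: t_1; ...; t_n], so that n is the size of the list. *)
Section partitions.
Context {R : realType}.
Implicit Types (a : R) (p q : seq R).

Definition point a p (i : nat) : R := nth a (a :: p) i.

Definition mesh a p : R :=
  \big[Num.max/0]_(i < size p) (point a p i.+1 - point a p i).

Definition mesh_to0 (a b : R) : set_system (seq R) :=
  filter_from [set e : R | 0 < e]
    (fun e => [set p | itv_partition a b p /\ mesh a p < e]).

End partitions.

Section covariance_structure.
Context {d} {T : measurableType d} {R : realType} (P : probability T R).
Implicit Types (Z : R -> {RV P >-> R}).

Definition cov_block Z (p q : seq R) (i j : nat) : R :=
  increment_cov Z (point 0 p i) (point 0 p i.+1) (point 0 q j) (point 0 q j.+1).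

Definition rho_variation_sum (rho : R) Z (p q : seq R) : R :=
  \sum_(i < size p) \sum_(j < size q) `|cov_block Z p q i j| `^ rho.

Definition finite_2d_variation (rho tmax : R) Z : Prop :=
  (ereal_sup [set (rho_variation_sum rho Z pq.1 pq.2)%:E | pq in
     [set pq | itv_partition 0%R tmax pq.1 /\ itv_partition 0%R tmax pq.2]]
   < +oo)%E.

Definition nondegenerate_process (tmax : R) Z : Prop :=
  forall p : seq R, itv_partition 0 tmax p ->
  forall x : 'rV[R]_(size p), x != 0 ->
    0 < (x *m (\matrix_(i, j) cov_block Z p p i j) *m x^T) 0 0.

Definition young2d_sum Z (f : R -> R) (p : seq R) : R :=
  \sum_(i < size p) \sum_(j < size p)
    f (point 0 p i) * f (point 0 p j) * cov_block Z p p i j.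

Definition young2d_integral Z (f : R -> R) (S : R) : R :=
  lim (young2d_sum Z f @ mesh_to0 0 S).

End covariance_structure.

(* Extended-real norms: since 0^-1 = +oo in [\bar R], dividing a nonzero sup norm
   by the vanishing Hoelder norm of a constant function gives +oo. *)
Section norms.
Context {R : realType}.
Implicit Types (f : R -> R).

Definition sup_norm f (S : R) : \bar R :=
  ereal_sup [set (`|f t|)%:E | t in `[0, S]].

Definition hoelder_norm (gamma : R) f (S : R) : \bar R :=
  ereal_sup [set x : \bar R | exists s t : R,
    [/\ 0 <= s, s < t, t <= S &
        x = (`|f t - f s| / `|t - s| `^ gamma)%:E]].

End norms.

(* Main.v *)
Require Import Defs.
From HB Require Import structures.
From mathcomp Require Import all_boot all_order all_algebra.
From mathcomp Require Import all_classical all_reals all_analysis.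
From mathcomp Require Import measurable_realfun.
From mathcomp Require Import ring lra.

Set Implicit Arguments.
Unset Strict Implicit.
Unset Printing Implicit Defensive.

Import Order.TTheory GRing.Theory Num.Theory.
Import numFieldNormedType.Exports.

Local Open Scope classical_set_scope.
Local Open Scope ring_scope.

(* The Riemann sums I_p = \sum f(t_(i-1)) Z_(t_(i-1), t_i) satisfy E[I_p^2] -> \int f f dR, so that
   everything reduces to lower bounds for E[I_p^2]. If sg f >= m >= 0 on [s, t] with sg = 1 or -1
   and p contains s and t, write I_p = A + B, where A collects the increments inside [s, t] and B
   is measurable with respect to F_(0,s) \/ F_(t,S). Then E[I_p^2] is at least the residual
   variance of A given this sigma-algebra, and since the residuals of the increments inside
   [s, t] correlate nonnegatively with that of Z_(s,t), the latter is at least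
   m^2 Var(Z_(s,t) | F_(0,s) \/ F_(t,S)). Taking m = |f|_oo / 2 around a maximum of |f| gives (b)
   if an interval of the required length fits into [0, S] on one side of the maximum; otherwise
   sg f >= m on the whole of [0, S], where the conditioning is trivial, which is (a).

   A Gaussian variable is split into its L^2-projection Y on the closed span of the outer
   increments and a residual N = X - Y. The conditional laws are obtained from characteristic
   functions only: E[cos(k + a + th N)] = E[cos(k + a)] E[cos(th N)] for k in the span, and the
   bounded functions that can multiply cos(k + a) in such identities form an algebra closed under
   bounded limits, hence contain the indicators of the generated sigma-algebra; expanding in th
   yields E[N | G] = 0 and the constancy of E[N^2 | G].

   The existence of the limit is proved in L^2: passing from level n to level n + 1 of a dyadic
   discretisation of f changes the sum in L^2 by O(2^(-n (gamma + 1/rho - 1))), by the bounded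
   rho-variation of the covariance. *)

(** The conditional covariance in the hypothesis is an unspecified version, known only almost
    surely, while the conclusion needs inequalities between numbers. So residuals N, N' are shown to
    satisfy E[N N' 1_A] = E[N N'] P(A) for every A in the outer sigma-algebra. Each conditional
    covariance is then almost surely the number E[N N'], and what follows is Hilbert space geometry
    of residuals.

    The integral is a limit over all partitions, yet the lower bound for E[I_p^2] is proved only for
    those through s and t. It passes to the limit because such partitions occur at every mesh and
    because the limit is known to exist.

    In the convergence proof the dyadic points are rounded up to points of p. The sum of level n is
    then the Riemann sum along p of a step function, and the rate in n is uniform in p; only
    afterwards, at a fixed level, does the mesh tend to 0, where L^2-continuity of Z suffices. The
    latter follows from path continuity, since E[cos X] = exp (- E[X^2] / 2) turns bounded
    convergence into convergence of variances. *)

Section integrals.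
Context {d} {T : measurableType d} {R : realType} (P : probability T R).
Implicit Types (X Y : T -> R).

Local Notation E X := (Rintegral P setT X).
Local Notation integ X := (P.-integrable setT (EFin \o X)).
Local Notation meas X := (measurable_fun setT X).

(** * Expectations of real-valued functions *)

Lemma integ_meas X : integ X -> meas X.
Proof. by move=> /(measurable_int P) /measurable_EFinP. Qed.

Lemma integ_bounded X (M : R) : meas X -> (forall w, `|X w| <= M) -> integ X.
Proof.
move=> mX XM; apply: measurable_bounded_integrable => //.
  by rewrite ltey_eq fin_num_measure.
exists M; split => [|y My w _] /=; first exact: num_real.
by rewrite (le_trans (XM w))// ltW.
Qed.

Lemma integ_le X Y : meas X -> integ Y -> (forall w, `|X w| <= Y w) -> integ X.
Proof.
move=> mX iY XY; apply: le_integrable iY => //=; first exact/measurable_EFinP.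
by move=> w _; rewrite lee_fin (le_trans (XY w))// ler_norm.
Qed.

Lemma integD X Y : integ X -> integ Y -> integ (fun w => X w + Y w).
Proof. by move=> iX iY; apply: (integrableD _ iX iY). Qed.

Lemma integB X Y : integ X -> integ Y -> integ (fun w => X w - Y w).
Proof. by move=> iX iY; apply: (integrableB _ iX iY). Qed.

Lemma integZ (a : R) X : integ X -> integ (fun w => a * X w).
Proof. by move=> iX; apply: (integrableZl _ a iX). Qed.

Lemma integ_cst (a : R) : integ (fun=> a).
Proof. exact: (integ_bounded (M := `|a|)). Qed.

Lemma integ_sum (I : Type) (s : seq I) (h : I -> T -> R) :
  (forall i, integ (h i)) -> integ (fun w => \sum_(i <- s) h i w).
Proof.
move=> ih; elim: s => [|i s IH].
  by under [X in EFin \o X]eq_fun do rewrite big_nil; exact: integ_cst.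
by under [X in EFin \o X]eq_fun do rewrite big_cons; exact: integD.
Qed.

Lemma meanD X Y : integ X -> integ Y -> E (fun w => X w + Y w) = E X + E Y.
Proof. by move=> iX iY; rewrite RintegralD. Qed.

Lemma meanB X Y : integ X -> integ Y -> E (fun w => X w - Y w) = E X - E Y.
Proof. by move=> iX iY; rewrite RintegralB. Qed.

Lemma meanZ (a : R) X : integ X -> E (fun w => a * X w) = a * E X.
Proof. by move=> iX; rewrite RintegralZl. Qed.

Lemma mean_cst (a : R) : E (fun=> a) = a.
Proof. by rewrite Rintegral_cst// [X in fine X](@probability_setT _ _ _ P) /= mulr1. Qed.

Lemma mean_sum (I : Type) (s : seq I) (h : I -> T -> R) :
  (forall i, integ (h i)) ->
  E (fun w => \sum_(i <- s) h i w) = \sum_(i <- s) E (h i).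
Proof.
move=> ih; elim: s => [|i s IH].
  by under eq_fun do rewrite big_nil; rewrite mean_cst big_nil.
under eq_fun do rewrite big_cons.
by rewrite meanD ?IH ?big_cons//; exact: integ_sum.
Qed.

Lemma mean_ge0 X : (forall w, 0 <= X w) -> 0 <= E X.
Proof. by move=> X0; apply: Rintegral_ge0. Qed.

Lemma mean_ae X Y : meas X -> meas Y -> {ae P, forall w, X w = Y w} -> E X = E Y.
Proof.
move=> mX mY XY; congr fine; apply: ae_eq_integral => //.
- exact/measurable_EFinP.
- exact/measurable_EFinP.
- by apply: filterS XY => w /= -> _.
Qed.

Lemma integ_ae X Y : meas Y -> integ X -> {ae P, forall w, X w = Y w} -> integ Y.
Proof.
move=> mY /integrableP[mX iX] XY; apply/integrableP; split.
  exact/measurable_EFinP.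
rewrite (le_lt_trans _ iX)// le_eqVlt; apply/orP; left; apply/eqP.
apply: ae_eq_integral => //; try (apply: measurableT_comp => //); first exact/measurable_EFinP.
by apply: filterS XY => w /= -> _.
Qed.

Lemma EFin_mean X : integ X -> (E X)%:E = (\int[P]_w (X w)%:E)%E.
Proof. by move=> iX; rewrite fineK//; exact: integrable_fin_num. Qed.

Lemma mean_dct (X_ : nat -> T -> R) X Y :
  (forall n, meas (X_ n)) -> meas X ->
  {ae P, forall w, X_ n w @[n --> \oo] --> X w} ->
  integ Y -> (forall n w, `|X_ n w| <= Y w) ->
  E (X_ n) @[n --> \oo] --> E X.
Proof.
move=> mX_ mX cX iY XY.
have aeL : {ae P, forall x, setT x ->
    (fun n => (X_ n x)%:E) @ \oo --> (X x)%:E}.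
  by apply: filterS cX => w cw _; apply: cvg_EFin => //; exact: nearW.
have aeB : {ae P, forall x (n : nat), setT x -> (`|(X_ n x)%:E| <= (Y x)%:E)%E}.
  by apply: aeW => w n _; rewrite lee_fin.
have [iX _ cE] := @dominated_convergence _ _ _ P setT measurableT
  (fun n w => (X_ n w)%:E) (fun w => (X w)%:E) (fun w => (Y w)%:E)
  (fun n => (measurable_EFinP _ _).2 (mX_ n)) ((measurable_EFinP _ _).2 mX)
  aeL iY aeB.
by apply: fine_cvg; rewrite EFin_mean.
Qed.

(** * Square integrable functions and the L^2 seminorm *)

Definition sqint X := meas X /\ integ (fun w => X w ^+ 2).

Lemma sqint_meas X : sqint X -> meas X. Proof. by case. Qed.

Lemma sqintM X Y : sqint X -> sqint Y -> integ (fun w => X w * Y w).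
Proof.
move=> [mX iX] [mY iY].
apply: (integ_le (Y := fun w => X w ^+ 2 + Y w ^+ 2)).
- exact: measurable_funM.
- exact: integD.
- move=> w; rewrite normrM.
  have := sqr_ge0 (`|X w| - `|Y w|).
  rewrite -(@real_normK _ (X w)) ?num_real// -(@real_normK _ (Y w)) ?num_real//; nra.
Qed.

Lemma sqint_cst (a : R) : sqint (fun=> a).
Proof. by split; [exact: measurable_cst|exact: integ_cst]. Qed.

Lemma sqint_integ X : sqint X -> integ X.
Proof.
move=> sX; have := sqintM sX (sqint_cst 1).
by under [X in EFin \o X]eq_fun do rewrite mulr1.
Qed.

Lemma sqintZ (a : R) X : sqint X -> sqint (fun w => a * X w).
Proof.
move=> [mX iX]; split; first exact: measurable_funM.
by under [X in EFin \o X]eq_fun do rewrite exprMn; exact: integZ.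
Qed.

Lemma sqintD X Y : sqint X -> sqint Y -> sqint (fun w => X w + Y w).
Proof.
move=> sX sY; split.
  by apply: measurable_funD; [case: sX|case: sY].
under [X in EFin \o X]eq_fun do rewrite sqrrD.
apply: integD; last by case: sY.
apply: integD; first by case: sX.
under [X in EFin \o X]eq_fun do rewrite -mulr_natl.
by apply: integZ; exact: sqintM.
Qed.

Lemma sqintB X Y : sqint X -> sqint Y -> sqint (fun w => X w - Y w).
Proof.
move=> sX sY; under eq_fun do rewrite -mulN1r.
by apply: sqintD => //; exact: sqintZ.
Qed.

Lemma sqint_sum (I : Type) (s : seq I) (h : I -> T -> R) :
  (forall i, sqint (h i)) -> sqint (fun w => \sum_(i <- s) h i w).
Proof.
move=> ih; elim: s => [|i s IH].
  by under eq_fun do rewrite big_nil; exact: sqint_cst.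
by under eq_fun do rewrite big_cons; exact: sqintD.
Qed.

Definition nrm X : R := Num.sqrt (E (fun w => X w ^+ 2)).

Lemma nrm_ge0 X : 0 <= nrm X. Proof. exact: sqrtr_ge0. Qed.

Lemma nrm_sqr X : nrm X ^+ 2 = E (fun w => X w ^+ 2).
Proof. by rewrite sqr_sqrtr//; apply: mean_ge0 => w; exact: sqr_ge0. Qed.

Lemma nrmZ (a : R) X : sqint X -> nrm (fun w => a * X w) = `|a| * nrm X.
Proof.
move=> [mX iX]; rewrite /nrm; under eq_fun do rewrite exprMn.
by rewrite meanZ// sqrtrM ?sqr_ge0// sqrtr_sqr.
Qed.

Lemma mean_sqr_lin (a : R) X Y : sqint X -> sqint Y ->
  E (fun w => (X w + a * Y w) ^+ 2) =
  E (fun w => X w ^+ 2) + 2 * a * E (fun w => X w * Y w) +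
  a ^+ 2 * E (fun w => Y w ^+ 2).
Proof.
move=> sX sY.
have -> : (fun w => (X w + a * Y w) ^+ 2) =
  (fun w => (X w ^+ 2 + (2 * a) * (X w * Y w)) + a ^+ 2 * Y w ^+ 2).
  by apply/funext => w; ring.
have iXY := sqintM sX sY.
case: sX => mX iX; case: sY => mY iY.
rewrite meanD; [|by apply: integD => //; exact: integZ|exact: integZ].
by rewrite meanD ?meanZ//; exact: integZ.
Qed.

(** The quadratic t |-> E[(X + t Y)^2] is nonnegative; its value at the minimiser t = - c / B gives
    the inequality. *)
Lemma cauchy_schwarz_mean X Y : sqint X -> sqint Y ->
  `|E (fun w => X w * Y w)| <= nrm X * nrm Y.
Proof.
move=> sX sY; set c := E _.
have [a0 b0] := (nrm_ge0 X, nrm_ge0 Y).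
have H (t : R) : 0 <= nrm X ^+ 2 + 2 * t * c + t ^+ 2 * nrm Y ^+ 2.
  by rewrite !nrm_sqr -mean_sqr_lin//; apply: mean_ge0 => w; exact: sqr_ge0.
rewrite -[leRHS]ger0_norm ?mulr_ge0// -ler_sqr ?nnegrE ?normr_ge0// !real_normK ?num_real//.
rewrite exprMn; set A := nrm X ^+ 2 in H *; set B := nrm Y ^+ 2 in H *.
have B0 : 0 <= B by exact: sqr_ge0.
have A0 : 0 <= A by exact: sqr_ge0.
have [B00|Bn0] := eqVneq B 0.
  have [c0|cn0] := eqVneq c 0; first by rewrite c0 expr0n/= mulr_ge0.
  (* With B = 0 the quadratic is affine in t, and this t gives it the value -1. *)
  have := H (- (A + 1) / (2 * c)).
  rewrite B00 mulr0 addr0 (_ : 2 * (- (A + 1) / (2 * c)) * c = - (A + 1)); last by field.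
  lra.
have := H (- c / B).
rewrite (_ : A + _ + _ = (A * B - c ^+ 2) / B); last by field.
by rewrite pmulr_lge0 ?invr_gt0 ?lt_def ?Bn0// subr_ge0.
Qed.

Lemma nrmD X Y : sqint X -> sqint Y -> nrm (fun w => X w + Y w) <= nrm X + nrm Y.
Proof.
move=> sX sY; have [a0 b0] := (nrm_ge0 X, nrm_ge0 Y).
rewrite -ler_sqr ?nnegrE ?addr_ge0 ?nrm_ge0// nrm_sqr.
under eq_fun do rewrite -[X in (_ + X)]mul1r.
rewrite mean_sqr_lin// -!nrm_sqr.
have := le_trans (ler_norm _) (cauchy_schwarz_mean sX sY); nra.
Qed.

Lemma nrmB X Y : sqint X -> sqint Y -> nrm (fun w => X w - Y w) <= nrm X + nrm Y.
Proof.
move=> sX sY; under eq_fun do rewrite -mulN1r.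
apply: le_trans (nrmD _ _) _ => //; first exact: sqintZ.
by rewrite nrmZ// normrN1 mul1r.
Qed.

Lemma nrm_sum (I : Type) (s : seq I) (h : I -> T -> R) :
  (forall i, sqint (h i)) ->
  nrm (fun w => \sum_(i <- s) h i w) <= \sum_(i <- s) nrm (h i).
Proof.
move=> ih; elim: s => [|i s IH].
  under eq_fun do rewrite big_nil.
  by rewrite big_nil /nrm expr0n/= mean_cst sqrtr0.
under eq_fun do rewrite big_cons.
rewrite big_cons; apply: le_trans (nrmD _ _) _ => //; first exact: sqint_sum.
by rewrite lerD2l.
Qed.

Lemma mean_normr_le_nrm X : sqint X -> E (fun w => `|X w|) <= nrm X.
Proof.
move=> [mX iX].
have sX : sqint (fun w => `|X w|).
  split; first exact: measurableT_comp.
  by under [X in EFin \o X]eq_fun do rewrite real_normK ?num_real//.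
have := cauchy_schwarz_mean sX (sqint_cst 1).
under eq_fun do rewrite mulr1.
rewrite /nrm expr1n mean_cst sqrtr1 mulr1.
under [X in _ <= Num.sqrt (E X) -> _]eq_fun do rewrite real_normK ?num_real//.
exact/le_trans/ler_norm.
Qed.

End integrals.

Notation mean P X := (Rintegral P setT X).
Notation integ P X := (integrable P setT (EFin \o X)).

Lemma measurable_cos (R : realType) : measurable_fun setT (@cos R).
Proof. by apply: continuous_measurable_fun; exact: continuous_cos. Qed.

Lemma measurable_sin (R : realType) : measurable_fun setT (@sin R).
Proof. by apply: continuous_measurable_fun; exact: continuous_sin. Qed.

(** * Integrals against the normal density *)

Section normal_law.
Context {R : realType}.
Notation mu := (@lebesgue_measure R).

(** The density and the Radon-Nikodym derivative of [normal_prob] have the same integral over every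
    measurable set, hence agree almost everywhere. *)
Lemma integral_normal_prob (m s : R) (f : R -> \bar R) :
  measurable_fun setT f -> (forall x, 0 <= f x)%E ->
  (\int[normal_prob m s]_x f x = \int[mu]_x (f x * (normal_pdf m s x)%:E))%E.
Proof.
move=> mf f0.
have dom := @normal_prob_dominates R m s.
rewrite -(Radon_Nikodym_SigmaFinite.change_of_variables dom f0 measurableT mf).
apply: ae_eq_integral => //.
- apply: emeasurable_funM => //.
  exact: measurable_int (Radon_Nikodym_SigmaFinite.f_integrable dom).
- by apply: emeasurable_funM => //; apply/measurable_EFinP; exact: measurable_normal_pdf.
apply: ae_eqe_mul2l; apply: integral_ae_eq => //.
- exact: Radon_Nikodym_SigmaFinite.f_integrable.
- by apply/measurable_EFinP; exact: measurable_normal_pdf.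
- by move=> A _ mA; rewrite -Radon_Nikodym_SigmaFinite.f_integral.
Qed.

(** Fundamental theorem of calculus on [m - n, m + n], then dominated convergence. *)
Lemma integral_deriv_eq0 (m : R) (F f : R -> R) :
  mu.-integrable setT (EFin \o f) -> continuous f ->
  (forall x : R, is_derive x 1 F (f x)) ->
  F (m + n%:R) @[n --> \oo] --> 0 -> F (m - n%:R) @[n --> \oo] --> 0 ->
  \int[mu]_x f x = 0.
Proof.
move=> intf cf dF Fp Fm.
pose I n := `[m - n%:R, m + n%:R]%classic.
have cvgI : (\int[mu]_x (f \_ (I n)) x) @[n --> \oo] --> \int[mu]_x f x.
  apply: fine_cvg; rewrite fineK ?integrable_fin_num//.
  have mf := measurable_int _ intf.
  have aeL : {ae mu, forall x, setT x ->
      (fun n => ((f \_ (I n)) x)%:E) @ \oo --> (f x)%:E}.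
    apply: aeW => x _; apply: cvg_near_cst.
    near=> n; congr (_%:E); rewrite patchE ifT// inE /I /= in_itv/=.
    have : `|x - m| <= n%:R by near: n; exact: nbhs_infty_ger.
    by rewrite ler_norml; lra.
  have mI n : measurable_fun setT (fun x => ((f \_ (I n)) x)%:E).
    apply/measurable_EFinP; apply/(measurable_restrictT _ _).1; first exact: measurable_itv.
    by apply: measurable_funTS; exact/measurable_EFinP.
  have aeB : {ae mu, forall x (n : nat), setT x ->
      (`|((f \_ (I n)) x)%:E| <= (abse \o (EFin \o f)) x)%E}.
    apply: aeW => x n _ /=; rewrite patchE; case: ifPn => // _.
    by rewrite normr0 lee_fin.
  by have [_ _ +] := @dominated_convergence _ _ _ mu setT measurableT
    (fun n x => ((f \_ (I n)) x)%:E) (EFin \o f) (abse \o (EFin \o f)) mI mf aeL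
    (integrable_abse intf) aeB.
have eI n : (0 < n)%N -> \int[mu]_x (f \_ (I n)) x = F (m + n%:R) - F (m - n%:R).
  move=> n0; rewrite -Rintegral_mkcond /Rintegral.
  have ltI : m - n%:R < m + n%:R by rewrite ltrD2l gtrN// ltr0n.
  have cF : continuous F.
    by move=> x; apply: differentiable_continuous; apply/derivable1_diffP.
  rewrite (@continuous_FTC2 _ f F)//.
  - exact: continuous_subspaceT.
  - split => [x _||]; first by have := dF x; case.
    + exact/cvg_at_right_filter/cF.
    + exact/cvg_at_left_filter/cF.
  - by move=> x _; rewrite derive1E; have := dF x; case.
have : (\int[mu]_x (f \_ (I n)) x) @[n --> \oo] --> (0 - 0 : R).
  apply: cvg_trans (cvgB Fp Fm); apply: near_eq_cvg.
  by near=> n; rewrite eI//; near: n; exact: nbhs_infty_gt.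
rewrite subr0 => /cvg_lim <- //.
by apply/esym/cvg_lim.
Unshelve. all: end_near. Qed.

Variables (m s : R).
Hypothesis s0 : 0 < s.
Let g := normal_pdf m s.

Let gE x : g x = normal_peak s * expR (- (x - m) ^+ 2 / (s ^+ 2 *+ 2)).
Proof. by rewrite /g normal_pdfE// gt_eqF. Qed.

Lemma is_derive_normal_pdf (x : R) : is_derive x 1 g (- (x - m) / s ^+ 2 * g x).
Proof.
have -> : g = (fun x => normal_peak s * expR (- (x - m) ^+ 2 / (s ^+ 2 *+ 2))).
  by apply/funext => y; exact: gE.
have H : is_derive x 1 (fun x : R => - (x - m) ^+ 2 / (s ^+ 2 *+ 2)) (- (x - m) / s ^+ 2).
  have -> : (fun x : R => - (x - m) ^+ 2 / (s ^+ 2 *+ 2)) =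
     (fun x : R => (- (s ^+ 2 *+ 2)^-1) * (x - m) ^+ 2).
    by apply/funext => y; rewrite mulNr mulrC mulNr.
  apply: is_derive_eq; rewrite /GRing.scale/=.
  have sn0 : s != 0 by rewrite gt_eqF.
  by field.
apply: is_derive_eq; rewrite /GRing.scale/=; ring.
Qed.

(** A normal density of twice the standard deviation absorbs the quadratic factor: the exponents
    differ by z = 3 (x - m)^2 / (8 s^2), and z <= exp z. *)
Lemma sqr_normal_pdf_le (x : R) : (x - m) ^+ 2 * g x <=
  (8 * s ^+ 2 / 3 * (normal_peak s / normal_peak (2 * s))) * normal_pdf m (2 * s) x.
Proof.
have s20 : 2 * s != 0 by rewrite mulf_neq0 ?gt_eqF.
have sn0 : s != 0 by rewrite gt_eqF.
rewrite gE normal_pdfE// /normal_fun.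
have p2 : normal_peak (2 * s) != 0 by rewrite gt_eqF ?normal_peak_gt0.
set E2 := expR (- (x - m) ^+ 2 / ((2 * s) ^+ 2 *+ 2)).
rewrite [leRHS](_ : _ = normal_peak s * (8 * s ^+ 2 / 3 * E2)); last by field.
rewrite mulrCA ler_pM2l ?normal_peak_gt0// /E2 {E2}.
set z := 3 * (x - m) ^+ 2 / (8 * s ^+ 2).
have -> : - (x - m) ^+ 2 / (s ^+ 2 *+ 2) = - (x - m) ^+ 2 / ((2 * s) ^+ 2 *+ 2) - z.
  by rewrite /z; field.
rewrite expRD expRN [leLHS]mulrCA [leRHS]mulrC ler_pM2l ?expR_gt0//.
rewrite ler_pdivrMr ?expR_gt0// (_ : (x - m) ^+ 2 = 8 * s ^+ 2 / 3 * z); last first.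
  by rewrite /z; field.
rewrite ler_pM2l; last by rewrite divr_gt0// mulr_gt0// exprn_gt0.
by have := expR_ge1Dx z; lra.
Qed.

Lemma integrable_normal_growth (A : R) (f : R -> R) : measurable_fun setT f ->
  (forall x, `|f x| <= A * (1 + (x - m) ^+ 2)) ->
  mu.-integrable setT (EFin \o (fun x => f x * g x)).
Proof.
move=> mf fA.
set C := (8 * s ^+ 2 / 3 * (normal_peak s / normal_peak (2 * s))).
have i1 : mu.-integrable setT (EFin \o (fun x => A * g x)).
  exact: (integrableZl _ A (integrable_normal_pdf m s)).
have i2 : mu.-integrable setT (EFin \o (fun x => `|A| * C * normal_pdf m (2 * s) x)).
  exact: (integrableZl _ (`|A| * C) (integrable_normal_pdf m (2 * s))).
have key (x : R) : `|f x * g x| <= A * g x + `|A| * C * normal_pdf m (2 * s) x.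
  have g0 : 0 <= g x by exact: normal_pdf_ge0.
  rewrite normrM (ger0_norm g0).
  apply: (@le_trans _ _ (A * (1 + (x - m) ^+ 2) * g x)); first by apply: ler_wpM2r.
  rewrite [leLHS](_ : _ = A * g x + A * ((x - m) ^+ 2 * g x)); last by ring.
  rewrite lerD2l; have hS := sqr_normal_pdf_le x; rewrite -/C in hS.
  have S0 : 0 <= (x - m) ^+ 2 * g x by rewrite mulr_ge0// sqr_ge0.
  have hA := ler_norm A; have A0 := normr_ge0 A.
  apply: (@le_trans _ _ (`|A| * ((x - m) ^+ 2 * g x))); first by nra.
  by rewrite -mulrA; apply: ler_wpM2l.
apply: le_integrable (integrableD measurableT i1 i2) => //.
  by apply/measurable_EFinP; apply: measurable_funM => //; exact: measurable_normal_pdf.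
by move=> x _; rewrite /= lee_fin (le_trans (key x))// ler_norm.
Qed.

(** Stein's identity, by integrating the derivative of u g, where g' = - (x - m) g / s^2. Mean,
    variance and characteristic function of the normal law are read off from it with u = 1, u = x -
    m and u = sin (t x + a). *)
Lemma normal_stein (A : R) (u u' : R -> R) : continuous u' ->
  (forall x : R, is_derive x 1 u (u' x)) ->
  (forall x, `|u x| <= A * (1 + `|x - m|)) -> (forall x, `|u' x| <= A) ->
  \int[mu]_x ((x - m) * u x * g x) = s ^+ 2 * \int[mu]_x (u' x * g x).
Proof.
move=> cu' du uA u'A.
have sn0 : s != 0 by rewrite gt_eqF.
have A0 : 0 <= A by rewrite (le_trans _ (u'A 0)).
have cu : continuous u.
  by move=> x; apply: differentiable_continuous; apply/derivable1_diffP.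
have mu_ := continuous_measurable_fun cu.
have mu' := continuous_measurable_fun cu'.
have y0 (y : R) : 0 <= (`|y| - 1) ^+ 2 by exact: sqr_ge0.
have yy (y : R) : `|y| ^+ 2 = y ^+ 2 by rewrite real_normK ?num_real.
have i1 : mu.-integrable setT (EFin \o (fun x => u' x * g x)).
  apply: (integrable_normal_growth (A := A)) => // x.
  by rewrite (le_trans (u'A x))// ler_peMr// lerDl sqr_ge0.
have i2 : mu.-integrable setT (EFin \o (fun x => (x - m) * u x * g x)).
  apply: (integrable_normal_growth (A := 2 * A)) => [|x].
    by apply: measurable_funM => //; exact: measurable_funB.
  rewrite normrM (le_trans (ler_wpM2l (normr_ge0 _) (uA x)))//.
  have := y0 (x - m); rewrite -(yy (x - m)); set z := `|x - m| => hz.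
  have z0 : 0 <= z by exact: normr_ge0.
  have z2 : 0 <= z ^+ 2 by exact: sqr_ge0.
  rewrite -subr_ge0 (_ : _ - _ = A * (((z - 1) ^+ 2 + z ^+ 2 + 3) / 2)); last by field.
  by rewrite mulr_ge0// divr_ge0// !addr_ge0.
have i2' : mu.-integrable setT (EFin \o (fun x => - (s ^+ 2)^-1 * ((x - m) * u x * g x))).
  exact: (integrableZl _ (- (s ^+ 2)^-1) i2).
have cg : continuous g by apply: continuous_normal_pdf.
suff : \int[mu]_x (u' x * g x + - (s ^+ 2)^-1 * ((x - m) * u x * g x)) = 0.
  rewrite RintegralD// RintegralZl// mulNr => /eqP; rewrite subr_eq0 => /eqP ->.
  by rewrite mulVKf// expf_neq0.
(* Boundary terms: exp (- y) <= 1 / y at y = n^2 / (2 s^2) leaves a multiple of (1 + n) / n^2, which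
   is of order 1 / n. *)
have decay (F : R -> R) : (forall n, (0 < n)%N -> `|F n%:R| <= A * (1 + n%:R) * g (m + n%:R)) ->
    F n%:R @[n --> \oo] --> 0.
  move=> FA; set K := A * normal_peak s * (4 * s ^+ 2).
  have K0 : 0 <= K.
    by apply: mulr_ge0; apply: mulr_ge0 => //; [exact: normal_peak_ge0|exact: sqr_ge0].
  have cK : K * (harmonic n : R) @[n --> \oo] --> 0.
    by rewrite -[X in _ --> X](mulr0 K); apply: cvgMr; exact: cvg_harmonic.
  apply/cvgr0Pnorm_le => e e0; move/cvgr0Pnorm_le : cK => /(_ (e / 2)).
  rewrite divr_gt0// => /(_ isT) [N _ HN].
  exists N.+1 => // n /= nN.
  have n0 : (0 < n)%N by exact: leq_ltn_trans nN.
  apply: le_trans (FA n n0) _.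
  have nr0 : (0 : R) < n%:R by rewrite ltr0n.
  have n1 : (1 : R) <= n%:R by rewrite ler1n.
  have {HN} := HN n (ltnW nN); rewrite ger0_norm ?(mulr_ge0 K0) ?invr_ge0//=.
  rewrite gE (_ : m + n%:R - m = n%:R); last by rewrite addrC addKr.
  set y : R := n%:R in nr0 n1 *.
  have -> : - y ^+ 2 / (s ^+ 2 *+ 2) = - (y ^+ 2 / (s ^+ 2 *+ 2)) by rewrite mulNr.
  have p0 : 0 < y ^+ 2 / (s ^+ 2 *+ 2) by rewrite divr_gt0 ?exprn_gt0// pmulrn_lgt0// exprn_gt0.
  have : expR (- (y ^+ 2 / (s ^+ 2 *+ 2))) <= (s ^+ 2 *+ 2) / y ^+ 2.
    rewrite expRN -[X in _ <= X]invrK invf_div lef_pV2 ?posrE ?expR_gt0//.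
    by have := expR_ge1Dx (y ^+ 2 / (s ^+ 2 *+ 2)); lra.
  set ex := expR _ => hex hK.
  have Ap0 : 0 <= A * normal_peak s by rewrite mulr_ge0 ?normal_peak_ge0.
  apply: (@le_trans _ _ (A * normal_peak s * ((1 + y) * ((s ^+ 2 *+ 2) / y ^+ 2)))).
    rewrite (_ : A * (1 + y) * _ = A * normal_peak s * ((1 + y) * ex)); last by ring.
    by rewrite ler_wpM2l// ler_wpM2l// addr_ge0// ltW.
  have {}hK : K / n.+1%:R <= e / 2 by exact: hK.
  apply: (@le_trans _ _ (2 * (K / n.+1%:R))); last first.
    by rewrite mulrC -ler_pdivlMr.
  rewrite /K [leRHS]mulrA [2 * _]mulrC -!mulrA ler_wpM2l// ler_wpM2l ?normal_peak_ge0//.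
  rewrite [leRHS]mulrCA.
  have -> : (1 + y) * (s ^+ 2 *+ 2 / y ^+ 2) = s ^+ 2 * (2 * (1 + y) / y ^+ 2).
    by rewrite -mulr_natl; field; rewrite gt_eqF.
  rewrite -natr1 -/y.
  rewrite [leRHS](_ : _ = s ^+ 2 * (8 / (y + 1))); last first.
    by field; rewrite gt_eqF// addr_gt0.
  rewrite ler_pM2l ?exprn_gt0// ler_pdivrMr ?exprn_gt0// mulrAC ler_pdivlMr ?addr_gt0//.
  by nra.
apply: (@integral_deriv_eq0 m (fun x => u x * g x)
  (fun x => u' x * g x + - (s ^+ 2)^-1 * ((x - m) * u x * g x))).
- exact: (integrableD measurableT i1 i2').
- move=> x; apply: cvgD; first by apply: cvgM; [exact: cu'|exact: cg].
  apply: cvgM; first exact: cvg_cst.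
  apply: cvgM; last exact: cg.
  by apply: cvgM; [apply: cvgB; [exact: cvg_id|exact: cvg_cst]|exact: cu].
- move=> x; have := is_derive_normal_pdf x => dg.
  have dux := du x.
  apply: is_derive_eq; rewrite /GRing.scale/=; by field.
- apply: (decay (fun y => u (m + y) * g (m + y))) => n n0.
  rewrite normrM (ger0_norm (normal_pdf_ge0 _ _ _)) ler_wpM2r ?normal_pdf_ge0//.
  by rewrite (le_trans (uA _))// (_ : m + n%:R - m = n%:R) ?normr_nat// addrC addKr.
- apply: (decay (fun y => u (m - y) * g (m - y))) => n n0.
  rewrite normrM (ger0_norm (normal_pdf_ge0 _ _ _)).
  have -> : g (m + n%:R) = g (m - n%:R) by rewrite !gE; congr (_ * expR _); field.
  rewrite ler_wpM2r ?normal_pdf_ge0//.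
  by rewrite (le_trans (uA _))// (_ : m - n%:R - m = - n%:R) ?normrN ?normr_nat//; ring.
Qed.

End normal_law.

(** * Moments and characteristic functions of Gaussian variables *)

Section gaussian_charfun.
Context {d} {T : measurableType d} {R : realType} (P : probability T R).
Notation mu := (@lebesgue_measure R).

(** The change of variables is made for nonnegative integrands; a general f is the difference of f +
    |f| and |f|. *)
Lemma normal_rv_mean (X : {RV P >-> R}) (m s : R) (f : R -> R) :
  (forall A : set R, measurable A -> distribution P X A = normal_prob m s A) ->
  measurable_fun setT f ->
  mu.-integrable setT (EFin \o (fun x => f x * normal_pdf m s x)) ->
  integ P (f \o X) /\ mean P (f \o X) = \int[mu]_x (f x * normal_pdf m s x).
Proof.
move=> dX mf intf.
have ge0E (h : R -> R) : measurable_fun setT h -> (forall x, 0 <= h x) ->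
    (\int[P]_w (h (X w))%:E = \int[mu]_x (h x * normal_pdf m s x)%:E)%E.
  move=> mh h0; have mEh : measurable_fun setT (EFin \o h) by exact/measurable_EFinP.
  pose X' : T -> measurableTypeR R := X.
  have mX' : measurable_fun setT X' by move=> _ A mA; exact: (measurable_funP X).
  have mh' : measurable_fun [set: measurableTypeR R] (EFin \o h) by [].
  have h0' : {in [set: measurableTypeR R], forall y, (0 <= (EFin \o h) y)%E}.
    by move=> y _; rewrite /= lee_fin.
  have eP := ge0_integral_pushforward mX' P measurableT mh' h0'.
  rewrite preimage_setT in eP; rewrite -[LHS]eP.
  have mE' : measurable_fun setT X' by [].
  pose mX'_mixin := isMeasurableFun.Build _ _ _ _ _ mX'.
  pose mX'_pack : {mfun T >-> measurableTypeR R} := HB.pack X' mX'_mixin.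
  rewrite (@eq_measure_integral _ _ R setT (normal_prob m s) (pushforward P mX'_pack)
    (EFin \o h) (fun A mA _ => dX A mA)).
  rewrite integral_normal_prob//.
  exact: mX'.
have mpdf := measurable_normal_pdf m s.
have mabs : measurable_fun setT (fun x => `|f x|) by exact: measurableT_comp.
have key (x : R) : `| `|f x| * normal_pdf m s x | <= `|f x * normal_pdf m s x|.
  by rewrite !normrM normr_id.
have intabs : mu.-integrable setT (EFin \o (fun x => `|f x| * normal_pdf m s x)).
  apply: le_integrable intf => //.
    by apply/measurable_EFinP; exact: measurable_funM.
  by move=> x _; rewrite lee_fin; exact: key.
have mfX : measurable_fun setT (fun w => f (X w)) by exact: measurableT_comp.
have iabs : integ P (fun w => `|f (X w)|).
  apply/integrableP; split; first by apply/measurable_EFinP; apply: (measurableT_comp _ mfX).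
  under eq_integral do rewrite /= normr_id.
  rewrite (ge0E (fun x => `|f x|))//.
  move/integrableP : intabs => [_]; apply: le_lt_trans.
  apply: ge0_le_integral => //.
  - by move=> x _; rewrite lee_fin mulr_ge0 ?normal_pdf_ge0.
  - by apply/measurable_EFinP; exact: measurable_funM.
  - by apply/measurable_EFinP; apply: measurableT_comp => //; exact: measurable_funM.
  - move=> x _; rewrite lee_fin.
    have xx : 0 <= `|f x| * normal_pdf m s x by rewrite mulr_ge0 ?normal_pdf_ge0.
    exact: ler_norm.
have iX : integ P (f \o X).
  by apply: (integ_le (Y := fun w => `|f (X w)|)).
split => //.
have mfabs : measurable_fun setT (fun x => f x + `|f x|) by exact: measurable_funD.
have -> : f \o X = fun w => (f (X w) + `|f (X w)|) - `|f (X w)|.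
  by apply/funext => w; rewrite addrK.
rewrite meanB//; last exact: integD.
rewrite /Rintegral (ge0E (fun x => f x + `|f x|))//; last first.
  by move=> x; have := ler_norm (- f x); rewrite normrN; lra.
rewrite (ge0E (fun x => `|f x|))// -!/(Rintegral _ _ _).
rewrite -RintegralB//; last first.
  under [X in EFin \o X]eq_fun do rewrite mulrDl.
  exact: (integrableD measurableT intf intabs).
by apply: eq_Rintegral => x _; rewrite mulrDl addrK.
Qed.

Lemma is_derive_cos_lin (x a t : R) :
  is_derive t 1 (fun t => cos (t * x + a)) (- (x * sin (t * x + a))).
Proof. by apply: is_derive_eq; rewrite /GRing.scale/=; ring. Qed.

Lemma normal_rv_sqint (X : {RV P >-> R}) (m s : R) : 0 < s ->
  (forall A : set R, measurable A -> distribution P X A = normal_prob m s A) ->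
  [/\ sqint P X, mean P X = m & mean P (fun w => (X w - m) ^+ 2) = s ^+ 2].
Proof.
move=> s0 dX; have sn0 : s ^+ 2 != 0 by rewrite expf_neq0 ?gt_eqF.
have mid : measurable_fun setT (fun x : R => x - m) by exact: measurable_funB.
have m2 : measurable_fun setT (fun x : R => (x - m) ^+ 2) by exact: measurable_funX.
have g2 (x : R) : `|(x - m) ^+ 2| <= 1 * (1 + (x - m) ^+ 2).
  by rewrite ger0_norm ?sqr_ge0// mul1r; lra.
have [i2 e2] := normal_rv_mean dX m2 (integrable_normal_growth s0 m2 g2).
have g1 (x : R) : `|x - m| <= 1 * (1 + (x - m) ^+ 2).
  have := sqr_ge0 (`|x - m| - 1); rewrite -(@real_normK _ (x - m)) ?num_real//.
  set z := `|x - m|; have : 0 <= z by exact: normr_ge0.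
  nra.
have [i1 e1] := normal_rv_mean dX mid (integrable_normal_growth s0 mid g1).
have mX : measurable_fun setT X by [].
have mpdf1 : \int[mu]_x (normal_pdf m s x) = 1 by rewrite /Rintegral integral_normal_pdf.
have sXm : sqint P (fun w => X w - m) by split => //; exact: measurable_funB.
have sX : sqint P X.
  have -> : (X : T -> R) = (fun w => (X w - m) + m) by apply/funext => w; rewrite subrK.
  by apply: sqintD => //; exact: sqint_cst.
have E0 : mean P (fun w => X w - m) = 0.
  rewrite e1.
  have -> : \int[mu]_x ((x - m) * normal_pdf m s x) =
            \int[mu]_x ((x - m) * (cst 1 : R -> R) x * normal_pdf m s x).
    by apply: eq_Rintegral => x _; rewrite mulr1.
  rewrite (@normal_stein _ _ _ s0 1 (cst 1) (cst 0)).
  - rewrite [X in _ * X](_ : _ = 0) ?mulr0//.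
    by under eq_Rintegral do rewrite mul0r; rewrite /Rintegral integral0.
  - exact: cst_continuous.
  - by move=> x; rewrite normr1 mul1r lerDl.
  - by move=> x; rewrite normr0.
split => //.
  move: E0; rewrite (meanB (sqint_integ sX) (integ_cst P m)) mean_cst => /eqP.
  by rewrite subr_eq0 => /eqP.
rewrite e2.
have -> : \int[mu]_x ((x - m) ^+ 2 * normal_pdf m s x) =
          \int[mu]_x ((x - m) * (x - m) * normal_pdf m s x) by [].
have c1 : continuous (cst 1 : R -> R) by exact: cst_continuous.
have d1 (x : R) : is_derive x 1 (fun x : R => x - m) (cst 1 x).
  by apply: is_derive_eq; rewrite subr0.
have u1 (x : R) : `|x - m| <= 1 * (1 + `|x - m|) by rewrite mul1r lerDr.
have u1' (x : R) : `|cst 1 x : R| <= 1 by rewrite normr1.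
rewrite (normal_stein s0 c1 d1 u1 u1').
by under eq_Rintegral do rewrite mul1r; rewrite mpdf1 mulr1.
Qed.

(** By differentiation under the integral and [normal_stein], y(t) = E[cos (t X + a)] solves y' = -
    s^2 t y, hence y(t) exp (s^2 t^2 / 2) is constant. The free phase a covers the sine as well and
    replaces complex exponentials. *)
Lemma normal_rv_charfun (X : {RV P >-> R}) (s a : R) : 0 < s ->
  (forall A : set R, measurable A -> distribution P X A = normal_prob 0 s A) ->
  mean P (fun w => cos (X w + a)) = cos a * expR (- s ^+ 2 / 2).
Proof.
move=> s0 dX.
have [sX _ _] := normal_rv_sqint s0 dX.
have mX : measurable_fun setT X by [].
have mlin t : measurable_fun setT (fun w => t * X w + a).
  by apply: measurable_funD => //; exact: measurable_funM.
have mcos t : measurable_fun setT (fun w => cos (t * X w + a)).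
  by apply: measurableT_comp (mlin t); exact: measurable_cos.
pose y t := mean P (fun w => cos (t * X w + a)).
have stein t : mean P (fun w => X w * sin (t * X w + a)) = s ^+ 2 * (t * y t).
  have clin : continuous (fun x : R => t * x + a).
    move=> x; apply: cvgD; last exact: cvg_cst.
    by apply: cvgM; [exact: cvg_cst|exact: cvg_id].
  have csin : continuous (fun x : R => sin (t * x + a)).
    by move=> x; apply: continuous_comp; [exact: clin|exact: continuous_sin].
  have ccos : continuous (fun x : R => cos (t * x + a)).
    by move=> x; apply: continuous_comp; [exact: clin|exact: continuous_cos].
  have sle (x : R) : `|sin x| <= 1 by rewrite ler_norml sin_geN1 sin_le1.
  have cle (x : R) : `|cos x| <= 1 by rewrite ler_norml cos_geN1 cos_le1.
  have mxs : measurable_fun setT (fun x : R => x * sin (t * x + a)).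
    by apply: measurable_funM => //; exact: continuous_measurable_fun.
  have mcs : measurable_fun setT (fun x : R => cos (t * x + a)).
    exact: continuous_measurable_fun.
  have g1 (x : R) : `|x * sin (t * x + a)| <= 1 * (1 + (x - 0) ^+ 2).
    rewrite normrM (le_trans (ler_wpM2l (normr_ge0 _) (sle _)))// mulr1 mul1r subr0.
    have := sqr_ge0 (`|x| - 1); rewrite -(@real_normK _ x) ?num_real//.
    set z := `|x|; have : 0 <= z by exact: normr_ge0.
    nra.
  have g2 (x : R) : `|cos (t * x + a)| <= 1 * (1 + (x - 0) ^+ 2).
    by rewrite (le_trans (cle _))// mul1r lerDl sqr_ge0.
  have [_ e1] := normal_rv_mean dX mxs (integrable_normal_growth s0 mxs g1).
  have [_ e2] := normal_rv_mean dX mcs (integrable_normal_growth s0 mcs g2).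
  have -> : mean P (fun w => X w * sin (t * X w + a)) =
    \int[mu]_x ((x - 0) * sin (t * x + a) * normal_pdf 0 s x).
    by rewrite -[LHS]/(mean P ((fun x => x * sin (t * x + a)) \o X)) e1;
       apply: eq_Rintegral => x _; rewrite subr0.
  have c1 : continuous (fun x : R => t * cos (t * x + a)).
    by move=> x; apply: cvgM; [exact: cvg_cst|exact: ccos].
  have d1 (x : R) : is_derive x 1 (fun x => sin (t * x + a)) (t * cos (t * x + a)).
    by apply: is_derive_eq; rewrite /GRing.scale/=; ring.
  have u1 (x : R) : `|sin (t * x + a)| <= (1 + `|t|) * (1 + `|x - 0|).
    rewrite (le_trans (sle _))//; have := normr_ge0 (x - 0); have := normr_ge0 t.
    by move: `|t| `|x - 0| => p q; nra.
  have u1' (x : R) : `|t * cos (t * x + a)| <= 1 + `|t|.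
    rewrite normrM (le_trans (ler_wpM2l (normr_ge0 _) (cle _)))// mulr1.
    by rewrite lerDr.
  rewrite (normal_stein s0 c1 d1 u1 u1').
  congr (_ * _); rewrite /y -[mean P _]/(mean P ((fun x => cos (t * x + a)) \o X)) e2.
  rewrite -RintegralZl//; last exact: (integrable_normal_growth s0 mcs g2).
  by apply: eq_Rintegral => x _; rewrite mulrA.
have dy (t : R) : is_derive t 1 y (- (s ^+ 2 * (t * y t))).
  pose f (t : R) w := cos (t * X w + a).
  have d1f u w : partial1of2 f u w = - (X w * sin (u * X w + a)).
    by rewrite /partial1of2 /= derive1E; have := is_derive_cos_lin (X w) a u; case.
  have It : `]t - 1, t + 1[%classic t by rewrite /= in_itv/=; lra.
  have intf x : `]t - 1, t + 1[%classic x -> P.-integrable setT (EFin \o f x).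
    move=> _; apply: (@integ_bounded _ _ _ P _ 1) => [|w]; first exact: mcos.
    by rewrite /f ler_norml cos_geN1 cos_le1.
  have derf x w : `]t - 1, t + 1[%classic x -> setT w -> derivable (f ^~ w) x 1.
    by move=> _ _; have := is_derive_cos_lin (X w) a x; case.
  have G0 w : 0 <= `|X w| by [].
  have iG : P.-integrable setT (EFin \o (fun w => `|X w|)).
    by apply: integrable_norm; exact: sqint_integ.
  have Gub x w : `]t - 1, t + 1[%classic x -> setT w -> `|partial1of2 f x w| <= `|X w|.
    move=> _ _; rewrite d1f normrN normrM ler_piMr//.
    by rewrite ler_norml sin_geN1 sin_le1.
  apply: DeriveDef.
    exact: (derivable_under_integral measurableT It intf derf G0 iG Gub).
  rewrite -derive1E (differentiation_under_integral measurableT It intf derf G0 iG Gub).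
  rewrite -stein -[RHS]mulN1r -RintegralZl//; first by apply: eq_Rintegral => w _; rewrite d1f mulN1r.
  apply: (@integ_le _ _ _ P _ (fun w => `|X w|)) => //.
    apply: measurable_funM => //; apply: measurableT_comp (mlin t).
    exact: measurable_sin.
  move=> w; rewrite normrM ler_piMr//.
  by rewrite ler_norml sin_geN1 sin_le1.
pose z t := y t * expR (s ^+ 2 * t ^+ 2 / 2).
have dz (t : R) : is_derive t 1 z 0.
  by have := dy t => dyt; apply: is_derive_eq; rewrite /GRing.scale/=; field.
have z10 := @is_derive_0_is_cst _ z 1 0 dz.
move: z10; rewrite /z expr0n/= mulr0 mul0r expR0 mulr1 expr1n mulr1 => z10.
have y1E : y 1 = mean P (fun w => cos (X w + a)).
  by rewrite /y; under eq_Rintegral do rewrite mul1r.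
have y0E : y 0 = cos a.
  by rewrite /y; under eq_Rintegral do rewrite mul0r add0r; rewrite mean_cst.
by rewrite -y1E -y0E -z10 -mulrA -expRD mulNr subrr expR0 mulr1.
Qed.

Lemma dirac_rv_ae (X : {RV P >-> R}) (m : R) :
  (forall A : set R, measurable A -> distribution P X A = dirac m A) ->
  {ae P, forall w, X w = m}.
Proof.
move=> dX; have mm : measurable (~` [set m] : set R) by exact: measurableC.
exists (X @^-1` (~` [set m])); split.
- by rewrite -[X in measurable X]setTI; exact: measurable_funP.
- have : distribution P X (~` [set m]) = 0%E.
    by rewrite dX// diracE memNset//= => /(_ erefl).
  by [].
- by move=> w.
Qed.

Lemma gaussian_rv_sqint (X : {RV P >-> R}) : gaussian_rv X -> sqint P X.
Proof.
case=> [[m dX]|[m [s [s0 dX]]]]; last by have [] := normal_rv_sqint s0 dX.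
have Xm := dirac_rv_ae dX.
split; first by [].
apply: (integ_ae (X := fun=> m ^+ 2)); [exact: measurable_funX|exact: integ_cst|].
by apply: filterS Xm => w ->.
Qed.

Lemma gaussian_rv_charfun (X : {RV P >-> R}) (a : R) : gaussian_rv X -> mean P X = 0 ->
  mean P (fun w => cos (X w + a)) = cos a * expR (- mean P (fun w => X w ^+ 2) / 2).
Proof.
case=> [[m dX]|[m [s [s0 dX]]]] EX.
  have mX : measurable_fun setT X by [].
  have Xm := dirac_rv_ae dX.
  have m0 : m = 0 by rewrite -EX -[LHS](mean_cst P); apply: mean_ae => //; apply: filterS Xm => w ->.
  have -> : mean P (fun w => cos (X w + a)) = mean P (fun=> cos a).
    apply: mean_ae => //; last by apply: filterS Xm => w ->; rewrite m0 add0r.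
    apply: measurableT_comp; first exact: measurable_cos.
    exact: measurable_funD.
  have -> : mean P (fun w => X w ^+ 2) = mean P (fun=> 0).
    apply: mean_ae => //; last by apply: filterS Xm => w ->; rewrite m0 expr0n.
    exact: measurable_funX.
  by rewrite !mean_cst oppr0 mul0r expR0 mulr1.
have [sX Xm Xs] := normal_rv_sqint s0 dX.
have m0 : m = 0 by rewrite -Xm.
rewrite m0 in dX Xs.
rewrite (normal_rv_charfun a s0 dX) -Xs.
by under eq_Rintegral do rewrite subr0.
Qed.

End gaussian_charfun.

(** * Elementary limits *)

Section real_lemmas.
Context {R : realType}.
Implicit Types x y : R.

Lemma bernoulli_ineq x n : -1 <= x -> 1 + n%:R * x <= (1 + x) ^+ n.
Proof.
move=> x1; elim: n => [|n IH]; first by rewrite mul0r addr0 expr0.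
rewrite exprSr; have x0 : 0 <= 1 + x by lra.
apply: le_trans (ler_wpM2r x0 IH); rewrite -natr1.
have := sqr_ge0 x; have : (0 : R) <= n%:R by []. nra.
Qed.

(** Write x = y^2. By Bernoulli's inequality for 1 / y the sequence n y^n is bounded, and the
    remaining factor y^n tends to 0. *)
Lemma mulrn_expr_cvg0 x : 0 <= x -> x < 1 -> n%:R * x ^+ n @[n --> \oo] --> 0.
Proof.
rewrite le_eqVlt => /predU1P[<- _|x0 x1].
  apply: cvg_near_cst; exists 1%N => // -[|n] //= _.
  by rewrite expr0n/= mulr0.
set y := Num.sqrt x; have y0 : 0 < y by rewrite sqrtr_gt0.
have yy : y ^+ 2 = x by rewrite sqr_sqrtr// ltW.
have y1 : y < 1 by rewrite -(@ltr_pXn2r _ 2)// ?nnegrE ?ltW// yy expr1n.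
set h := y^-1 - 1; have h0 : 0 < h by rewrite subr_gt0 invf_gt1.
have b n : n%:R * y ^+ n <= h^-1.
  have H : n%:R * h <= y ^- n.
    have hE : 1 + h = y^-1 by rewrite /h; ring.
    have h1 : -1 <= h by lra.
    by have := bernoulli_ineq n h1; rewrite hE exprVn; lra.
  rewrite -[leRHS]mul1r ler_pdivlMr// mulrAC -ler_pdivlMr ?exprn_gt0//.
  by rewrite mul1r.
have c0 : h^-1 * y ^+ n @[n --> \oo] --> 0.
  rewrite -[X in _ --> X](mulr0 h^-1); apply: cvgMr; apply: cvg_expr.
  by rewrite ger0_norm// ltW.
apply: squeeze_cvgr (cvg_cst 0) c0; apply: nearW => n /=.
have xn : x ^+ n = y ^+ n * y ^+ n by rewrite -exprD addnn -mul2n exprM yy.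
have yn : 0 <= y ^+ n by rewrite exprn_ge0// ltW.
apply/andP; split; first by rewrite mulr_ge0// xn mulr_ge0.
by rewrite xn mulrA ler_wpM2r.
Qed.

(* (1 - y^n)^(n 2^n) converges to the indicator of [0, 1/2) on [0, 1]; the exponent makes
   n (2y)^n the critical quantity, so that the limit at y = 1/2 is 0. *)
Lemma threshold_cvg y : 0 <= y -> y <= 1 ->
  (1 - y ^+ n) ^+ (n * 2 ^ n) @[n --> \oo] --> ((y < 2^-1)%R%:R : R).
Proof.
move=> y0 y1.
have yn n : 0 <= y ^+ n <= 1 by rewrite exprn_ge0// exprn_ile1.
have yn' n : 0 <= 1 - y ^+ n <= 1 by have := yn n; lra.
have [ylt|yge] := ltP y 2^-1; rewrite /= ?mulr1n ?mulr0n.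
  have c0 : (1 - n%:R * (2 * y) ^+ n) @[n --> \oo] --> (1 - 0 : R).
    by apply: cvgB; [exact: cvg_cst|apply: mulrn_expr_cvg0; lra].
  rewrite subr0 in c0; apply: (squeeze_cvgr _ c0 (cvg_cst _)); apply: nearW => n /=.
  apply/andP; split; last first.
    by rewrite exprn_ile1//; have := yn' n => /andP[].
  have := @bernoulli_ineq (- y ^+ n) (n * 2 ^ n).
  have -> : -1 <= - y ^+ n by have := yn n; lra.
  by move=> /(_ isT); rewrite natrM natrX exprMn mulrN mulrA.
apply: (squeeze_cvgr _ (cvg_cst _) (@cvg_harmonic R)); apply: nearW => n /=.
have := yn' n => /andP[a0 a1].
rewrite exprn_ge0//=.
have H : 1 + n%:R <= (1 + y ^+ n) ^+ (n * 2 ^ n).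
  have := @bernoulli_ineq (y ^+ n) (n * 2 ^ n).
  have -> : -1 <= y ^+ n by have := yn n; lra.
  move=> /(_ isT); apply: le_trans; rewrite lerD2l natrM natrX -mulrA -exprMn.
  by rewrite ler_peMr// exprn_ege1//; lra.
rewrite -[leRHS]mul1r ler_pdivlMr// -natr1 [n%:R + 1]addrC.
apply: le_trans (ler_wpM2l _ H) _; first exact: exprn_ge0.
rewrite -exprMn exprn_ile1//; have := yn n; set z := y ^+ n; nra.
Qed.

Lemma sin_le_norm x : `|sin x| <= `|x|.
Proof.
have H (y : R) : 0 < y -> `|sin y| <= `|y|.
  move=> y0; have [|c _] := @MVT R sin cos 0 y y0 (fun z _ => is_derive_sin z).
    by apply: continuous_subspaceT; exact: continuous_sin.
  by rewrite sin0 !subr0 => ->; rewrite normrM ler_piMl// ler_norml cos_geN1 cos_le1.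
have [x0|] := ltP 0 x; first by apply: H.
rewrite le_eqVlt => /predU1P[->|x0]; first by rewrite sin0 normr0.
by rewrite -(normrN x) -(normrN (sin x)) -sinN; apply: H; rewrite oppr_gt0.
Qed.

(** Derivative of t |-> sin (t x) at 0, taken along t = 1 / (n + 1). *)
Lemma sin_quotient_cvg x :
  sin (x * n.+1%:R^-1) * n.+1%:R @[n --> \oo] --> x.
Proof.
have d : is_derive (0 : R) 1 (fun t : R => sin (t * x)) x.
  by apply: is_derive_eq; rewrite mul0r cos0 /GRing.scale/=; ring.
have [dd de] := d.
have /cvg_ex[/= l fl] := dd.
have lx : l = x by rewrite -de; apply/esym/cvg_lim.
rewrite lx in fl => {lx de dd d}.
move/cvgr_dnbhsP : fl => /(_ (@harmonic R)).
have h0 : (forall n, (@harmonic R) n != 0) /\ (@harmonic R) n @[n --> \oo] --> 0.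
  by split => [n|]; [rewrite /harmonic/= invr_neq0//|exact: cvg_harmonic].
move=> /(_ h0); apply: cvg_trans; apply: near_eq_cvg; apply: nearW => n.
rewrite /harmonic/= invrK mul0r sin0 subr0 addr0 /GRing.scale/= mulr1.
by rewrite mulrC [x * _]mulrC.
Qed.

(** Squeeze, with z = x / (n + 1)^2, from 1 + z <= exp z and 1 - z <= exp (- z). *)
Lemma expR_quotient_cvg x : 0 <= x ->
  (1 - expR (- (x / n.+1%:R ^+ 2))) * n.+1%:R ^+ 2 @[n --> \oo] --> x.
Proof.
move=> x0.
have c1 : x / (1 + x / n.+1%:R ^+ 2) @[n --> \oo] --> x.
  have c2 : (1 + x / n.+1%:R ^+ 2) @[n --> \oo] --> (1 + x * (0 * 0) : R).
    apply: cvgD; first exact: cvg_cst.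
    apply: cvgM; first exact: cvg_cst.
    under eq_fun do rewrite -exprVn expr2.
    by apply: cvgM; exact: cvg_harmonic.
  rewrite !mulr0 addr0 in c2.
  rewrite -[X in _ --> X]mulr1 -[X in x * X]invr1.
  by apply: cvgM; [exact: cvg_cst|apply: cvgV => //; exact: oner_neq0].
apply: (squeeze_cvgr _ c1 (cvg_cst _)); apply: nearW => n /=.
set m : R := n.+1%:R ^+ 2; have n0 : 0 < m by rewrite exprn_gt0.
set z := x / m; have z0 : 0 <= z by rewrite divr_ge0// ltW.
have xz : x = z * m by rewrite /z divfK// gt_eqF.
rewrite {1 2}xz mulrAC ![_ * m]mulrC !ler_pM2l//; apply/andP; split; last first.
  by have := expR_ge1Dx (- z); lra.
rewrite expRN lerBrDr -lerBrDl.
have z1 : 0 < 1 + z by lra.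
have -> : 1 - z / (1 + z) = (1 + z)^-1 by field; rewrite gt_eqF.
by rewrite lef_pV2 ?posrE ?expR_gt0// expR_ge1Dx.
Qed.

End real_lemmas.

(** * From trigonometric test functions to indicators of the generated sigma-algebra *)

Section multipliers.
Context {d} {T : measurableType d} {R : realType} (P : probability T R).
Implicit Types (X Y u V : T -> R) (K : set (T -> R)).
Local Notation meas X := (measurable_fun setT X).

Definition bdd X := meas X /\ exists M, forall w, `|X w| <= M.

Lemma bdd_integ X : bdd X -> integ P X.
Proof. by move=> [mX [M XM]]; exact: integ_bounded XM. Qed.

Lemma bddM X Y : bdd X -> bdd Y -> bdd (fun w => X w * Y w).
Proof.
move=> [mX [M XM]] [mY [N YN]]; split; first exact: measurable_funM.
by exists (M * N) => w; rewrite normrM ler_pM.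
Qed.

Lemma bdd_lin X (a : R) Y : bdd X -> bdd Y -> bdd (fun w => X w + a * Y w).
Proof.
move=> [mX [M XM]] [mY [N YN]]; split.
  by apply: measurable_funD => //; exact: measurable_funM.
exists (M + `|a| * N) => w; rewrite (le_trans (ler_normD _ _))// lerD//.
by rewrite normrM ler_wpM2l.
Qed.

Lemma bdd_cst (a : R) : bdd (fun=> a).
Proof. by split; [exact: measurable_cst|exists `|a|]. Qed.

Lemma bdd_cos X : meas X -> bdd (fun w => cos (X w)).
Proof.
move=> mX; split; first by apply: measurableT_comp mX; exact: measurable_cos.
by exists 1 => w; rewrite ler_norml cos_geN1 cos_le1.
Qed.

Lemma bdd_indic (A : set T) : measurable A -> bdd (\1_A : T -> R).
Proof.
move=> mA; split; first exact: measurable_indic.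
by exists 1 => w; rewrite indicE; case: (_ \in _); rewrite ?normr1 ?normr0.
Qed.

Definition lin_subspace K :=
  K (fun=> 0) /\ forall (a : R) X Y, K X -> K Y -> K (fun w => X w + a * Y w).

Lemma lin_subspaceZ K (a : R) X : lin_subspace K -> K X -> K (fun w => a * X w).
Proof.
move=> [K0 KD] KX; have := KD a _ _ K0 KX.
by under eq_fun do rewrite add0r.
Qed.

Lemma lin_subspaceB K X Y : lin_subspace K -> K X -> K Y -> K (fun w => X w - Y w).
Proof.
move=> [K0 KD] KX KY; have := KD (-1) _ _ KX KY.
by under eq_fun do rewrite mulN1r.
Qed.

Lemma lin_subspaceD K X Y : lin_subspace K -> K X -> K Y -> K (fun w => X w + Y w).
Proof.
move=> [K0 KD] KX KY; have := KD 1 _ _ KX KY.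
by under eq_fun do rewrite mul1r.
Qed.

(** Stands for E[V | sigma(K)] = 0, tested on trigonometric functions of single members of K; the
    phase a gives cosines and sines at once. *)
Definition trig_null K V := forall k (a : R), K k ->
  mean P (fun w => V w * cos (k w + a)) = 0.

(** Asking that u preserve [trig_null], rather than that E[V u] = 0, makes multipliers closed under
    products by composition. *)
Definition multiplier K u := bdd u /\
  forall V, bdd V -> trig_null K V -> trig_null K (fun w => V w * u w).

Variable K : set (T -> R).
Hypotheses (Klin : lin_subspace K) (Kmeas : forall k, K k -> meas k).

Let bcos k a : K k -> bdd (fun w => cos (k w + a)).
Proof. by move=> Kk; apply: bdd_cos; apply: measurable_funD => //; exact: Kmeas. Qed.

Lemma multiplier_cst a : multiplier K (fun=> a).
Proof.
split=> [|V bV nV k b Kk]; first exact: bdd_cst.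
rewrite -[RHS](mulr0 a) -(nV k b Kk) -meanZ; last by apply: bdd_integ; exact: bddM (bcos b Kk).
by congr (mean P _); apply/funext => w; ring.
Qed.

Lemma multiplierM u1 u2 : multiplier K u1 -> multiplier K u2 ->
  multiplier K (fun w => u1 w * u2 w).
Proof.
move=> [b1 m1] [b2 m2]; split=> [|V bV nV]; first exact: bddM.
under eq_fun do rewrite mulrA.
by apply: m2; [exact: bddM|exact: m1].
Qed.

Lemma multiplier_lin u1 (a : R) u2 : multiplier K u1 -> multiplier K u2 ->
  multiplier K (fun w => u1 w + a * u2 w).
Proof.
move=> [b1 m1] [b2 m2]; split=> [|V bV nV k c Kk]; first exact: bdd_lin.
have -> : (fun w => V w * (u1 w + a * u2 w) * cos (k w + c)) =
  (fun w => V w * u1 w * cos (k w + c) + a * (V w * u2 w * cos (k w + c))).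
  by apply/funext => w; ring.
have i u : bdd u -> integ P (fun w => V w * u w * cos (k w + c)).
  by move=> bu; apply: bdd_integ; apply: bddM (bcos c Kk); exact: bddM.
rewrite meanD ?meanZ; [|exact: i|exact: i|by apply: integZ; exact: i].
by rewrite (m1 V bV nV k c Kk) (m2 V bV nV k c Kk) mulr0 addr0.
Qed.

Lemma multiplierX u n : multiplier K u -> multiplier K (fun w => u w ^+ n).
Proof.
move=> mu; elim: n => [|n IH]; first exact: multiplier_cst.
by under eq_fun do rewrite exprS; exact: multiplierM.
Qed.

(** Product-to-sum formula: k + h and k - h stay in the linear space K. *)
Lemma multiplier_cos k a : K k -> multiplier K (fun w => cos (k w + a)).
Proof.
move=> Kk; split=> [|V bV nV h b Kh]; first exact: bcos.
have -> : (fun w => V w * cos (k w + a) * cos (h w + b)) =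
  (fun w => 2^-1 * (V w * cos ((k w + h w) + (a + b))) +
            2^-1 * (V w * cos ((k w - h w) + (a - b)))).
  apply/funext => w.
  have -> : k w + h w + (a + b) = (k w + a) + (h w + b) by ring.
  have -> : k w - h w + (a - b) = (k w + a) - (h w + b) by ring.
  by rewrite (cosD (k w + a)) (cosB (k w + a)); field.
have K1 := lin_subspaceD Klin Kk Kh.
have K2 := lin_subspaceB Klin Kk Kh.
have i1 : integ P (fun w => V w * cos ((k w + h w) + (a + b))).
  by apply: bdd_integ; apply: bddM (bcos _ K1).
have i2 : integ P (fun w => V w * cos ((k w - h w) + (a - b))).
  by apply: bdd_integ; apply: bddM (bcos _ K2).
rewrite meanD ?meanZ//; [|exact: integZ|exact: integZ].
by rewrite (nV _ (a + b) K1) (nV _ (a - b) K2) !mulr0 addr0.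
Qed.

(** Bounded convergence in the defining identity; this leads from polynomials in a multiplier to
    indicators. *)
Lemma multiplier_lim (u_ : nat -> T -> R) u M :
  (forall n, multiplier K (u_ n)) -> (forall n w, `|u_ n w| <= M) ->
  (forall w, u_ n w @[n --> \oo] --> u w) -> multiplier K u.
Proof.
move=> mu_ uM cu.
have mu : meas u.
  by apply: (measurable_fun_cvg (h := u_)) => [n|w _]; [case: (mu_ n) => -[]|exact: cu].
have bu : bdd u.
  split => //; exists M => w.
  have cn : `|u_ n w| @[n --> \oo] --> `|u w| by apply: cvg_norm; exact: cu.
  rewrite -(cvg_lim (@Rhausdorff R) cn); apply: limr_le; first by apply/cvg_ex; exists `|u w|.
  exact: nearW.
split => // V bV nV k a Kk.
have [mV [N VN]] := bV.
have [mcos _] := bcos a Kk.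
have c0 : mean P (fun w => V w * u_ n w * cos (k w + a)) @[n --> \oo] -->
          mean P (fun w => V w * u w * cos (k w + a)).
  apply: (mean_dct (Y := fun=> N * M)).
  - by move=> n; case: (mu_ n) => -[m _] _; do 2 apply: measurable_funM => //.
  - by do 2 apply: measurable_funM => //.
  - apply: aeW => w; apply: cvgM; last exact: cvg_cst.
    by apply: cvgM; [exact: cvg_cst|exact: cu].
  - exact: integ_cst.
  - move=> n w; rewrite normrM -[leRHS]mulr1 ler_pM// ?normrM ?ler_pM//.
    by rewrite ler_norml cos_geN1 cos_le1.
rewrite -(cvg_lim (@Rhausdorff R) c0); apply/cvg_lim => //; apply: cvg_near_cst.
by apply: nearW => n; case: (mu_ n) => _ mn; exact: mn.
Qed.

Lemma multiplier_threshold u : multiplier K u -> (forall w, 0 <= u w <= 1) ->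
  multiplier K (fun w => (u w < 2^-1)%R%:R).
Proof.
move=> mu u01.
apply: (multiplier_lim (u_ := fun n w => (1 - u w ^+ n) ^+ (n * 2 ^ n)) (M := 1)).
- move=> n; apply: multiplierX.
  have := multiplier_lin (-1) (multiplier_cst 1) (multiplierX n mu).
  by under eq_fun do rewrite mulN1r.
- move=> n w; have /andP[u0 u1] := u01 w.
  have un : 0 <= u w ^+ n <= 1 by rewrite exprn_ge0// exprn_ile1.
  by rewrite ger0_norm ?exprn_ge0 ?exprn_ile1//; lra.
- by move=> w; have /andP[u0 u1] := u01 w; exact: threshold_cvg.
Qed.

(** An unbounded k is reached through its bounded sine. For each w, once e is small, e k(w) and e a
    lie where the sine is increasing, and k(w) < a amounts to sin (e k(w)) < sin (e a). *)
Lemma multiplier_lt k (a : R) : K k -> multiplier K (fun w => (k w < a)%R%:R).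
Proof.
move=> Kk.
pose e n : R := n.+1%:R^-1.
have e0 n : 0 < e n by rewrite invr_gt0.
have ce : e n @[n --> \oo] --> 0 by exact: cvg_harmonic.
apply: (multiplier_lim (u_ := fun n w => (sin (e n * k w) < sin (e n * a))%R%:R) (M := 1)).
- move=> n; set c := sin (e n * a).
  (* As |sin| <= 1, this affine map puts the comparison of sines into [0, 1] with threshold 1/2, as
     [multiplier_threshold] requires; the shift by pi / 2 turns the sine into a cosine of a member
     of K. *)
  have -> : (fun w => (sin (e n * k w) < c)%R%:R) =
    (fun w => ((2^-1 - 4^-1 * c + 4^-1 * cos (e n * k w + - (pi / 2)) < 2^-1)%R%:R : R)).
    by apply/funext => w; rewrite cosBpihalf; congr (nat_of_bool _)%:R; apply/idP/idP; lra.
  apply: multiplier_threshold.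
    apply: multiplier_lin; first exact: multiplier_cst.
    by apply: (@multiplier_cos (fun w => e n * k w)); exact: lin_subspaceZ.
  move=> w; rewrite cosBpihalf.
  have := sin_geN1 (e n * k w); have := sin_le1 (e n * k w).
  by have := sin_geN1 (e n * a); have := sin_le1 (e n * a); rewrite -/c; lra.
- by move=> n w; case: (_ < _); rewrite ?normr1 ?normr0.
- move=> w; apply: cvg_near_cst.
  have inI (x : R) : \forall n \near \oo, e n * x \in `[ (- (pi/2)), pi/2].
    have : e n * x @[n --> \oo] --> 0 * x by apply: cvgM => //; exact: cvg_cst.
    rewrite mul0r => /cvgr0Pnorm_le /(_ (pi / 2)).
    rewrite divr_gt0 ?pi_gt0// => /(_ isT); apply: filterS => n.
    by rewrite in_itv/= -ler_norml.
  near=> n; congr (nat_of_bool _)%:R.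
  by rewrite ltr_sin ?ltr_pM2l//; near: n; exact: inI.
Unshelve. all: end_near. Qed.

Definition multiplier_set (A : set T) := measurable A /\ multiplier K (\1_A).

Lemma multiplier_set_sigma_algebra : sigma_algebra setT multiplier_set.
Proof.
split.
- by split => //; rewrite indic0; exact: multiplier_cst.
- move=> A [mA uA]; rewrite setTD; split; first exact: measurableC.
  have := multiplier_lin (-1) (multiplier_cst 1) uA.
  by congr multiplier; apply/funext => w; rewrite mulN1r !indicE in_setC; case: (_ \in _) => /=; lra.
- move=> A mA; split; first by apply: bigcupT_measurable => n; case: (mA n).
  (* [1 - v n] is the indicator of the union of the first n sets. *)
  pose v n w : R := \prod_(i < n) (1 + (-1) * \1_(A i) w).
  have mv n : multiplier K (v n).
    elim: n => [|n IH].
      by rewrite /v; under eq_fun do rewrite big_ord0; exact: multiplier_cst.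
    rewrite /v; under eq_fun do rewrite big_ord_recr/=.
    apply: multiplierM => //; apply: multiplier_lin; first exact: multiplier_cst.
    by case: (mA n).
  apply: (multiplier_lim (u_ := fun n w => 1 + (-1) * v n w) (M := 1)).
  - by move=> n; apply: multiplier_lin => //; exact: multiplier_cst.
  - move=> n w; have : 0 <= v n w <= 1.
      rewrite /v; elim: n => [|n /andP[IH0 IH1]]; first by rewrite big_ord0 ler01 lexx.
      by rewrite big_ord_recr/= indicE; case: (_ \in _) => /=; rewrite ?mulr0 ?mulr1; lra.
    by rewrite ler_norml; lra.
  - move=> w; rewrite indicE; case: (boolP (w \in _)) => /= wA.
      have [i _ Aiw] : (\bigcup_k A k) w by move: wA; rewrite inE.
      apply: cvg_near_cst; exists i.+1 => // n /= ni.
      rewrite /v (bigD1 (Ordinal ni))//= indicE mem_set//=.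
      by rewrite mulr1 subrr mul0r mulr0 addr0.
    apply: cvg_near_cst; apply: nearW => n.
    rewrite /v big1 ?mulr1 ?subrr// => i _; rewrite indicE memNset ?mulr0 ?addr0// => Aiw.
    by move: wA; rewrite notin_setE; apply; exists i.
Qed.

(** The sets B whose preimage under k is a multiplier set form a sigma-algebra; the rays ]-oo, x[
    belong to it by [multiplier_lt] and generate the Borel sets. *)
Lemma multiplier_set_preimage k A : K k -> g_sigma_algebra_preimage k A -> multiplier_set A.
Proof.
move=> Kk [B mB <-]; rewrite setTI.
have [M0 MC MU] := multiplier_set_sigma_algebra.
have : <<s @RGenInftyO.G R >> B.
  have mB' : (ocitv (R := R)).-sigma.-measurable B by exact: mB.
  by rewrite RGenInftyO.measurableE in mB'.
move: B {mB}; apply: smallest_sub; last first.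
  move=> _ [x ->]; split.
    rewrite -[X in measurable X]setTI; apply: (Kmeas Kk) => //; exact: measurable_itv.
  have := multiplier_lt x Kk; congr multiplier; apply/funext => w.
  rewrite indicE; congr (nat_of_bool _)%:R; apply/idP/idP.
    by move=> kx; rewrite inE /= in_itv.
  by rewrite inE /= in_itv.
split.
- by rewrite preimage_set0.
- move=> A' mA'; rewrite setTD preimage_setC -setTD; exact: MC.
- by move=> A' mA'; rewrite preimage_bigcup; exact: MU.
Qed.

End multipliers.

(** * L^2-projection in a Gaussian space and the conditional moments of the residual *)

Section gaussian_projection.
Context {d} {T : measurableType d} {R : realType} (P : probability T R).
Implicit Types (X Y : T -> R) (H K : set (T -> R)).
Local Notation meas X := (measurable_fun setT X).

(** E|k_(n+1) - k_n| is at most the L^2 norm, hence summable with total at most C. So the series of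
    the |k_(n+1) - k_n| is almost surely finite, and k_n is a partial sum of an absolutely
    convergent series. *)
Lemma cvg_ae_fast (k_ : nat -> T -> R) (C : R) : (forall n, sqint P (k_ n)) ->
  (forall n, nrm P (fun w => k_ n.+1 w - k_ n w) <= C / (2 ^ n.+1)%:R) ->
  {ae P, forall w, cvgn (k_ ^~ w)}.
Proof.
move=> sk kC.
pose g n w := `|k_ n.+1 w - k_ n w|.
have C0 : 0 <= C.
  have := le_trans (nrm_ge0 _ _) (kC 0%N); rewrite pmulr_lge0 ?invr_gt0//.
have g0 n w : 0 <= g n w by exact: normr_ge0.
have sd n : sqint P (fun w => k_ n.+1 w - k_ n w) by exact: sqintB.
have mg n : meas (g n) by apply: measurableT_comp => //; case: (sd n).
have ig n : integ P (g n) by apply: integrable_norm; exact: sqint_integ.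
have mEg n : measurable_fun setT (EFin \o g n) by exact/measurable_EFinP.
have iS : P.-integrable setT (fun w => \sum_(0 <= n <oo) (g n w)%:E)%E.
  apply/integrableP; split.
    apply: (ge0_emeasurable_sum (h := fun n w => (g n w)%:E) (P := xpredT)).
      by move=> k w _ _; rewrite lee_fin g0.
    by move=> k _; exact: mEg.
  under eq_integral => w _.
    rewrite gee0_abs; last by apply: nneseries_ge0 => n _ _; rewrite lee_fin g0.
    over.
  rewrite integral_nneseries//; last by move=> n w _; rewrite lee_fin g0.
  apply: le_lt_trans (ltry C).
  apply: le_trans (epsilon_trick0 xpredT C0).
  apply: lee_nneseries => [n _ _|n _]; first by apply: integral_ge0 => w _; rewrite lee_fin g0.
  rewrite -EFin_mean// lee_fin (le_trans _ (kC n))//.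
  exact: mean_normr_le_nrm.
have := integrable_ae measurableT iS; apply: filterS => w /(_ I) fw.
have cs : cvgn (series (fun n => g n w)).
  apply: nnseries_is_cvg => //.
  by rewrite -ge0_fin_numE//; apply: nneseries_ge0 => n _ _; rewrite lee_fin g0.
have := normed_cvg (u_ := fun n => k_ n.+1 w - k_ n w) cs.
move=> /cvg_ex[l cl]; apply/cvg_ex; exists (l + k_ 0%N w).
have -> : k_ ^~ w = (fun n => series (fun n => k_ n.+1 w - k_ n w) n + k_ 0%N w).
  by apply/funext => n; rewrite seriesEnat/= (telescope_sumr (k_ ^~ w))// subrK.
by apply: cvgD; [exact: cl|exact: cvg_cst].
Qed.

(** Fatou's lemma for the squares, whose means converge to a finite limit. *)
Lemma sqint_lim (X_ : nat -> T -> R) X (c : R) : (forall n, sqint P (X_ n)) -> meas X ->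
  {ae P, forall w, X_ n w @[n --> \oo] --> X w} ->
  mean P (fun w => X_ n w ^+ 2) @[n --> \oo] --> c -> sqint P X.
Proof.
move=> sX mX cX cc; split => //.
apply/integrableP; split; first by apply/measurable_EFinP; exact: measurable_funX.
under eq_integral do rewrite /= ger0_norm ?sqr_ge0//.
have mX2 n : measurable_fun setT (fun w => (X_ n w ^+ 2)%:E).
  by apply/measurable_EFinP; apply: measurable_funX; case: (sX n).
have -> : (\int[P]_w (X w ^+ 2)%:E = \int[P]_w limn_einf (fun n => (X_ n w ^+ 2)%:E))%E.
  apply: ae_eq_integral => //.
  - by apply/measurable_EFinP; exact: measurable_funX.
  - have -> : (fun w => limn_einf (fun n => (X_ n w ^+ 2)%:E)) =
        (fun w => - limn_esup (-%E \o (fun n => (X_ n w ^+ 2)%:E)))%E.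
      by apply/funext => w; rewrite limn_esupN oppeK.
    apply: measurableT_comp => //.
    apply: (measurable_fun_limn_esup (f := fun n w => - (X_ n w ^+ 2)%:E)%E) => n.
    exact: measurableT_comp.
  apply: filterS cX => w cw _; have c2 : (X_ n w ^+ 2)%:E @[n --> \oo] --> (X w ^+ 2)%:E.
    by apply: cvg_EFin; [exact: nearW|rewrite /comp/=; under eq_fun do rewrite expr2; apply: cvgM].
  by rewrite is_cvg_limn_einfE; [apply/esym/cvg_lim|apply/cvg_ex; exists (X w ^+ 2)%:E].
apply: le_lt_trans (fatou P measurableT mX2 _) _.
  by move=> n w _; rewrite lee_fin sqr_ge0.
have cE : (\int[P]_w (X_ n w ^+ 2)%:E)%E @[n --> \oo] --> c%:E.
  apply: (@cvg_trans _ ((mean P (fun w => X_ n w ^+ 2))%:E @[n --> \oo])).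
    by apply: near_eq_cvg; apply: nearW => n; rewrite EFin_mean//; case: (sX n).
  by apply: cvg_EFin => //; exact: nearW.
rewrite is_cvg_limn_einfE; last by apply/cvg_ex; exists c%:E.
by rewrite (cvg_lim _ cE)// ltry.
Qed.

(** Centred Gaussian spaces are described by characteristic functions alone. The joint law of
    several members is encoded by linearity, as in the Cramer-Wold device. *)
Definition gaussian_space H := lin_subspace H /\ forall X, H X ->
  sqint P X /\ forall a,
    mean P (fun w => cos (X w + a)) = cos a * expR (- mean P (fun w => X w ^+ 2) / 2).

(* v is the squared distance from X to K, and Y the limit of a sequence in K minimising it. *)
Theorem gaussian_projection H K G X :
  gaussian_space H -> lin_subspace K -> K `<=` H -> H X ->
  sigma_algebra setT G -> (forall k, K k -> g_sigma_algebra_preimage k `<=` G) ->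
  G `<=` <<s [set A | exists2 k, K k & g_sigma_algebra_preimage k A] >> ->
  exists Y (v : R), [/\ g_sigma_algebra_preimage Y `<=` G,
    sqint P (fun w => X w - Y w),
    forall A, G A -> mean P (fun w => (X w - Y w) * \1_A w) = 0,
    forall A, G A -> mean P (fun w => (X w - Y w) ^+ 2 * \1_A w) = v * mean P (\1_A) &
    (forall k, K k -> v <= mean P (fun w => (X w - k w) ^+ 2)) /\
    forall e, 0 < e -> exists2 k, K k & mean P (fun w => (X w - k w) ^+ 2) < v + e].
Proof.
move=> [Hlin HG] Klin KH HX sG KG GK.
have HK k : K k -> H k by exact: KH.
have Hsq Z : H Z -> sqint P Z by move=> /HG[].
have Kmeas k : K k -> meas k by move=> /HK /Hsq[].
have Gmul A : G A -> multiplier_set P K A.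
  move/GK; apply: smallest_sub; first exact: multiplier_set_sigma_algebra.
  by move=> B [k Kk]; exact: multiplier_set_preimage.
have GM A : G A -> measurable A by move=> /Gmul[].
pose D := [set mean P (fun w => (X w - k w) ^+ 2) | k in K].
have D0 : lbound D 0 by move=> _ [k _ <-]; apply: mean_ge0 => w; exact: sqr_ge0.
have Dinf : has_inf D.
  by split; [exists (mean P (fun w => (X w - 0) ^+ 2)), (fun=> 0) => //; case: Klin|exists 0].
pose v := inf D.
have vle k : K k -> v <= mean P (fun w => (X w - k w) ^+ 2).
  by move=> Kk; apply: ge_inf; [exists 0|exists k].
have v0 : 0 <= v by apply: lb_le_inf => //; case: Dinf.
(* The square of 2^-(n+2): the parallelogram identity gives |k_(n+1) - k_n|^2 <= 2 (e n + e n.+1),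
   hence L^2 steps of order 2^-n, which are summable. *)
pose e n : R := ((2 ^ n.+2)%:R^-1) ^+ 2.
have e0 n : 0 < e n by rewrite exprn_gt0// invr_gt0 ltr0n expn_gt0.
have /choice[k_ kP] n : exists k, K k /\ mean P (fun w => (X w - k w) ^+ 2) < v + e n.
  by have [_ [k Kk <-] ke] := inf_adherent (e0 n) Dinf; exists k.
have Kk n : K (k_ n) by case: (kP n).
have ke n : mean P (fun w => (X w - k_ n w) ^+ 2) < v + e n by case: (kP n).
have HXk k : K k -> H (fun w => X w - k w) by move=> ?; apply: lin_subspaceB => //; exact: HK.
have sXk k : K k -> sqint P (fun w => X w - k w) by move=> ?; apply/Hsq/HXk.
have q0 n : 0 < (2 ^ n.+2)%:R^-1 :> R by rewrite invr_gt0 ltr0n expn_gt0.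
have q1 n : (2 ^ n.+2)%:R^-1 <= (2^-1 : R) ^+ n.
  rewrite natrX exprVn lef_pV2 ?posrE ?exprn_gt0// ler_eXn2l ?ltr1n//.
  by do 2 apply: leqW.
have h1 n : (2^-1 : R) ^+ n <= 1 by rewrite exprn_ile1//; lra.
have ce : e n @[n --> \oo] --> 0.
  have c1 : (2^-1 : R) ^+ n @[n --> \oo] --> 0 by apply: cvg_expr; rewrite ger0_norm; lra.
  apply: squeeze_cvgr (cvg_cst 0) c1; apply: nearW => n /=.
  rewrite (ltW (e0 n)) /= /e; have hq0 := q0 n; have hq := q1 n; have hp := h1 n.
  set q : R := (2 ^ n.+2)%:R^-1 in hq0 hq *.
  have hqq : q * q <= q * 1 by rewrite ler_pM2l//; exact: (le_trans hq hp).
  by rewrite expr2; lra.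
have cv : mean P (fun w => (X w - k_ n w) ^+ 2) @[n --> \oo] --> v.
  have cve : v + e n @[n --> \oo] --> v + 0 by apply: cvgD => //; exact: cvg_cst.
  rewrite addr0 in cve; apply: (squeeze_cvgr _ (cvg_cst v) cve); apply: nearW => n /=.
  by rewrite vle//= ltW.
(* The midpoint of k_n and k_(n+1) is in K: apply the parallelogram identity. *)
have para n : nrm P (fun w => k_ n.+1 w - k_ n w) <= 2 / (2 ^ n.+1)%:R.
  rewrite -ler_sqr ?nnegrE ?nrm_ge0 ?divr_ge0// nrm_sqr.
  have Km : K (fun w => 2^-1 * k_ n w + 2^-1 * k_ n.+1 w).
    by case: (Klin) => _ KD; apply: KD => //; exact: lin_subspaceZ.
  have -> : (fun w => (k_ n.+1 w - k_ n w) ^+ 2) = (fun w =>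
     (2 * (X w - k_ n w) ^+ 2 + 2 * (X w - k_ n.+1 w) ^+ 2) -
     4 * (X w - (2^-1 * k_ n w + 2^-1 * k_ n.+1 w)) ^+ 2).
    by apply/funext => w; field.
  have i1 := (sXk _ (Kk n)).2; have i2 := (sXk _ (Kk n.+1)).2; have i3 := (sXk _ Km).2.
  rewrite meanB; [|by apply: integD; exact: integZ|exact: integZ].
  rewrite meanD ?meanZ//; [|exact: integZ|exact: integZ].
  have := vle _ Km; have := ke n; have := ke n.+1.
  have : e n.+1 <= e n.
    rewrite /e ler_sqr ?nnegrE ?invr_ge0// lef_pV2 ?posrE ?ltr0n ?expn_gt0// ler_nat.
    by rewrite leq_exp2l.
  have -> : (2 / (2 ^ n.+1)%:R) ^+ 2 = 16 * e n.
    by rewrite /e !natrX exprS [2 ^+ n.+2]exprS exprS; field; rewrite expf_neq0.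
  have := e0 n; lra.
(* The upper limit makes Y everywhere defined and measurable for G; Y is the limit wherever the
   sequence converges, hence almost surely. *)
pose Y w := fine (limn_esup (fun n => (k_ n w)%:E)).
have YlimE w : cvgn (k_ ^~ w) -> k_ n w @[n --> \oo] --> Y w.
  move=> /cvg_ex[l cl]; suff -> : Y w = l by [].
  have cE : (k_ n w)%:E @[n --> \oo] --> l%:E by apply: cvg_EFin => //; exact: nearW.
  rewrite /Y is_cvg_limn_esupE; last by apply/cvg_ex; exists l%:E.
  by rewrite (cvg_lim _ cE).
have YG : g_sigma_algebra_preimage Y `<=` G.
  rewrite -(sigma_algebra_id sG) => A [B mB <-].
  pose k' n : g_sigma_algebraType G -> \bar R := fun w => (k_ n w)%:E.
  have mk' n : measurable_fun setT (k' n).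
    apply/measurable_EFinP => _ C mC; apply: sub_gen_smallest; apply: (KG _ (Kk n)).
    by exists C.
  have mY : measurable_fun [set: g_sigma_algebraType G] Y.
    apply: (measurableT_comp (f := fine) 
      (g := fun w : g_sigma_algebraType G => limn_esup (fun n => (k_ n w)%:E))).
      exact: fine_measurable.
    exact: (measurable_fun_limn_esup mk').
  by have := mY measurableT B mB.
have mY : meas Y by move=> _ B mB; apply/GM/YG; exists B.
have aeY : {ae P, forall w, k_ n w @[n --> \oo] --> Y w}.
  have := cvg_ae_fast (fun n => Hsq _ (HK _ (Kk n))) para.
  by apply: filterS => w /YlimE.
pose N w := X w - Y w.
have mX : meas X by case: (Hsq _ HX).
have mN : meas N by exact: measurable_funB.
have aeN : {ae P, forall w, (X w - k_ n w) @[n --> \oo] --> N w}.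
  by apply: filterS aeY => w cw; apply: cvgB cw; exact: cvg_cst.
have sN : sqint P N by apply: (sqint_lim (fun n => sXk _ (Kk n)) mN aeN cv).
(* Asymptotic orthogonality to K: minimality of v is tested at k_n - t k for t = 2^-(n+2) and t = -
   2^-(n+2). Since e n = t^2, the cross term is at most (1 + B) |t|. *)
have cross k : K k -> mean P (fun w => k w * (X w - k_ n w)) @[n --> \oo] --> 0.
  move=> KKk.
  set B := mean P (fun w => k w ^+ 2).
  have B0 : 0 <= B by apply: mean_ge0 => w; exact: sqr_ge0.
  have hv n (t : R) : v <= mean P (fun w => (X w - k_ n w) ^+ 2) +
      2 * t * mean P (fun w => k w * (X w - k_ n w)) + t ^+ 2 * B.
    have -> : mean P (fun w => k w * (X w - k_ n w)) = mean P (fun w => (X w - k_ n w) * k w).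
      by congr (mean P _); apply/funext => w; rewrite mulrC.
    rewrite -mean_sqr_lin; [|exact: sXk|exact/Hsq/HK].
    have Kt : K (fun w => k_ n w + (- t) * k w) by case: Klin => _; apply.
    apply: le_trans (vle _ Kt) _; rewrite le_eqVlt; apply/orP; left; apply/eqP.
    by congr (mean P _); apply/funext => w; ring.
  have H2 n : `|mean P (fun w => k w * (X w - k_ n w))| <= (1 + B) * (2 ^ n.+2)%:R^-1.
    set c := mean P _; set q := (2 ^ n.+2)%:R^-1.
    have {}q0 : 0 < q by exact: q0.
    have Hp := hv n q; have Hm := hv n (- q); have := ke n; rewrite -/c -/q /e -/q in Hp Hm *.
    move: Hp Hm; set V := mean P _ => Hp Hm HV.
    have cp : - ((1 + B) * q) * q <= 2 * c * q by lra.
    have cm : 2 * c * q <= (1 + B) * q * q by lra.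
    rewrite ler_pM2r// in cp; rewrite ler_pM2r// in cm.
    have : 0 <= (1 + B) * q by rewrite mulr_ge0// ?addr_ge0// ltW.
    by rewrite ler_norml; lra.
  have c2 : (1 + B) * (2 ^ n.+2)%:R^-1 @[n --> \oo] --> 0.
    have c1 : (1 + B) * ((2^-1 : R) ^+ n) @[n --> \oo] --> 0.
      rewrite -[X in _ --> X](mulr0 (1 + B)); apply: cvgMr.
      by apply: cvg_expr; rewrite ger0_norm; lra.
    apply: squeeze_cvgr (cvg_cst 0) c1; apply: nearW => n /=.
    by rewrite mulr_ge0 ?invr_ge0 ?addr_ge0//= ler_wpM2l ?addr_ge0.
  apply/norm_cvg0P; apply: (squeeze_cvgr _ (cvg_cst 0) c2); apply: nearW => n /=.
  by rewrite normr_ge0 H2.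
(* Independence of N from K in Fourier form: the cross term vanishes in the limit, so the
   characteristic function of k + t N factorises, with v as the variance of N. *)
have charN k (t a : R) : K k -> mean P (fun w => cos (k w + t * N w + a)) =
    cos a * expR (- (mean P (fun w => k w ^+ 2) + t ^+ 2 * v) / 2).
  move=> KKk; have mk := Kmeas _ KKk; have sk := Hsq _ (HK _ KKk).
  have c1 : mean P (fun w => cos (k w + t * (X w - k_ n w) + a)) @[n --> \oo] -->
            mean P (fun w => cos (k w + t * N w + a)).
    have mc (U : T -> R) : meas U -> meas (fun w => cos (k w + t * U w + a)).
      move=> mU; apply: measurableT_comp; first exact: measurable_cos.
      by apply: measurable_funD => //; apply: measurable_funD => //; exact: measurable_funM.
    apply: (mean_dct (Y := fun=> 1)).
    - by move=> n; apply: mc; case: (sXk _ (Kk n)).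
    - exact: mc.
    - apply: filterS aeN => w cw; apply: (cvg_comp _ cos); last exact: continuous_cos.
      apply: cvgD; last exact: cvg_cst.
      by apply: cvgD; [exact: cvg_cst|apply: cvgM => //; exact: cvg_cst].
    - exact: integ_cst.
    - by move=> n w; rewrite ler_norml cos_geN1 cos_le1.
  have c2 : mean P (fun w => cos (k w + t * (X w - k_ n w) + a)) @[n --> \oo] -->
     cos a * expR (- (mean P (fun w => k w ^+ 2) + t ^+ 2 * v) / 2).
    have -> : (fun n => mean P (fun w => cos (k w + t * (X w - k_ n w) + a))) = (fun n =>
      cos a * expR (- (mean P (fun w => k w ^+ 2) +
        2 * t * mean P (fun w => k w * (X w - k_ n w)) +
        t ^+ 2 * mean P (fun w => (X w - k_ n w) ^+ 2)) / 2)).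
      apply/funext => n; rewrite -mean_sqr_lin//; last exact: sXk.
      have Hn : H (fun w => k w + t * (X w - k_ n w)).
        by case: Hlin => _; apply; [exact: HK|exact: HXk].
      by have [_ ->] := HG _ Hn.
    apply: cvgM; first exact: cvg_cst.
    apply: (cvg_comp _ expR); last exact: continuous_expR.
    apply: cvgM; last exact: cvg_cst.
    apply: cvgN.
    apply: cvgD; last by apply: cvgM => //; exact: cvg_cst.
    rewrite -[X in _ --> X]addr0; apply: cvgD; first exact: cvg_cst.
    by rewrite -(mulr0 (2 * t)); apply: cvgM; [exact: cvg_cst|exact: cross].
  exact: (cvg_unique _ c1 c2).
have bcosN k (t a : R) : K k -> bdd (fun w => cos (k w + t * N w + a)).
  move=> KKk; apply: bdd_cos; apply: measurable_funD => //; apply: measurable_funD => //.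
    exact: Kmeas.
  exact: measurable_funM.
have K0 : K (fun=> 0) by case: Klin.
have mean_ind A V : G A -> bdd V -> trig_null P K V -> mean P (fun w => V w * \1_A w) = 0.
  move=> GA bV nV; have [_ [_ mul]] := Gmul A GA.
  rewrite -[RHS](mul V bV nV (fun=> 0) 0 K0); congr (mean P _); apply/funext => w.
  by rewrite addr0 cos0 mulr1.
have mtN t : meas (fun w => t * N w) by exact: measurable_funM.
have bsin t : bdd (fun w => sin (t * N w)).
  split; first by apply: measurableT_comp (mtN t); exact: measurable_sin.
  by exists 1 => w; rewrite ler_norml sin_geN1 sin_le1.
(* By [charN] the mean of cos (k + t N + b) is the same for t and - t; the product with the sine is
   half the difference of the two at b = a - pi / 2. *)
have sin_null t : trig_null P K (fun w => sin (t * N w)).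
  move=> k a KKk.
  have -> : (fun w => sin (t * N w) * cos (k w + a)) =
    (fun w => 2^-1 * cos (k w + t * N w + (a - pi / 2)) -
              2^-1 * cos (k w + (- t) * N w + (a - pi / 2))).
    apply/funext => w; rewrite !addrA !cosBpihalf.
    have -> : k w + t * N w + a = t * N w + (k w + a) by ring.
    have -> : k w + - t * N w + a = - (t * N w) + (k w + a) by ring.
    by rewrite !(sinD _ (k w + a)) sinN cosN; field.
  have i u := bdd_integ P (bcosN k u (a - pi / 2) KKk).
  rewrite meanB ?meanZ ?charN//; try exact: integZ.
  by rewrite sqrrN subrr.
have cos_null t : trig_null P K (fun w => cos (t * N w) - expR (- (t ^+ 2 * v) / 2)).
  move=> k a KKk.
  have -> : (fun w => (cos (t * N w) - expR (- (t ^+ 2 * v) / 2)) * cos (k w + a)) =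
    (fun w => (2^-1 * cos (k w + t * N w + a) + 2^-1 * cos (k w + (- t) * N w + a)) -
              expR (- (t ^+ 2 * v) / 2) * cos (k w + 0 * N w + a)).
    apply/funext => w; rewrite mul0r addr0.
    have -> : k w + t * N w + a = t * N w + (k w + a) by ring.
    have -> : k w + - t * N w + a = - (t * N w) + (k w + a) by ring.
    by rewrite !(cosD _ (k w + a)) sinN cosN; field.
  have i u := bdd_integ P (bcosN k u a KKk).
  rewrite meanB; [|by apply: integD; exact: integZ|exact: integZ].
  rewrite meanD ?meanZ ?charN//; try exact: integZ.
  rewrite sqrrN expr0n/= mul0r addr0; set m := mean P _.
  have -> : expR (- (m + t ^+ 2 * v) / 2) = expR (- (t ^+ 2 * v) / 2) * expR (- m / 2).
    by rewrite -expRD; congr expR; ring.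
  by field.
have bcosV t : bdd (fun w => cos (t * N w) - expR (- (t ^+ 2 * v) / 2)).
  have := bdd_lin (-1) (bdd_cos (mtN t)) (bdd_cst (expR (- (t ^+ 2 * v) / 2))).
  by under eq_fun do rewrite mulN1r.
(* Only bounded functions can be paired with multipliers; (n + 1) sin (N / (n + 1)) is bounded,
   dominated by |N|, and tends to N. *)
pose S n w := sin (N w * n.+1%:R^-1) * n.+1%:R.
have mS n : meas (S n).
  apply: measurable_funM => //; apply: measurableT_comp; first exact: measurable_sin.
  exact: measurable_funM.
have SN n w : `|S n w| <= `|N w|.
  rewrite /S normrM normr_nat; apply: le_trans (ler_wpM2r _ (sin_le_norm _)) _ => //.
  by rewrite normrM normfV normr_nat divfK.
have cS w : S n w @[n --> \oo] --> N w by exact: sin_quotient_cvg.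
have mind A : G A -> meas (\1_A : T -> R) by move=> GA; apply: measurable_indic; exact: GM.
have ind_le A w : `|\1_A w : R| <= 1.
  by rewrite indicE; case: (_ \in _); rewrite ?normr1 ?normr0.
exists Y, v; split => //.
3: split=> // u u0; have [_ [k Kk' <-] ke'] := inf_adherent u0 Dinf; by exists k.
- move=> A GA; have c1 : mean P (fun w => S n w * \1_A w) @[n --> \oo] -->
            mean P (fun w => N w * \1_A w).
    apply: (mean_dct (Y := fun w => `|N w|)).
    + by move=> n; apply: measurable_funM => //; exact: mind.
    + by apply: measurable_funM => //; exact: mind.
    + by apply: aeW => w; apply: cvgM; [exact: cS|exact: cvg_cst].
    + by apply: integrable_norm; exact: sqint_integ.
    + by move=> n w; rewrite normrM -[leRHS]mulr1 ler_pM.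
  rewrite -[LHS](cvg_lim (@Rhausdorff R) c1); apply/cvg_lim => //.
  apply: cvg_near_cst; apply: nearW => n.
  have := mean_ind A _ GA (bsin n.+1%:R^-1) (sin_null n.+1%:R^-1).
  move=> /(congr1 (fun x => n.+1%:R * x)); rewrite mulr0 -meanZ; last first.
    by apply: bdd_integ; apply: bddM (bdd_indic (GM A GA)).
  move=> <-; congr (mean P _); apply/funext => w; rewrite /S.
  by rewrite [N w * _]mulrC; ring.
- move=> A GA; have c1 : mean P (fun w => S n w ^+ 2 * \1_A w) @[n --> \oo] -->
            mean P (fun w => N w ^+ 2 * \1_A w).
    apply: (mean_dct (Y := fun w => N w ^+ 2)).
    + by move=> n; apply: measurable_funM; [exact: measurable_funX|exact: mind].
    + by apply: measurable_funM; [exact: measurable_funX|exact: mind].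
    + apply: aeW => w; apply: cvgM; last exact: cvg_cst.
      by under eq_fun do rewrite expr2; rewrite expr2; apply: cvgM; exact: cS.
    + by case: sN.
    + move=> n w; rewrite normrM -[leRHS]mulr1 ler_pM// normrX.
      by rewrite -[leRHS]real_normK ?num_real// ler_sqr ?nnegrE.
  (* Second moments come from 2 (sin x)^2 = 1 - cos (2 x): the mean of cos (2 t N) on A is exp (- 2
     t^2 v) P(A), used at t = 1 / (n + 1). *)
  have c2 : 2^-1 * ((1 - expR (- (2 * v / n.+1%:R ^+ 2))) * n.+1%:R ^+ 2) *
      mean P (\1_A : T -> R) @[n --> \oo] --> 2^-1 * (2 * v) * mean P (\1_A : T -> R).
    apply: cvgM; last exact: cvg_cst.
    apply: cvgM; first exact: cvg_cst.
    by apply: expR_quotient_cvg; rewrite mulr_ge0.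
  rewrite mulKf// in c2; rewrite -(cvg_lim (@Rhausdorff R) c2) -(cvg_lim (@Rhausdorff R) c1).
  congr (limn _); apply/funext => n; set t : R := n.+1%:R^-1.
  have t0 : n.+1%:R ^+ 2 = t ^- 2 by rewrite /t exprVn invrK.
  have := mean_ind A _ GA (bcosV (2 * t)) (cos_null (2 * t)).
  have -> : - ((2 * t) ^+ 2 * v) / 2 = - (2 * v / n.+1%:R ^+ 2).
    by rewrite t0 invrK; field.
  set x := expR _ => H0.
  have -> : (fun w => S n w ^+ 2 * \1_A w) = (fun w => (2^-1 * n.+1%:R ^+ 2) *
     ((1 - x) * \1_A w - (cos (2 * t * N w) - x) * \1_A w)).
    apply/funext => w; have -> : 2 * t * N w = t * N w + t * N w by ring.
    rewrite cosD /S -/t [N w * t]mulrC; have := cos2Dsin2 (t * N w).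
    set si := sin _; set co := cos _ => cs.
    have -> : co * co = 1 - si ^+ 2 by rewrite -cs -expr2 addrK.
    by field.
  have i1 : integ P (\1_A : T -> R) by apply: bdd_integ; apply: bdd_indic; exact: GM.
  have i2 : integ P (fun w => (cos (2 * t * N w) - x) * \1_A w).
    apply: bdd_integ; apply: bddM (bdd_indic (GM A GA)).
    have := bdd_lin (-1) (bdd_cos (mtN (2 * t))) (bdd_cst x).
    by under eq_fun do rewrite mulN1r.
  rewrite meanZ ?meanB ?H0 ?meanZ//; try exact: integZ; last by apply: integB => //; exact: integZ.
  by ring.
Qed.

End gaussian_projection.

(** * Sums along partitions, and rounding up to partition points *)

Section partition_sums.
Context {R : realType}.
Implicit Types (a x y : R) (p q : seq R).

(** The sums over consecutive points, by recursion along the list with a moving starting point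
    instead of [nth]. This form splits at concatenations and suits induction; [psumE] links the
    two. *)
Fixpoint psum (phi : R -> R -> R) a p : R :=
  if p is x :: q then phi a x + psum phi x q else 0.

Lemma pointS a x p i : (i <= size p)%N -> Defs.point a (x :: p) i.+1 = Defs.point x p i.
Proof. by move=> ip; rewrite /Defs.point /=; apply: set_nth_default. Qed.

Lemma psumE phi a p :
  psum phi a p = \sum_(i < size p) phi (Defs.point a p i) (Defs.point a p i.+1).
Proof.
elim: p a => [|x p IH] a /=; first by rewrite big_ord0.
rewrite big_ord_recl IH; congr (_ + _); apply: eq_bigr => i _.
by rewrite lift0 !pointS// ltnW.
Qed.

Lemma eq_psum phi psi a p : (forall x y, phi x y = psi x y) -> psum phi a p = psum psi a p.
Proof. by move=> e; elim: p a => //= x p IH a; rewrite e IH. Qed.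

Lemma psum_ge0 phi a p : (forall x y, 0 <= phi x y) -> 0 <= psum phi a p.
Proof. by move=> h; elim: p a => //= x p IH a; rewrite addr_ge0. Qed.

Lemma psum_rcons phi a p x : psum phi a (rcons p x) = psum phi a p + phi (last a p) x.
Proof. by elim: p a => /= [|y p IH] a; [rewrite addr0 add0r|rewrite IH addrA]. Qed.

Lemma psum_cat phi a p q : psum phi a (p ++ q) = psum phi a p + psum phi (last a p) q.
Proof. by elim: p a => /= [|y p IH] a; [rewrite add0r|rewrite IH addrA]. Qed.

Lemma psumZ c phi a p : psum (fun u v => c * phi u v) a p = c * psum phi a p.
Proof. by elim: p a => /= [|x p IH] a; [rewrite mulr0|rewrite IH mulrDr]. Qed.

Lemma psumB phi psi a p :
  psum (fun u v => phi u v - psi u v) a p = psum phi a p - psum psi a p.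
Proof. by elim: p a => /= [|x p IH] a; [rewrite subrr|rewrite IH; ring]. Qed.

(** Turns a weakly increasing list into a strict one. Distinct dyadic points may be rounded to the
    same partition point, whereas [itv_partition] is strict. *)
Fixpoint dedup a p : seq R :=
  if p is x :: q then if x == a then dedup a q else x :: dedup x q else [::].

Lemma dedup_path a p : path <=%R a p -> path <%R a (dedup a p).
Proof.
elim: p a => //= x p IH a /andP[ax xp]; case: eqVneq => [xa|xa].
  by apply: IH; rewrite -xa.
by rewrite /= lt_neqAle eq_sym xa ax IH.
Qed.

Lemma dedup_last a p : last a (dedup a p) = last a p.
Proof. by elim: p a => //= x p IH a; case: eqVneq => [->|_] /=; rewrite IH. Qed.

Lemma dedup_psum phi a p : (forall x, phi x x = 0) -> psum phi a (dedup a p) = psum phi a p.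
Proof.
move=> h; elim: p a => //= x p IH a; case: eqVneq => [->|_] /=; rewrite IH//.
by rewrite h add0r.
Qed.

Lemma psum_mkseq phi (b : nat -> R) m :
  psum phi (b 0%N) (mkseq (fun i => b i.+1) m) = \sum_(i < m) phi (b i) (b i.+1).
Proof.
elim: m => [|m IH]; first by rewrite big_ord0.
rewrite /mkseq -addn1 iotaD map_cat psum_cat /= addr0 add0n -/(mkseq _ _) IH.
rewrite addn1 big_ord_recr/=; congr (_ + phi _ _).
by case: m {IH} => // m; rewrite (last_nth 0) size_mkseq /= nth_mkseq.
Qed.

(* The first point of a :: p which is at least x (the last point of a :: p if there is none). *)
Fixpoint upper_point a p x : R :=
  if x <= a then a else if p is y :: q then upper_point y q x else a.

Lemma upper_point_le a p x : path <%R a p -> a <= upper_point a p x.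
Proof.
elim: p a => [|y p IH] a /=; first by case: ifP.
by case/andP=> ay yp; case: ifP => // _; apply: le_trans (ltW ay) _; exact: IH.
Qed.

Lemma upper_point_le_last a p x : path <%R a p -> upper_point a p x <= last a p.
Proof.
elim: p a => [|y p IH] a /=; first by case: ifP.
case/andP=> ay yp; case: ifP => // _; last exact: IH.
by apply: le_trans (ltW ay) _; exact: le_trans (upper_point_le x yp) (IH _ yp).
Qed.

Lemma upper_point_id a p x : x <= a -> upper_point a p x = a.
Proof. by case: p => [|y p] /= ->. Qed.

Lemma upper_point_ge a p x : path <%R a p -> x <= last a p -> x <= upper_point a p x.
Proof.
elim: p a => [|y p IH] a /=; first by move=> _ xa; case: ifP.
by case/andP=> ay yp xl; case: ifP => // _; exact: IH.
Qed.

Lemma upper_point_mono a p x y : path <%R a p -> x <= y ->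
  upper_point a p x <= upper_point a p y.
Proof.
elim: p a => [|z p IH] a /=; first by do 2 case: ifP.
case/andP=> az zp xy; case: ifP => xa; case: ifP => ya //.
- by apply: le_trans (ltW az) _; exact: upper_point_le.
- by rewrite (le_trans xy ya) in xa.
- exact: IH.
Qed.

Lemma upper_point_last a p : path <%R a p -> upper_point a p (last a p) = last a p.
Proof.
move=> ap; apply/eqP; rewrite eq_le upper_point_le_last//=.
by apply: upper_point_ge.
Qed.

Lemma mesh_cons a x p : mesh a (x :: p) = Num.max (x - a) (mesh x p).
Proof.
rewrite /mesh /= big_ord_recl; congr (Num.max _ _).
by apply: eq_bigr => i _; rewrite lift0 !pointS// ltnW.
Qed.

Lemma upper_point_mesh a p x : path <%R a p -> a <= x -> x <= last a p ->
  upper_point a p x - x <= mesh a p.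
Proof.
elim: p a => [|y p IH] a.
  rewrite /mesh /= big_ord0 => _ ax xa; rewrite xa; lra.
rewrite mesh_cons /= => /andP[ay yp] ax xl; case: ifP => xa.
  have m0 : 0 <= y - a by lra.
  by rewrite le_max; apply/orP; left; lra.
have [xy|yx] := leP x y.
  by rewrite upper_point_id// le_max; apply/orP; left; lra.
by rewrite le_max IH ?orbT// ltW.
Qed.

(** The weight keeps the increments that start at or after x, and these telescope from the first
    partition point not before x. *)
Lemma psum_tail (W : R -> R) a p x : path <%R a p ->
  psum (fun u v => (x <= u)%R%:R * (W v - W u)) a p = W (last a p) - W (upper_point a p x).
Proof.
elim: p a => [|y p IH] a /=; first by case: ifP; rewrite subrr.
case/andP=> ay yp; rewrite IH//; case: ifP => xa.
  by rewrite upper_point_id ?(le_trans xa (ltW ay))// mul1r; ring.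
by rewrite mul0r add0r.
Qed.

End partition_sums.

(** * Existence of partitions of small mesh *)

Section fine_partitions.
Context {R : realType}.
Implicit Types (a b e : R) (p q : seq R).

Lemma path_mkseq (r : rel R) (b : nat -> R) m : (forall i, (i < m)%N -> r (b i) (b i.+1)) ->
  path r (b 0%N) (mkseq (fun i => b i.+1) m).
Proof.
elim: m b => // m IH b bm.
have -> : mkseq (fun i => b i.+1) m.+1 = b 1%N :: mkseq (fun i => b i.+2) m.
  by rewrite /mkseq /= (iotaDl 1 0) -map_comp.
by rewrite /= bm//= (IH (b \o S))// => i im; exact: bm.
Qed.

Lemma mesh_mkseq (b : nat -> R) m e : 0 < e -> (forall i, (i < m)%N -> b i.+1 - b i < e) ->
  mesh (b 0%N) (mkseq (fun i => b i.+1) m) < e.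
Proof.
move=> e0; elim: m b => [|m IH] b bm; first by rewrite /mesh big_ord0.
have -> : mkseq (fun i => b i.+1) m.+1 = b 1%N :: mkseq (fun i => b i.+2) m.
  by rewrite /mkseq /= (iotaDl 1 0) -map_comp.
by rewrite mesh_cons gt_max bm//= (IH (b \o S))// => i im; exact: bm.
Qed.

Lemma last_mkseq (b : nat -> R) m : last (b 0%N) (mkseq (fun i => b i.+1) m) = b m.
Proof. by case: m => // m; rewrite (last_nth 0) size_mkseq /= nth_mkseq. Qed.

(** For a = b the list is empty; this case occurs when the interval [s, t] touches an end of
    [0, S]. *)
Lemma exists_fine_partition a b e : 0 < e -> a <= b ->
  exists p, [/\ path <%R a p, last a p = b & mesh a p < e].
Proof.
move=> e0; rewrite le_eqVlt => /predU1P[->|ab].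
  by exists [::]; rewrite /mesh big_ord0.
pose N := (Num.truncn ((b - a) / e)).+1.
have N0 : (0 : R) < N%:R by rewrite ltr0n.
have Ne : (b - a) / N%:R < e.
  by rewrite ltr_pdivrMr// mulrC -ltr_pdivrMr//; exact: truncnS_gt.
pose c (i : nat) : R := a + i%:R * ((b - a) / N%:R).
have cS i : c i.+1 - c i = (b - a) / N%:R by rewrite /c -natr1; ring.
have h0 : 0 < (b - a) / N%:R by rewrite divr_gt0// subr_gt0.
have c0 : c 0%N = a by rewrite /c mul0r addr0.
exists (mkseq (fun i => c i.+1) N); rewrite -[X in path _ X]c0 -[X in last X]c0 -[X in mesh X]c0.
split.
- by apply: path_mkseq => i _; rewrite -subr_gt0 cS.
- by rewrite last_mkseq /c mulrC divfK ?subrKC// gt_eqF.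
- by apply: mesh_mkseq => // i _; rewrite cS.
Qed.

Lemma mesh_cat_lt a p q e : mesh a p < e -> mesh (last a p) q < e -> mesh a (p ++ q) < e.
Proof.
elim: p a => [|x p IH] a //=; rewrite !mesh_cons !gt_max => /andP[-> /=].
exact: IH.
Qed.

End fine_partitions.

(** * Convergence of the Riemann sums in L^2 *)

Section young_limit.
Context {d} {T : measurableType d} {R : realType} (P : probability T R).
Variables (W : R -> T -> R) (sW : forall t, sqint P (W t)).
Variables (S Tm : R) (S0 : 0 < S) (STm : S <= Tm).
Variables (rho K : R) (rho1 : 1 <= rho).

Let icov s t u v := mean P (fun w => (W t w - W s w) * (W v w - W u w)).

Hypothesis varK : forall p q, path <%R 0 p -> last 0 p = Tm -> path <%R 0 q -> last 0 q = Tm ->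
  psum (fun a b => psum (fun c d => `|icov a b c d| `^ rho) 0 q) 0 p <= K.

Let rho0 : 0 < rho. Proof. exact: lt_le_trans rho1. Qed.

Let sD u v : sqint P (fun w => W v w - W u w). Proof. exact: sqintB. Qed.

Let icovC s t u v : icov s t u v = icov u v s t.
Proof. by congr (mean P _); apply/funext => w; rewrite mulrC. Qed.

Let icov0 s u v : icov s s u v = 0.
Proof.
by rewrite /icov -[RHS](mean_cst P); congr (mean P _); apply/funext => w; rewrite subrr mul0r.
Qed.

(** The sequence becomes a partition of [0, Tm] by appending Tm, which adds nonnegative terms, and
    by removing repetitions, which drops only terms with a zero increment. *)
Lemma weak_variation (b : nat -> R) m : b 0%N = 0 -> (forall i, (i < m)%N -> b i <= b i.+1) ->
  b m <= Tm ->
  \sum_(i < m) \sum_(j < m) `|icov (b i) (b i.+1) (b j) (b j.+1)| `^ rho <= K.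
Proof.
move=> b0 bS bm.
pose V q a b := psum (fun c d => `|icov a b c d| `^ rho) 0 q.
pose q0 := mkseq (fun i => b i.+1) m; pose q1 := rcons q0 Tm; pose q2 := dedup 0 q1.
have V0 q a b' : 0 <= V q a b' by apply: psum_ge0 => *; exact: powR_ge0.
have Vq0 a b' : V q0 a b' = \sum_(j < m) `|icov a b' (b j) (b j.+1)| `^ rho.
  by rewrite /V -[X in psum _ X _]b0 psum_mkseq.
have Vq1 a b' : V q0 a b' <= V q1 a b' by rewrite /V psum_rcons lerDl powR_ge0.
have Vq2 a b' : V q2 a b' = V q1 a b'.
  by apply: dedup_psum => x; rewrite icovC icov0 normr0 powR0// gt_eqF.
have path_le : path <=%R 0 q1.
  rewrite rcons_path -[X in path _ X _]b0 -[X in last X _]b0 last_mkseq bm andbT.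
  exact: path_mkseq.
have last_q2 : last 0 q2 = Tm by rewrite dedup_last last_rcons.
apply: le_trans (varK (dedup_path path_le) last_q2 (dedup_path path_le) last_q2).
rewrite -/q2 (eq_psum (psi := V q1))// dedup_psum; last first.
  move=> x; rewrite -Vq2 /V psumE big1// => i _.
  by rewrite icov0 normr0 powR0// gt_eqF.
rewrite psum_rcons; apply: (@le_trans _ _ (psum (V q1) 0 q0)); last by rewrite lerDl.
rewrite -[X in psum _ X _]b0 psum_mkseq; apply: ler_sum => i _.
by rewrite -Vq0.
Qed.

Let K0 : 0 <= K.
Proof.
have := @weak_variation (fun=> 0) 1 erefl (fun _ _ => lexx _) (le_trans (ltW S0) STm).
by apply: le_trans; apply: sumr_ge0 => i _; apply: sumr_ge0 => j _; exact: powR_ge0.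
Qed.

(* For x >= 0 and l > 0 one has x <= l^-1 (1 + (l x)^rho); the choice l = m^(2/rho) balances
   the m^2 terms of the double sum against the variation bound. *)
Lemma nrm_incr_sum (b c : nat -> R) m C : (0 < m)%N -> 0 <= C ->
  b 0%N = 0 -> (forall i, (i < m)%N -> b i <= b i.+1) -> b m <= Tm ->
  (forall j, (j < m)%N -> `|c j| <= C) ->
  nrm P (fun w => \sum_(j < m) c j * (W (b j.+1) w - W (b j) w)) <=
    C * (m%:R / m%:R `^ rho^-1) * Num.sqrt (1 + K).
Proof.
move=> m0 C0 b0 bS bm cC.
have M0 : (0 : R) < m%:R by rewrite ltr0n.
pose l : R := (m%:R `^ rho^-1) ^+ 2.
have l0 : 0 < l by rewrite exprn_gt0// powR_gt0.
have lr : l `^ rho = m%:R ^+ 2.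
  rewrite /l expr2 powRM ?powR_ge0// -powRrM mulVf ?gt_eqF// powRr1 ?ltW//.
have key x : 0 <= x -> x <= l^-1 * (1 + m%:R ^+ 2 * x `^ rho).
  move=> x0; rewrite mulrC ler_pdivlMr// mulrC -lr -powRM ?(ltW l0)//.
  set y := l * x; have y0 : 0 <= y by rewrite mulr_ge0// ltW.
  have [y1|y1] := leP y 1; first by rewrite (le_trans y1)// lerDl powR_ge0.
  rewrite -[leLHS]powRr1// (@le_trans _ _ (y `^ rho))//; last by rewrite lerDr.
  by rewrite ler_powR// ltW.
rewrite -ler_sqr ?nnegrE ?nrm_ge0 ?mulr_ge0 ?sqrtr_ge0 ?invr_ge0 ?powR_ge0//.
rewrite nrm_sqr.
have -> : (fun w => (\sum_(j < m) c j * (W (b j.+1) w - W (b j) w)) ^+ 2) =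
  (fun w => \sum_(i < m) \sum_(j < m) (c i * c j) *
     ((W (b i.+1) w - W (b i) w) * (W (b j.+1) w - W (b j) w))).
  apply/funext => w; rewrite expr2 big_distrlr/=; apply: eq_bigr => i _.
  by apply: eq_bigr => j _; ring.
have iM s t u v : integ P (fun w => (W t w - W s w) * (W v w - W u w)) by exact: sqintM.
rewrite mean_sum; last by move=> i; apply: integ_sum => j; exact: integZ.
under eq_bigr => i _.
  rewrite mean_sum; last by move=> j; exact: integZ.
  under eq_bigr => j _ do rewrite meanZ//.
  over.
rewrite /=.
apply: (@le_trans _ _ (\sum_(i < m) \sum_(j < m)
    C ^+ 2 * (l^-1 * (1 + m%:R ^+ 2 * `|icov (b i) (b i.+1) (b j) (b j.+1)| `^ rho)))).
  apply: ler_sum => i _; apply: ler_sum => j _.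
  apply: (le_trans (ler_norm _)); rewrite !normrM ler_pM//; last exact: key.
  by rewrite expr2 ler_pM// cC.
under eq_bigr do rewrite -mulr_sumr -mulr_sumr.
rewrite -mulr_sumr -mulr_sumr.
rewrite [leRHS](_ : _ = C ^+ 2 * (l^-1 * (m%:R ^+ 2 * (1 + K)))); last first.
  rewrite exprMn sqr_sqrtr ?addr_ge0// exprMn exprMn exprVn -/l.
  by move: (l^-1) (C ^+ 2) (m%:R ^+ 2) (1 + K) => *; ring.
rewrite ler_wpM2l ?sqr_ge0// ler_wpM2l ?invr_ge0 ?(ltW l0)//.
under eq_bigr do rewrite big_split/= sumr_const card_ord -mulr_sumr.
rewrite big_split/= sumr_const card_ord -mulr_sumr -mulrnA mulnn natrX.
by rewrite mulrDr mulr1 lerD2l ler_wpM2l ?sqr_ge0// weak_variation.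
Qed.

Variables (f : R -> R) (L gamma : R).
Hypotheses (L0 : 0 <= L) (gamma0 : 0 < gamma) (gr : 1 < gamma + rho^-1).
Hypothesis fL : forall s t, 0 <= s -> s <= t -> t <= S -> `|f t - f s| <= L * (t - s) `^ gamma.

Let x n j : R := S * (j%:R / 2 ^+ n).

Let x0 n : x n 0%N = 0. Proof. by rewrite /x mul0r mulr0. Qed.
Let xS n : x n (2 ^ n)%N = S. Proof. by rewrite /x natrX divff ?mulr1// expf_neq0. Qed.
Let x_ge0 n j : 0 <= x n j. Proof. by rewrite mulr_ge0 ?(ltW S0)// divr_ge0// exprn_ge0. Qed.
Let x_leS n j : (j <= 2 ^ n)%N -> x n j <= S.
Proof.
by move=> j2; rewrite ler_piMr ?(ltW S0)// ler_pdivrMr ?exprn_gt0// mul1r -natrX ler_nat.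
Qed.
Let x_mono n i j : (i <= j)%N -> x n i <= x n j.
Proof. by move=> ij; rewrite ler_pM2l// ler_pM2r ?invr_gt0 ?exprn_gt0// ler_nat. Qed.
Let x_double n j : x n.+1 j.*2 = x n j.
Proof. by rewrite /x -muln2 natrM exprS; congr (_ * _); field; rewrite expf_neq0. Qed.

Definition riemann_sum p w := psum (fun u v => f u * (W v w - W u w)) 0 p.

Let b p n j := upper_point 0 p (x n j).

(** f is sampled at dyadic points while the increments run between points of p. Hence this is the
    Riemann sum along p itself of a step function ([dyadic_sumE]), and consecutive levels can be
    compared with constants independent of p. *)
Definition dyadic_sum n p w := \sum_(j < 2 ^ n) f (x n j) * (W (b p n j.+1) w - W (b p n j) w).

Lemma sqint_riemann_sum p : sqint P (riemann_sum p).
Proof.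
rewrite /riemann_sum; under eq_fun do rewrite psumE.
by apply: sqint_sum => i; exact: sqintZ.
Qed.

Lemma sqint_dyadic_sum n p : sqint P (dyadic_sum n p).
Proof. by apply: sqint_sum => i; exact: sqintZ. Qed.

(** Puts the coarse sum on the refined grid, each coefficient being used twice, so that two
    consecutive levels differ in their coefficients only. *)
Lemma sum_double (g a : nat -> R) m :
  \sum_(i < m.*2) g i./2 * (a i.+1 - a i) = \sum_(j < m) g j * (a j.+1.*2 - a j.*2).
Proof.
elim: m => [|m IH]; first by rewrite !big_ord0.
rewrite doubleS 2!big_ord_recr/= IH big_ord_recr/= uphalf_double doubleK.
by rewrite doubleS; ring.
Qed.

(** This is 2^(1 - 1/rho - gamma), which is below 1 precisely when gamma + 1/rho > 1. *)
Let q : R := 2 / (2 `^ rho^-1 * 2 `^ gamma).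

Let q0 : 0 < q. Proof. by rewrite divr_gt0// mulr_gt0 ?powR_gt0. Qed.
Let q1 : q < 1.
Proof.
rewrite ltr_pdivrMr ?mulr_gt0 ?powR_gt0// mul1r -powRD ?pnatr_eq0 ?implybT//.
rewrite (_ : rho^-1 + gamma = 1 + (gamma + rho^-1 - 1)); last by ring.
rewrite powRD ?pnatr_eq0 ?implybT// powRr1// -[ltLHS]mulr1 ltr_pM2l//.
have h := gr; rewrite -[ltLHS](congr1 (fun g => g (gamma + rho^-1 - 1)) (powR1 R)).
by rewrite gt0_ltr_powR ?nnegrE ?ltr1n// subr_gt0.
Qed.

Let B : R := L * S `^ gamma * Num.sqrt (1 + K).

Let B0 : 0 <= B. Proof. by rewrite !mulr_ge0 ?powR_ge0 ?sqrtr_ge0. Qed.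

Let powX (y : R) n : (2 ^+ n) `^ y = (2 `^ y) ^+ n.
Proof. by rewrite -[RHS]powR_mulrn ?powR_ge0// powRAC [in RHS]powR_mulrn. Qed.

Let powS n : (S / 2 ^+ n) `^ gamma = S `^ gamma * ((2 `^ gamma)^-1) ^+ n.
Proof.
rewrite powRM ?(ltW S0) ?invr_ge0 ?exprn_ge0//; congr (_ * _).
have a0 : (2 ^+ n) `^ gamma != 0 :> R by rewrite gt_eqF// powR_gt0// exprn_gt0.
apply: (mulfI a0); rewrite exprVn -powX divff// -powRM ?invr_ge0 ?exprn_ge0//.
by rewrite divff ?expf_neq0// powR1.
Qed.

Let step_bound n : L * (S / 2 ^+ n) `^ gamma * ((2 ^ n)%:R / (2 ^ n)%:R `^ rho^-1) *
  Num.sqrt (1 + K) = B * q ^+ n.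
Proof.
rewrite natrX powS powX /B /q expr_div_n exprMn exprVn.
have n1 : (2 `^ gamma) ^+ n != 0 :> R by rewrite expf_neq0// gt_eqF// powR_gt0.
have n2 : (2 `^ rho^-1) ^+ n != 0 :> R by rewrite expf_neq0// gt_eqF// powR_gt0.
by field; rewrite n1 n2.
Qed.

Let b0 p n : b p n 0 = 0. Proof. by rewrite /b x0 upper_point_id. Qed.

Let b_mono p n : path <%R 0 p -> forall i, b p n i <= b p n i.+1.
Proof. by move=> pp i; apply: upper_point_mono => //; exact: x_mono. Qed.

Let bS p n : path <%R 0 p -> last 0 p = S -> b p n (2 ^ n) = S.
Proof. by move=> pp pl; rewrite /b xS -pl upper_point_last. Qed.

Let b_itv p n j : path <%R 0 p -> last 0 p = S -> 0 <= b p n j <= S.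
Proof. by move=> pp pl; rewrite upper_point_le//= -pl upper_point_le_last. Qed.

(** Points of even index are inherited from level n and cancel; at an odd index the coefficient is
    an increment of f over one step S / 2^(n+1). Then [nrm_incr_sum] applies with m = 2^(n+1). *)
Lemma dyadic_step p n : path <%R 0 p -> last 0 p = S ->
  nrm P (fun w => dyadic_sum n.+1 p w - dyadic_sum n p w) <= B * q ^+ n.+1.
Proof.
move=> pp pl.
have e2 : (2 ^ n.+1 = (2 ^ n).*2)%N by rewrite expnS mul2n.
have -> : (fun w => dyadic_sum n.+1 p w - dyadic_sum n p w) =
  (fun w => \sum_(i < 2 ^ n.+1) (f (x n.+1 i) - f (x n i./2)) *
     (W (b p n.+1 i.+1) w - W (b p n.+1 i) w)).
  apply/funext => w.
  have -> : dyadic_sum n p w = \sum_(i < 2 ^ n.+1) f (x n i./2) *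
     (W (b p n.+1 i.+1) w - W (b p n.+1 i) w).
    rewrite e2 (sum_double (fun j => f (x n j)) (fun i => W (b p n.+1 i) w)).
    by apply: eq_bigr => j _; rewrite /b !x_double.
  by rewrite -sumrB; apply: eq_bigr => i _; rewrite mulrBl.
rewrite -step_bound.
apply: (nrm_incr_sum (b := b p n.+1) (c := fun i => f (x n.+1 i) - f (x n i./2))) => //.
- by rewrite expn_gt0.
- by rewrite mulr_ge0 ?powR_ge0.
- by move=> i _; exact: b_mono.
- by rewrite bS.
- move=> j j2; have ej := odd_double_half j.
  have -> : x n j./2 = x n.+1 j./2.*2 by rewrite x_double.
  have h : 0 <= L * (S / 2 ^+ n.+1) `^ gamma by rewrite mulr_ge0 ?powR_ge0.
  case: (odd j) ej => ej; last by rewrite -{1}ej add0n subrr normr0.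
  have hd : x n.+1 j - x n.+1 j./2.*2 = S / 2 ^+ n.+1.
    by rewrite -{1}ej add1n /x -natr1; field; rewrite expf_neq0.
  rewrite -hd; apply: fL; [exact: x_ge0| |].
    by apply: x_mono; rewrite -{2}ej leq_addl.
  by apply: x_leS; exact: ltnW.
Qed.

(** The step function equal to f at the left dyadic point. Each interval is written as a difference
    of two half-lines, to which [psum_tail] applies. *)
Let fn n u := \sum_(j < 2 ^ n) f (x n j) * ((x n j <= u)%R%:R - (x n j.+1 <= u)%R%:R).

Let fn_close n u : 0 <= u -> u < S -> `|f u - fn n u| <= L * (S / 2 ^+ n) `^ gamma.
Proof.
move=> u0 uS.
have h0 : 0 < S / 2 ^+ n by rewrite divr_gt0// exprn_gt0.
(* The index of the dyadic interval containing u; all other terms of [fn n u] vanish. *)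
pose k := Num.truncn (u / (S / 2 ^+ n)).
have /andP[k1 k2] : k%:R <= u / (S / 2 ^+ n) < k.+1%:R.
  by apply: truncn_itv; rewrite divr_ge0// ltW.
rewrite ler_pdivlMr// in k1; rewrite ltr_pdivrMr// in k2.
have xE j : x n j = j%:R * (S / 2 ^+ n) by rewrite /x mulrCA.
have kn : (k < 2 ^ n)%N.
  rewrite ltnNge; apply/negP => kn; have := x_mono n kn; rewrite xS xE; lra.
have xk : x n k <= u by rewrite xE.
have xk1 : u < x n k.+1 by rewrite xE.
have -> : fn n u = f (x n k).
  rewrite /fn (bigD1 (Ordinal kn))//= xk leNgt xk1 subr0 mulr1 big1 ?addr0// => j jk.
  have [jlt|jge|je] := ltngtP j k; last by move/eqP: jk; case; exact/val_inj.
    rewrite (le_trans (x_mono n (ltnW jlt)) xk) (le_trans (x_mono n jlt) xk).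
    by rewrite subrr mulr0.
  rewrite !leNgt (lt_le_trans xk1 (x_mono n jge)).
  by rewrite (lt_le_trans xk1 (x_mono n (leqW jge))) subrr mulr0.
apply: (le_trans (fL (x_ge0 n k) xk (ltW uS))); rewrite ler_wpM2l//.
apply: ge0_ler_powR; rewrite ?nnegrE ?subr_ge0 ?(ltW gamma0) ?(ltW h0)//.
by move: k2; rewrite xE -natr1; lra.
Qed.

Lemma psum_sum (m : nat) (phi : nat -> R -> R -> R) a p :
  psum (fun u v => \sum_(j < m) phi j u v) a p = \sum_(j < m) psum (phi j) a p.
Proof.
rewrite psumE exchange_big/=; apply: eq_bigr => j _.
by rewrite psumE.
Qed.

Lemma dyadic_sumE n p w : path <%R 0 p ->
  dyadic_sum n p w = psum (fun u v => fn n u * (W v w - W u w)) 0 p.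
Proof.
move=> pp; transitivity (psum (fun u v => \sum_(j < 2 ^ n) f (x n j) *
    ((x n j <= u)%R%:R * (W v w - W u w) - (x n j.+1 <= u)%R%:R * (W v w - W u w))) 0 p).
  rewrite (psum_sum _ (fun j u v => f (x n j) *
    ((x n j <= u)%R%:R * (W v w - W u w) - (x n j.+1 <= u)%R%:R * (W v w - W u w)))).
  apply: eq_bigr => j _.
  rewrite psumZ psumB !(psum_tail (fun u => W u w))// /b; congr (_ * _); ring.
apply: eq_psum => u v; rewrite /fn mulr_suml; apply: eq_bigr => j _; ring.
Qed.

Lemma nrm_psum_le (g : R -> R) C a p : path <%R a p -> 0 <= a -> last a p = S ->
  (forall u, 0 <= u -> u < S -> `|g u| <= C) ->
  nrm P (fun w => psum (fun u v => g u * (W v w - W u w)) a p) <=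
    C * psum (fun u v => nrm P (fun w => W v w - W u w)) a p.
Proof.
move=> ap a0 pl gC; elim: p a ap a0 pl => [|y p IH] a /=.
  by rewrite mulr0 /nrm expr0n/= mean_cst sqrtr0.
case/andP=> ay yp a0 pl.
have sp : sqint P (fun w => psum (fun u v => g u * (W v w - W u w)) y p).
  by under eq_fun do rewrite psumE; apply: sqint_sum => i; exact: sqintZ.
apply: (le_trans (nrmD _ sp)); first exact: sqintZ.
rewrite mulrDr lerD//; last by apply: IH => //; lra.
rewrite nrmZ// ler_wpM2r ?nrm_ge0// gC//.
by rewrite -pl (lt_le_trans ay)//; have := @upper_point_le_last _ y p y yp; rewrite upper_point_id.
Qed.

Let A : R := B / (1 - q).

Let A0 : 0 <= A. Proof. by rewrite divr_ge0// subr_ge0 ltW. Qed.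

Let sqint_RD p n : sqint P (fun w => riemann_sum p w - dyadic_sum n p w).
Proof. by apply: sqintB; [exact: sqint_riemann_sum|exact: sqint_dyadic_sum]. Qed.

(** Uniform closeness of the step functions to f and the triangle inequality. The constant V depends
    on p, so this serves only to identify the limit for a fixed p. *)
Lemma riemann_dyadic_cvg p : path <%R 0 p -> last 0 p = S ->
  nrm P (fun w => riemann_sum p w - dyadic_sum n p w) @[n --> \oo] --> 0.
Proof.
move=> pp pl; set V := psum (fun u v => nrm P (fun w => W v w - W u w)) 0 p.
have c0 : L * (S `^ gamma * ((2 `^ gamma)^-1) ^+ n) * V @[n --> \oo] --> L * (S `^ gamma * 0) * V.
  apply: cvgM; last exact: cvg_cst.
  apply: cvgM; first exact: cvg_cst.
  apply: cvgM; first exact: cvg_cst.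
  have g1 : 1 < 2 `^ gamma.
    rewrite -[ltLHS](congr1 (fun g => g gamma) (powR1 R)).
    by rewrite gt0_ltr_powR ?nnegrE ?ltr1n.
  apply: cvg_expr; rewrite ger0_norm ?invr_ge0 ?powR_ge0// invf_lt1// powR_gt0.
rewrite !mulr0 mul0r in c0.
apply: (squeeze_cvgr _ (cvg_cst 0) c0); apply: nearW => n /=; rewrite nrm_ge0/=.
have -> : (fun w => riemann_sum p w - dyadic_sum n p w) =
  (fun w => psum (fun u v => (f u - fn n u) * (W v w - W u w)) 0 p).
  apply/funext => w; rewrite dyadic_sumE// /riemann_sum -psumB.
  by apply: eq_psum => u v; rewrite mulrBl.
apply: nrm_psum_le => // u u0 uS.
by rewrite -powS; exact: fn_close.
Qed.

(** Sum the steps from level n to level n + N and let N tend to infinity; A = B / (1 - q) bounds the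
    geometric series. The bound does not depend on p. *)
Lemma riemann_dyadic p n : path <%R 0 p -> last 0 p = S ->
  nrm P (fun w => riemann_sum p w - dyadic_sum n p w) <= A * q ^+ n.
Proof.
move=> pp pl.
have H N : nrm P (fun w => riemann_sum p w - dyadic_sum n p w) <=
    nrm P (fun w => riemann_sum p w - dyadic_sum (n + N) p w) + A * (q ^+ n - q ^+ (n + N)).
  elim: N => [|N IH]; first by rewrite addn0 subrr mulr0 addr0.
  apply: (le_trans IH); rewrite addnS.
  have -> : (fun w => riemann_sum p w - dyadic_sum (n + N) p w) =
    (fun w => (riemann_sum p w - dyadic_sum (n + N).+1 p w) +
              (dyadic_sum (n + N).+1 p w - dyadic_sum (n + N) p w)).
    by apply/funext => w; ring.
  have sd : sqint P (fun w => dyadic_sum (n + N).+1 p w - dyadic_sum (n + N) p w).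
    by apply: sqintB; exact: sqint_dyadic_sum.
  have h1 := nrmD (sqint_RD p (n + N).+1) sd.
  have h2 := dyadic_step (n + N) pp pl.
  have h3 : B * q ^+ (n + N).+1 <= A * (q ^+ (n + N) - q ^+ (n + N).+1).
    rewrite exprS (_ : A * _ = B * q ^+ (n + N)); last first.
      by rewrite /A; field; rewrite gt_eqF// subr_gt0.
    by rewrite ler_wpM2l// ler_piMl ?exprn_ge0// ltW.
  by move: h1 h2 h3; rewrite -!/(nrm _ _); lra.
apply/ler_addgt0Pr => e e0.
have /cvgr0Pnorm_le/(_ _ e0)[N _ HN] := riemann_dyadic_cvg pp pl.
have := HN (n + N)%N (leq_addl _ _); rewrite /= ger0_norm ?nrm_ge0// => hN.
apply: (le_trans (H N)).
have : A * (q ^+ n - q ^+ (n + N)) <= A * q ^+ n.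
  by rewrite ler_wpM2l// gerBl exprn_ge0// ltW.
lra.
Qed.

Hypothesis Wcont : forall u, 0 <= u <= S -> forall e, 0 < e -> exists2 dl, 0 < dl &
  forall v, 0 <= v <= S -> `|v - u| < dl -> nrm P (fun w => W v w - W u w) < e.

Definition dyadic_limit n w := \sum_(j < 2 ^ n) f (x n j) * (W (x n j.+1) w - W (x n j) w).

Lemma dyadic_mesh n e : 0 < e -> exists2 dl, 0 < dl & forall p,
  path <%R 0 p -> last 0 p = S -> mesh 0 p < dl ->
  nrm P (fun w => dyadic_sum n p w - dyadic_limit n w) < e.
Proof.
move=> e0; set F := \sum_(j < 2 ^ n) `|f (x n j)|.
have F0 : 0 <= F by apply: sumr_ge0.
(* Each increment moves by at most 2 h in L^2; the + 1 covers F = 0. *)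
pose h := e / (2 * (F + 1)); have h0 : 0 < h by rewrite divr_gt0// mulr_gt0// ltr_wpDl.
have [dl dl0 Hdl] : exists2 dl, 0 < dl & forall j, (j <= 2 ^ n)%N -> forall v, 0 <= v <= S ->
    `|v - x n j| < dl -> nrm P (fun w => W v w - W (x n j) w) < h.
  have H m : (m <= 2 ^ n)%N -> exists2 dl, 0 < dl & forall j, (j <= m)%N -> forall v, 0 <= v <= S ->
      `|v - x n j| < dl -> nrm P (fun w => W v w - W (x n j) w) < h.
    elim: m => [_|m IH m2].
      have [|dl dl0 H] := Wcont (u := x n 0) _ h0; first by rewrite x_ge0 x_leS.
      by exists dl => // j; rewrite leqn0 => /eqP ->.
    have [d1 d10 H1] := IH (ltnW m2).
    have [|d2 d20 H2] := Wcont (u := x n m.+1) _ h0; first by rewrite x_ge0 x_leS.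
    exists (Num.min d1 d2); first by rewrite lt_min d10.
    move=> j; rewrite leq_eqVlt => /predU1P[->|jm] v vS; rewrite lt_min => /andP[hv1 hv2].
      exact: H2.
    exact: H1.
  exact: H.
exists dl => // p pp pl pm.
have close j : (j <= 2 ^ n)%N -> nrm P (fun w => W (b p n j) w - W (x n j) w) < h.
  move=> j2; apply: Hdl => //; first exact: b_itv.
  have xl : x n j <= last 0 p by rewrite pl x_leS.
  rewrite ger0_norm ?subr_ge0; last exact: upper_point_ge.
  exact: le_lt_trans (upper_point_mesh pp (x_ge0 n j) xl) pm.
have -> : (fun w => dyadic_sum n p w - dyadic_limit n w) =
  (fun w => \sum_(j < 2 ^ n) f (x n j) * ((W (b p n j.+1) w - W (x n j.+1) w) -
                                         (W (b p n j) w - W (x n j) w))).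
  by apply/funext => w; rewrite -sumrB; apply: eq_bigr => j _; ring.
apply: (le_lt_trans (nrm_sum _ _)) => [j|]; first by apply: sqintZ; exact: sqintB.
apply: (@le_lt_trans _ _ (\sum_(j < 2 ^ n) `|f (x n j)| * (2 * h))).
  apply: ler_sum => j _; rewrite nrmZ; last exact: sqintB.
  rewrite ler_wpM2l//; apply: (le_trans (nrmB _ _)) => //.
  by have := close j.+1 (ltn_ord j); have := close j (ltnW (ltn_ord j)); lra.
rewrite -mulr_suml -/F /h.
rewrite (_ : F * _ = e * (F / (F + 1))); last by field; rewrite gt_eqF// ltr_wpDl.
by rewrite gtr_pMr// ltr_pdivrMr ?ltr_wpDl// mul1r ltrDl.
Qed.

Lemma mesh_to0_proper : ProperFilter (mesh_to0 0 S).
Proof.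
apply: filter_from_proper.
  apply: filter_from_filter; first by exists 1 => /=.
  move=> i j /= i0 j0; exists (Num.min i j); rewrite /= ?lt_min ?i0//.
  by move=> p [pS]; rewrite lt_min => /andP[pi pj].
move=> e /= e0; have [p [pp pl pm]] := exists_fine_partition e0 (ltW S0).
by exists p; split => //; split => //; apply/eqP.
Qed.

(** Cauchy criterion with centre the norm of [dyadic_limit n]: the level n is chosen first, by the
    bound uniform in p, and the mesh afterwards. Convergence of norms is enough, since the double
    sum is the squared norm. *)
Theorem riemann_sum_cvg : exists l : R, nrm P (riemann_sum p) @[p --> mesh_to0 0 S] --> l.
Proof.
have PF := mesh_to0_proper.
apply/cvg_ex; apply: cauchy_cvg; apply: cauchy_exP => e e0.
have c0 : A * q ^+ n @[n --> \oo] --> A * 0.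
  apply: cvgM; first exact: cvg_cst.
  by apply: cvg_expr; rewrite ger0_norm ?(ltW q0).
rewrite mulr0 in c0; move/cvgr0Pnorm_lt : c0 => /(_ (e / 2)); rewrite divr_gt0// => /(_ isT)[n _ Hn].
have {}Hn : A * q ^+ n < e / 2 by apply: le_lt_trans (ler_norm _) _; exact: (Hn n (leqnn n)).
have e20 : 0 < e / 2 by rewrite divr_gt0.
have [dl dl0 Hdl] := dyadic_mesh n e20.
exists (nrm P (dyadic_limit n)); exists dl => // p [[pp /eqP pl] pm]; rewrite /ball/=.
have h1 := riemann_dyadic n pp pl; have h2 := Hdl p pp pl pm.
have sJ : sqint P (dyadic_limit n) by apply: sqint_sum => i; exact: sqintZ.
have sI := sqint_riemann_sum p; have sII := sqint_dyadic_sum n p.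
have h3 : nrm P (fun w => riemann_sum p w - dyadic_limit n w) < e.
  have -> : (fun w => riemann_sum p w - dyadic_limit n w) =
    (fun w => (riemann_sum p w - dyadic_sum n p w) + (dyadic_sum n p w - dyadic_limit n w)).
    by apply/funext => w; ring.
  apply: (le_lt_trans (nrmD _ _)); [exact: sqintB|exact: sqintB|].
  by move: h1 h2 Hn; rewrite -!/(nrm _ _); lra.
have sIJ : sqint P (fun w => riemann_sum p w - dyadic_limit n w) by exact: sqintB.
have h4 : nrm P (riemann_sum p) <=
    nrm P (fun w => riemann_sum p w - dyadic_limit n w) + nrm P (dyadic_limit n).
  apply: le_trans (nrmD sIJ sJ); rewrite le_eqVlt; apply/orP; left; apply/eqP.
  by congr (nrm P _); apply/funext => w; rewrite subrK.
have h5 : nrm P (dyadic_limit n) <=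
    nrm P (riemann_sum p) + nrm P (fun w => riemann_sum p w - dyadic_limit n w).
  apply: le_trans (nrmB sI sIJ); rewrite le_eqVlt; apply/orP; left; apply/eqP.
  by congr (nrm P _); apply/funext => w; rewrite subKr.
rewrite ltr_norml; move: h3 h4 h5.
move: (nrm P (fun w => riemann_sum p w - dyadic_limit n w)) => z; lra.
Qed.

End young_limit.

(** * Versions of conditional expectations and their residuals *)

Section conditional_expectation.
Context {d} {T : measurableType d} {R : realType} (P : probability T R).
Variables (G : set (set T)) (sG : sigma_algebra setT G) (GM : G `<=` measurable).
Implicit Types X Y N : T -> R.
Local Notation meas X := (measurable_fun setT X).
Local Notation Gmeas X := (g_sigma_algebra_preimage X `<=` G).

Lemma Gmeas_measurable X : Gmeas X -> measurable_fun [set: g_sigma_algebraType G] X.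
Proof. by move=> GX _ B mB; apply: sub_gen_smallest; apply: GX; exists B. Qed.

Lemma measurable_Gmeas X : measurable_fun [set: g_sigma_algebraType G] X -> Gmeas X.
Proof.
move=> mX A [B mB <-]; have := mX measurableT B mB.
by rewrite /measurable/= /measurableR sigma_algebra_id.
Qed.

Lemma Gmeas_meas X : Gmeas X -> meas X.
Proof. by move=> GX _ B mB; apply/GM/GX; exists B. Qed.

Lemma Gmeas_lin X (a : R) Y : Gmeas X -> Gmeas Y -> Gmeas (fun w => X w + a * Y w).
Proof.
move=> /Gmeas_measurable mX /Gmeas_measurable mY; apply: measurable_Gmeas.
by apply: measurable_funD => //; exact: measurable_funM.
Qed.

Lemma Gmeas_cst (a : R) : Gmeas (fun=> a).
Proof. by apply: measurable_Gmeas; exact: measurable_cst. Qed.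

Lemma integral_set_mean X A : measurable A -> integ P X ->
  (\int[P]_(w in A) (X w)%:E = (mean P (fun w => X w * \1_A w))%:E)%E.
Proof.
move=> mA iX; rewrite integral_mkcond EFin_mean.
  apply: eq_integral => w _; rewrite patchE indicE.
  by case: (_ \in _); rewrite ?mulr1 ?mulr0.
apply: (integ_le (Y := fun w => `|X w|)).
- by apply: measurable_funM; [exact: integ_meas iX|exact: measurable_indic].
- exact: integrable_norm.
- by move=> w; rewrite indicE; case: (_ \in _); rewrite ?mulr1 ?mulr0 ?normr0.
Qed.

Lemma ge0_mean_eq0 X : (forall w, 0 <= X w) -> integ P X -> mean P X = 0 ->
  {ae P, forall w, X w = 0}.
Proof.
move=> X0 iX EX.
have mEX : measurable_fun setT (EFin \o X) by apply/measurable_EFinP; exact: integ_meas iX.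
have : ae_eq P setT (EFin \o X) (cst 0%E).
  apply/(ae_eq_integral_abs P measurableT mEX).
  under eq_integral do rewrite /= ger0_norm//.
  by rewrite -EFin_mean// EX.
by apply: filterS => w /(_ I) [].
Qed.

(** N is X - E[X | G] for some version. As a relation it avoids choosing versions, and it is linear
    ([residual_lin]) and unique almost surely ([residual_uniq]). *)
Definition residual X N := [/\ Gmeas (fun w => X w - N w), sqint P N &
  forall A, G A -> mean P (fun w => N w * \1_A w) = 0].

Lemma integ_ind X A : G A -> integ P X -> integ P (fun w => X w * \1_A w).
Proof.
move=> GA iX; apply: (integ_le (Y := fun w => `|X w|)).
- by apply: measurable_funM; [exact: integ_meas iX|apply: measurable_indic; exact: GM].
- exact: integrable_norm.
- by move=> w; rewrite indicE; case: (_ \in _); rewrite ?mulr1 ?mulr0 ?normr0.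
Qed.

(** Testing on the event X > 0, which is in G, gives X <= 0 almost surely; the same holds for -
    X. *)
Lemma mean_ind_eq0 X : Gmeas X -> integ P X ->
  (forall A, G A -> mean P (fun w => X w * \1_A w) = 0) -> {ae P, forall w, X w = 0}.
Proof.
move=> GX iX X0; have [_ GC _] := sG.
have H Y : Gmeas Y -> integ P Y ->
   (forall A, G A -> mean P (fun w => Y w * \1_A w) = 0) -> {ae P, forall w, Y w <= 0}.
  move=> GY iY Y0; pose A := Y @^-1` `]0, +oo[.
  have GA : G A by apply: GY; exists `]0, +oo[%classic => //; rewrite setTI.
  have YA w : Y w * \1_A w = Num.max (Y w) 0.
    rewrite indicE /A; have [y0|y0] := ltP 0 (Y w).
      by rewrite mem_set ?mulr1 /= ?in_itv/= ?y0.
    have nA : ~ (Y @^-1` `]0, +oo[) w by rewrite /= in_itv/= andbT; apply/negP; rewrite -leNgt.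
    by rewrite memNset// mulr0.
  have := @ge0_mean_eq0 (fun w => Y w * \1_A w) _ (integ_ind GA iY) (Y0 A GA).
  have h w : 0 <= Y w * \1_A w by rewrite YA le_max lexx orbT.
  move=> /(_ h); apply: filterS => w; rewrite YA => /max_idPr.
  by [].
have h1 := H X GX iX X0.
have GN : Gmeas (fun w => - X w).
  have := Gmeas_lin (a := -1) (@Gmeas_cst 0) GX.
  by under eq_fun do rewrite add0r mulN1r.
have iN : integ P (fun w => - X w).
  have -> : (fun w => - X w) = (fun w => -1 * X w) by apply/funext => w; rewrite mulN1r.
  exact: integZ.
have N0 A : G A -> mean P (fun w => - X w * \1_A w) = 0.
  move=> GA; under eq_fun do rewrite mulNr -mulN1r.
  by rewrite meanZ ?X0 ?mulr0//; exact: integ_ind.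
have h2 := H _ GN iN N0.
by apply: filterS2 h1 h2 => w a b; apply/eqP; rewrite eq_le a -oppr_le0 b.
Qed.

Lemma residual_meas X N : residual X N -> meas N. Proof. by case=> _ []. Qed.

Lemma residual_lin X N (a : R) X' N' : residual X N -> residual X' N' ->
  residual (fun w => X w + a * X' w) (fun w => N w + a * N' w).
Proof.
move=> [g1 s1 e1] [g2 s2 e2]; split.
- have := Gmeas_lin (a := a) g1 g2; congr (g_sigma_algebra_preimage _ `<=` _).
  by apply/funext => w; ring.
- by apply: sqintD => //; exact: sqintZ.
- move=> A GA; have -> : (fun w => (N w + a * N' w) * \1_A w) =
    (fun w => N w * \1_A w + a * (N' w * \1_A w)) by apply/funext => w; ring.
  rewrite meanD ?meanZ ?e1 ?e2 ?mulr0 ?addr0//; try apply: integZ;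
    by apply: integ_ind => //; exact: sqint_integ.
Qed.

Lemma residual_uniq X N N' : residual X N -> residual X N' -> {ae P, forall w, N w = N' w}.
Proof.
move=> r r'; have := residual_lin (-1) r r' => -[g s e].
have : {ae P, forall w, N w + -1 * N' w = 0}.
  apply: mean_ind_eq0 => //; last exact: sqint_integ.
  have := Gmeas_lin (a := -1) (@Gmeas_cst 0) g; congr (g_sigma_algebra_preimage _ `<=` _).
  by apply/funext => w; ring.
by apply: filterS => w; rewrite mulN1r => /eqP; rewrite subr_eq0 => /eqP.
Qed.

Lemma is_cond_expectationP X Y : integ P X ->
  is_cond_expectation P G X Y <->
  [/\ Gmeas Y, integ P Y & forall A, G A -> mean P (fun w => (X w - Y w) * \1_A w) = 0].
Proof.
move=> iX; have key Y' A : integ P Y' -> G A ->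
    (\int[P]_(w in A) (Y' w)%:E = \int[P]_(w in A) (X w)%:E)%E <->
    mean P (fun w => (X w - Y' w) * \1_A w) = 0.
  move=> iY GA; rewrite !integral_set_mean//; try exact: GM.
  have -> : (fun w => (X w - Y' w) * \1_A w) = (fun w => X w * \1_A w - Y' w * \1_A w).
    by apply/funext => w; rewrite mulrBl.
  rewrite meanB; [|exact: integ_ind|exact: integ_ind].
  split => [[->]|/eqP]; first by rewrite subrr.
  by rewrite subr_eq0 => /eqP ->.
split => -[gY iY eY]; split => // A GA.
  by apply/(key _ _ iY GA); exact: eY.
by apply/(key _ _ iY GA); exact: eY.
Qed.

(** The version Y guarantees that [xget] returns a genuine version instead of its default, and two
    versions differ by a function with zero mean on every set of G. *)
Lemma cond_expectation_ae X Y : integ P X -> is_cond_expectation P G X Y ->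
  Gmeas (cond_expectation P G X) /\ {ae P, forall w, cond_expectation P G X w = Y w}.
Proof.
move=> iX XY.
have : is_cond_expectation P G X (cond_expectation P G X).
  by rewrite /cond_expectation; exact: (xgetPex (cst 0) (ex_intro _ Y XY)).
move: XY => /(is_cond_expectationP _ iX)[gY iY eY] /(is_cond_expectationP _ iX)[gC iC eC].
split => //.
have : {ae P, forall w, cond_expectation P G X w + -1 * Y w = 0}.
  apply: mean_ind_eq0; first exact: Gmeas_lin.
    by apply: integD => //; exact: integZ.
  move=> A GA; have -> : (fun w => (cond_expectation P G X w + -1 * Y w) * \1_A w) =
    (fun w => (X w - Y w) * \1_A w - (X w - cond_expectation P G X w) * \1_A w).
    by apply/funext => w; ring.
  rewrite meanB ?eY ?eC ?subrr//; by apply: integ_ind => //; exact: integB.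
by apply: filterS => w; rewrite mulN1r => /eqP; rewrite subr_eq0 => /eqP.
Qed.

Lemma residual_cond_expectation X N : integ P X -> residual X N ->
  Gmeas (cond_expectation P G X) /\
  {ae P, forall w, X w - cond_expectation P G X w = N w}.
Proof.
move=> iX [g s e].
have H : is_cond_expectation P G X (fun w => X w - N w).
  apply/(is_cond_expectationP _ iX); split => //.
    by apply: integB => //; exact: sqint_integ.
  by move=> A GA; under eq_fun do rewrite subKr; exact: e.
have [gC h] := cond_expectation_ae iX H; split => //.
by apply: filterS h => w ->; rewrite subKr.
Qed.

(** The inner conditional expectations may be replaced by the given residuals almost surely; the
    constant c is then a version of the outer one. *)
Lemma cond_covariance_residual X N X' N' (c : R) : integ P X -> integ P X' ->
  residual X N -> residual X' N' ->
  (forall A, G A -> mean P (fun w => N w * N' w * \1_A w) = c * mean P (\1_A)) ->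
  {ae P, forall w, cond_covariance P G X X' w = c}.
Proof.
move=> iX iX' r r' NN.
have [g1 h1] := residual_cond_expectation iX r.
have [g2 h2] := residual_cond_expectation iX' r'.
set U := (X \- cond_expectation P G X) \* (X' \- cond_expectation P G X').
have UN : {ae P, forall w, N w * N' w = U w}.
  by apply: filterS2 h1 h2 => w <- <-.
have [[_ sN _] [_ sN' _]] := (r, r').
have mU : meas U.
  by apply: measurable_funM; apply: measurable_funB; [exact: integ_meas iX|exact: Gmeas_meas|
     exact: integ_meas iX'|exact: Gmeas_meas].
have iNN : integ P (fun w => N w * N' w) by exact: sqintM.
have iU : integ P U by exact: (integ_ae mU iNN UN).
have H : is_cond_expectation P G U (fun=> c).
  apply/(is_cond_expectationP _ iU); split; [exact: Gmeas_cst|exact: integ_cst|].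
  move=> A GA; have mA := GM GA.
  have i1 : integ P (\1_A : T -> R) by apply: bdd_integ; exact: bdd_indic.
  transitivity (mean P (fun w => N w * N' w * \1_A w - c * \1_A w)).
    apply: mean_ae.
    - by apply: measurable_funM; [exact: measurable_funB|exact: measurable_indic].
    - apply: measurable_funB; apply: measurable_funM => //.
      by apply: measurable_funM; [case: sN|case: sN'].
    - by apply: filterS UN => w ->; ring.
  by rewrite meanB ?meanZ ?NN ?subrr//; [exact: integ_ind|exact: integZ].
by have [] := cond_expectation_ae iU H.
Qed.

End conditional_expectation.

(** * Linear spans of random variables *)

Section spans.
Context {T : Type} {R : realType}.
Implicit Types (E H : set (T -> R)) (X Y : T -> R).

(** The algebraic span; limits of its members enter only through [gaussian_projection]. *)
Inductive span E : set (T -> R) :=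
| span0 : span E (fun=> 0)
| spanD (a : R) X Y : E X -> span E Y -> span E (fun w => Y w + a * X w).

End spans.

Section span_theory.
Context {d} {T : measurableType d} {R : realType}.
Implicit Types (E H : set (T -> R)) (X Y : T -> R).

Lemma span_lin E : lin_subspace (span E).
Proof.
split=> [|a X Y EX EY]; first exact: span0.
elim: EY => [|b X' Y' EX' _ IH]; first by under eq_fun do rewrite mulr0 addr0.
have -> : (fun w => X w + a * (Y' w + b * X' w)) = (fun w => (X w + a * Y' w) + (a * b) * X' w).
  by apply/funext => w; ring.
exact: spanD.
Qed.

Lemma span_gen E X : E X -> span E X.
Proof.
move=> EX; have := spanD 1 EX (span0 E); congr (span E _).
by apply/funext => w; rewrite add0r mul1r.
Qed.

Lemma span_sub E H : lin_subspace H -> E `<=` H -> span E `<=` H.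
Proof. by move=> [H0 HD] EH X; elim => // a X' Y' /EH HX' _ HY'; exact: HD. Qed.

Lemma psum_subspace H (W : R -> T -> R) (g : R -> R) lo hi a p : lin_subspace H ->
  (forall u v, lo <= u -> u <= v -> v <= hi -> H (fun w => W v w - W u w)) ->
  path <%R a p -> lo <= a -> last a p <= hi ->
  H (fun w => psum (fun u v => g u * (W v w - W u w)) a p).
Proof.
move=> lH HW; elim: p a => [|x p IH] a /=; first by case: lH.
case/andP=> ax xp loa hip.
have xhi : x <= hi.
  by apply: le_trans hip; have := upper_point_le_last x xp; rewrite upper_point_id.
have -> : (fun w => g a * (W x w - W a w) + psum (fun u v => g u * (W v w - W u w)) x p) =
  (fun w => psum (fun u v => g u * (W v w - W u w)) x p + g a * (W x w - W a w)).
  by apply/funext => w; rewrite addrC.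
case: (lH) => _; apply; last by apply: HW => //; exact: ltW.
by apply: IH => //; exact: le_trans (ltW ax).
Qed.

End span_theory.

(** * The Gaussian space spanned by the process *)

Section gaussian_process_space.
Context {d} {T : measurableType d} {R : realType} (P : probability T R).
Variables (tmax : R) (Z : R -> {RV P >-> R}).
Hypotheses (Zgauss : gaussian_process tmax Z) (Zcentred : centred_process tmax Z).

Definition process_space : set (T -> R) :=
  span [set X | exists2 t, t \in `[0, tmax] & X = (Z t : T -> R)].

Lemma process_space_list X : process_space X -> exists2 s : seq (R * R),
  all (fun p => p.2 \in `[0, tmax]) s & X = (fun w => \sum_(p <- s) p.1 * Z p.2 w).
Proof.
elim=> [|a _ Y [t tI ->] _ [s sI ->]].
  by exists [::] => //; apply/funext => w; rewrite big_nil.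
exists ((a, t) :: s); first by rewrite /= tI.
by apply/funext => w; rewrite big_cons addrC.
Qed.

(** A member of the span is a list of coefficients and times, reindexed by an ordinal to match
    [gaussian_process]; the characteristic function is that of a centred Gaussian variable. *)
Lemma gaussian_space_process : gaussian_space P process_space.
Proof.
split=> [|X HX]; first exact: span_lin.
have [s sI XE] := process_space_list HX.
pose n := size s; pose tt (i : 'I_n) := (nth (0, 0) s i).2.
pose aa (i : 'I_n) := (nth (0, 0) s i).1.
have ttI i : tt i \in `[0, tmax] by apply: (all_nthP (0, 0) sI); exact: ltn_ord.
pose G : {RV P >-> R} := (\sum_(i < n) aa i *: (Z (tt i) : {mfun T >-> R})).
have GX : (G : T -> R) = X.
  apply/funext => w; rewrite XE (big_nth (0, 0)) big_mkord /G.
  by rewrite (big_morph (fun g : {mfun T >-> R} => g w) (id1 := 0) (op1 := +%R)).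
have gG : gaussian_rv G by exact: Zgauss.
have sZ t : t \in `[0, tmax] -> sqint P (Z t) /\ mean P (Z t) = 0.
  move=> tI; split; last first.
    by have := Zcentred tI; rewrite unlock /Rintegral => ->.
  have := @Zgauss 1 (fun=> t) (fun=> 1) (fun=> tI) => /gaussian_rv_sqint.
  by rewrite big_ord1 scale1r.
have G0 : mean P G = 0.
  have -> : (G : T -> R) = (fun w => \sum_(i < n) aa i * Z (tt i) w).
    by rewrite GX XE; apply/funext => w; rewrite (big_nth (0, 0)) big_mkord.
  have iZ i : integ P (Z (tt i)) by apply: sqint_integ; case: (sZ _ (ttI i)).
  rewrite mean_sum; last by move=> i; apply: integZ.
  by rewrite big1// => i _; rewrite meanZ// (sZ _ (ttI i)).2 mulr0.
rewrite -GX; split; first exact: gaussian_rv_sqint.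
by move=> a; exact: gaussian_rv_charfun.
Qed.

Lemma process_space_incr u v : 0 <= u -> u <= v -> v <= tmax ->
  process_space (fun w => Z v w - Z u w).
Proof.
move=> u0 uv vt; apply: lin_subspaceB; first exact: span_lin.
  by apply: span_gen; exists v => //; rewrite in_itv/= vt (le_trans u0).
by apply: span_gen; exists u => //; rewrite in_itv/= u0 (le_trans uv).
Qed.

End gaussian_process_space.

(** * Conditioning on the increments outside an interval *)

Section outer_conditioning.
Context {d} {T : measurableType d} {R : realType} (P : probability T R).
Variables (tmax : R) (Z : R -> {RV P >-> R}).
Hypotheses (Zgauss : gaussian_process tmax Z) (Zcentred : centred_process tmax Z).
Hypothesis Zcov : nonneg_cond_cov tmax Z.
Variables (s t S : R).
Hypotheses (s0 : 0 <= s) (st : s <= t) (tS : t <= S) (ST : S <= tmax).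

Let G := outer_sigma Z s t S.
Let H := process_space tmax Z.

Definition outer_incr : set (T -> R) := [set X | exists v v',
  [/\ 0 <= v, v <= v', v' <= S, v' <= s \/ t <= v & X = increment Z v v']].

Let K := span outer_incr.

Lemma outer_incr_process : outer_incr `<=` H.
Proof.
move=> _ [v [v' [v0 vv vS _ ->]]]; apply: process_space_incr => //.
exact: le_trans ST.
Qed.

Lemma outer_sigma_algebra : sigma_algebra setT G.
Proof. exact: smallest_sigma_algebra. Qed.

Lemma outer_incr_Gmeas X : outer_incr X -> g_sigma_algebra_preimage X `<=` G.
Proof.
move=> [v [v' [v0 vv vS vst ->]]] A XA; apply: sub_gen_smallest.
case: vst => h; [left|right]; apply: sub_gen_smallest; exists v, v'; split => //.
Qed.

Lemma outer_span_Gmeas k : K k -> g_sigma_algebra_preimage k `<=` G.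
Proof.
elim=> [|a X Y EX _ IH]; first exact: (Gmeas_cst outer_sigma_algebra).
by apply: (Gmeas_lin outer_sigma_algebra) => //; exact: outer_incr_Gmeas.
Qed.

Lemma outer_sigma_sub : G `<=` <<s [set A | exists2 k, K k & g_sigma_algebra_preimage k A] >>.
Proof.
have sub : <<s [set A | exists2 k, K k & g_sigma_algebra_preimage k A] >> `<=`
           <<s [set A | exists2 k, K k & g_sigma_algebra_preimage k A] >> by [].
apply: smallest_sub; first exact: smallest_sigma_algebra.
move=> A [] ; apply: smallest_sub; try exact: smallest_sigma_algebra.
  move=> B [v [v' [v0 vv vs VB]]]; apply: sub_gen_smallest; exists (increment Z v v') => //.
  apply: span_gen; exists v, v'; split => //; last by left.
  by rewrite (le_trans vs)// (le_trans st).
move=> B [v [v' [v0 vv vs VB]]]; apply: sub_gen_smallest; exists (increment Z v v') => //.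
apply: span_gen; exists v, v'; split => //; last by right.
by rewrite (le_trans s0)// (le_trans st).
Qed.

Lemma increment_meas u v : measurable_fun setT (increment Z u v).
Proof. exact: measurable_funB. Qed.

Lemma outer_sigma_measurable : G `<=` measurable.
Proof.
apply: smallest_sub; first exact: sigma_algebra_measurable.
move=> A []; apply: smallest_sub; try exact: sigma_algebra_measurable;
  by move=> B [v [v' [_ _ _ [C mC <-]]]]; exact: increment_meas.
Qed.

Let sG := outer_sigma_algebra.
Let lH : lin_subspace H. Proof. exact: span_lin. Qed.
Let GM := outer_sigma_measurable.

(** The number v has two readings: the conditional second moment of the residual, and the squared
    distance to the span of the outer increments. The first identifies conditional variances, the
    second compares with arbitrary outer combinations. *)
Lemma outer_residual X : H X -> exists N (v : R), [/\ residual P G X N,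
  forall A, G A -> mean P (fun w => N w ^+ 2 * \1_A w) = v * mean P (\1_A),
  (forall k, K k -> v <= mean P (fun w => (X w - k w) ^+ 2)) &
  forall e, 0 < e -> exists2 k, K k & mean P (fun w => (X w - k w) ^+ 2) < v + e].
Proof.
move=> HX; have gH := gaussian_space_process Zgauss Zcentred.
have KH : K `<=` H by apply: span_sub outer_incr_process; exact: span_lin.
have [Y [v [YG sN N0 N2 [vle vlt]]]] := gaussian_projection gH (span_lin _) KH HX sG
  outer_span_Gmeas outer_sigma_sub.
exists (fun w => X w - Y w), v; split => //; split => //.
by under eq_fun do rewrite subKr.
Qed.

Lemma H_integ X : H X -> integ P X.
Proof.
by have [_ HG] := gaussian_space_process Zgauss Zcentred => /HG[sX _]; exact: sqint_integ.
Qed.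

Lemma mean_indT X : mean P (fun w => X w * \1_(setT : set T) w) = mean P X.
Proof. by congr (mean P _); apply/funext => w; rewrite indicT mulr1. Qed.

Let indT : mean P (\1_(setT : set T)) = 1.
Proof. by rewrite -[RHS](mean_cst P); congr (mean P _); apply/funext => w; rewrite indicT. Qed.

Let GT : G setT. Proof. by have [G0 GC _] := sG; rewrite -(setD0 setT); exact: GC. Qed.

(* Polarisation: N_{X + X'} = N_X + N_X' almost surely. *)
Lemma residual_prod X X' N N' : H X -> H X' -> residual P G X N -> residual P G X' N' ->
  forall A, G A -> mean P (fun w => N w * N' w * \1_A w) =
    mean P (fun w => N w * N' w) * mean P (\1_A).
Proof.
move=> HX HX' r r'.
have lin (a : R) : exists v, forall A, G A ->
    mean P (fun w => (N w + a * N' w) ^+ 2 * \1_A w) = v * mean P (\1_A).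
  have HXX : H (fun w => X w + a * X' w) by case: lH => _; apply.
  have [M [v [rM M2 _ _]]] := outer_residual HXX.
  have rNN := residual_lin sG GM a r r'.
  have aeM := residual_uniq sG GM rNN rM.
  exists v => A GA; rewrite -M2//; apply: mean_ae.
  - apply: measurable_funM; last by apply: measurable_indic; exact: GM.
    by apply: measurable_funX; exact: (residual_meas rNN).
  - apply: measurable_funM; last by apply: measurable_indic; exact: GM.
    by apply: measurable_funX; exact: (residual_meas rM).
  - by apply: filterS aeM => w ->.
have [vp Hp] := lin 1; have [vm Hm] := lin (-1).
have [[_ sN _] [_ sN' _]] := (r, r').
have HA A : G A -> mean P (fun w => N w * N' w * \1_A w) = 4^-1 * (vp - vm) * mean P (\1_A).
  move=> GA.
  have -> : (fun w => N w * N' w * \1_A w) = (fun w =>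
     4^-1 * ((N w + 1 * N' w) ^+ 2 * \1_A w - (N w + -1 * N' w) ^+ 2 * \1_A w)).
    by apply/funext => w; field.
  have i (a : R) : integ P (fun w => (N w + a * N' w) ^+ 2 * \1_A w).
    apply: (integ_ind GM) => //; apply: (sqintD _ _).2 => //; exact: sqintZ.
  by rewrite meanZ ?meanB ?Hp ?Hm//; [ring|exact: integB].
move=> A GA; rewrite HA//; congr (_ * _).
by rewrite -[RHS]mean_indT HA// indT mulr1.
Qed.

(** By [residual_prod] the conditional covariance is almost surely the number E[N N'], to which the
    sign hypothesis applies. *)
Lemma residual_incr_ge0 u v N N' : s <= u -> u <= v -> v <= t ->
  residual P G (increment Z s t) N -> residual P G (increment Z u v) N' ->
  0 <= mean P (fun w => N w * N' w).
Proof.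
move=> su uv vt r r'.
have HX : H (increment Z s t) by apply: process_space_incr => //; exact: le_trans ST.
have HX' : H (increment Z u v).
  apply: process_space_incr => //; first exact: le_trans su.
  by rewrite (le_trans vt)// (le_trans tS).
have c := cond_covariance_residual sG GM (H_integ HX) (H_integ HX') r r'
  (residual_prod HX HX' r r').
have c0 := Zcov s0 su uv vt tS ST.
have : {ae P, forall w, 0 <= mean P (fun w => N w * N' w)} by apply: filterS2 c0 c => w h <-.
(* An almost sure statement about a number: its failure would make the whole space negligible,
   against P(setT) = 1. *)
case=> B [mB PB] h; rewrite leNgt; apply/negP => neg.
have : P setT = 0%E.
  apply/eqP; rewrite -measure_le0 -PB le_measure ?inE//.
  by apply: subset_trans h => w _ /=; rewrite leNgt neg.
by rewrite probability_setT => /eqP; rewrite onee_eq0.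
Qed.

(** Induction along the partition: the residual of a sum is almost surely the sum of the residuals
    of its first term and of its tail, and each increment falls under [residual_incr_ge0]. *)
Lemma residual_psum_ge0 (g : R -> R) N a p N' : (forall u, s <= u -> u <= t -> 0 <= g u) ->
  residual P G (increment Z s t) N -> path <%R a p -> s <= a -> last a p <= t ->
  residual P G (fun w => psum (fun u v => g u * (Z v w - Z u w)) a p) N' ->
  0 <= mean P (fun w => N w * N' w).
Proof.
move=> g0 r; elim: p a N' => [|x p IH] a N' /=.
  move=> _ _ _ r'; have r0 : residual P G (fun=> 0) (fun=> 0).
    split; [|exact: sqint_cst|].
      by under eq_fun do rewrite subrr; exact: (Gmeas_cst sG).
    by move=> A _; under eq_fun do rewrite mul0r; rewrite mean_cst.
  have -> : mean P (fun w => N w * N' w) = mean P (fun=> 0).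
    apply: mean_ae => //.
      by apply: measurable_funM; [exact: residual_meas r|exact: residual_meas r'].
    by apply: filterS (residual_uniq sG GM r' r0) => w ->; rewrite mulr0.
  by rewrite mean_cst.
case/andP=> ax xp sa pt r'.
have xt : x <= t.
  by apply: le_trans pt; have := upper_point_le_last x xp; rewrite upper_point_id.
have sx : s <= x := le_trans sa (ltW ax).
have a0 : 0 <= a := le_trans s0 sa.
have tT : t <= tmax := le_trans tS ST.
have H1 : H (increment Z a x) by apply: process_space_incr (ltW ax) _ => //; exact: le_trans xt _.
have H2 : H (fun w => psum (fun u v => g u * (Z v w - Z u w)) x p).
  apply: (@psum_subspace _ T R _ (fun t => Z t : T -> R) _ 0 tmax).
  - exact: lH.
  - by move=> u v; exact: process_space_incr.
  - exact: xp.
  - exact: le_trans sx.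
  - exact: le_trans tT.
have [N1 [_ [r1 _ _ _]]] := outer_residual H1.
have [N2 [_ [r2 _ _ _]]] := outer_residual H2.
have r12 := residual_lin sG GM (g a) r2 r1.
have e12 : (fun w => psum (fun u v => g u * (Z v w - Z u w)) x p + g a * increment Z a x w) =
  (fun w => g a * (Z x w - Z a w) + psum (fun u v => g u * (Z v w - Z u w)) x p).
  by apply/funext => w; rewrite addrC.
rewrite e12 in r12.
have [[_ sN _] [_ sN1 _] [_ sN2 _]] := (And3 r r1 r2).
have -> : mean P (fun w => N w * N' w) = mean P (fun w => N w * N2 w + g a * (N w * N1 w)).
  apply: mean_ae.
  - by apply: measurable_funM; [exact: residual_meas r|exact: residual_meas r'].
  - have [mN mN1 mN2] := And3 (residual_meas r) (residual_meas r1) (residual_meas r2).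
    apply: measurable_funD; first exact: measurable_funM.
    by apply: measurable_funM => //; exact: measurable_funM.
  - by apply: filterS (residual_uniq sG GM r' r12) => w ->; ring.
rewrite meanD ?meanZ; [|exact: sqintM|exact: sqintM|by apply: integZ; exact: sqintM].
rewrite addr_ge0//; first exact: (IH x N2 xp sx pt r2).
rewrite mulr_ge0//; first by apply: g0 => //; exact: le_trans (ltW ax) xt.
by apply: (@residual_incr_ge0 a x) => //; exact: ltW.
Qed.

(** The conditional variance is known only almost surely, so its constant value v is named once and
    shared by the lower bound and by the case of the whole interval. *)
Theorem outer_variance : exists v, [/\
  {ae P, forall w, cond_variance P G (increment Z s t) w = v},
  forall (f : R -> R) (sg m : R) p1 p2 p3, sg ^+ 2 = 1 -> 0 <= m ->
    (forall u, s <= u -> u <= t -> m <= sg * f u) ->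
    path <%R 0 p1 -> last 0 p1 = s -> path <%R s p2 -> last s p2 = t ->
    path <%R t p3 -> last t p3 = S ->
    m ^+ 2 * v <= mean P (fun w =>
      (psum (fun u v => f u * (Z v w - Z u w)) 0 (p1 ++ p2 ++ p3)) ^+ 2) &
  s = 0 -> t = S -> mean P (fun w => increment Z s t w ^+ 2) <= v].
Proof.
have tT : t <= tmax := le_trans tS ST.
have HX : H (increment Z s t) by apply: process_space_incr.
have [N [v [r N2 vle vlt]]] := outer_residual HX.
have [_ sN _] := r.
have EN : mean P (fun w => N w ^+ 2) = v by rewrite -mean_indT N2// indT mulr1.
exists v; split.
- apply: (cond_covariance_residual sG GM (H_integ HX) (H_integ HX) r r) => A GA.
  by rewrite -N2//; under eq_fun do rewrite -expr2.
- move=> f sg m p1 p2 p3 sg2 m0 mf pp1 l1 pp2 l2 pp3 l3.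
  pose S1 w := psum (fun u v => f u * (Z v w - Z u w)) 0 p1.
  pose S2 w := psum (fun u v => f u * (Z v w - Z u w)) s p2.
  pose S3 w := psum (fun u v => f u * (Z v w - Z u w)) t p3.
  have K1 : K S1.
    apply: (@psum_subspace _ T R _ (fun t => Z t : T -> R) _ 0 s).
    - exact: span_lin.
    - move=> u u' u0 uu us; apply: span_gen; exists u, u'; split => //; last by left.
      by rewrite (le_trans us)// (le_trans st).
    - exact: pp1.
    - exact: lexx.
    - by rewrite l1.
  have K3 : K S3.
    apply: (@psum_subspace _ T R _ (fun t => Z t : T -> R) _ t S).
    - exact: span_lin.
    - move=> u u' u0 uu us; apply: span_gen; exists u, u'; split => //; last by right.
      by rewrite (le_trans s0)// (le_trans st).
    - exact: pp3.
    - exact: lexx.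
    - by rewrite l3.
  have HS (h : R -> R) : H (fun w => psum (fun u v => h u * (Z v w - Z u w)) s p2).
    apply: (@psum_subspace _ T R _ (fun t => Z t : T -> R) _ 0 tmax).
    - exact: lH.
    - by move=> u u'; exact: process_space_incr.
    - exact: pp2.
    - exact: s0.
    - by rewrite l2.
  have [NA [vA [rA NA2 vAle _]]] := outer_residual (HS f).
  have ENA : mean P (fun w => NA w ^+ 2) = vA by rewrite -mean_indT NA2// indT mulr1.
  (* The outer parts of the sum, with opposite sign, as competitor in the distance of S2 to K: the
     total second moment is at least vA. *)
  have KB : K (fun w => 0 + -1 * (S1 w + S3 w)).
    case: (span_lin outer_incr) => K0 KD; apply: KD => //.
    exact: (lin_subspaceD (span_lin _)).
  apply: (@le_trans _ _ vA); last first.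
    apply: le_trans (vAle _ KB) _; rewrite le_eqVlt; apply/orP; left; apply/eqP.
    congr (mean P _); apply/funext => w; rewrite !psum_cat l1 l2 -/(S1 w) -/(S2 w) -/(S3 w).
    by ring.
  (* Split sg f = g + m with g >= 0 on [s, t]. Then sg NA = N' + m N almost surely, and the cross
     term of the square is nonnegative by [residual_psum_ge0]. *)
  pose g u := sg * f u - m.
  have g0 u : s <= u -> u <= t -> 0 <= g u by move=> su ut; rewrite subr_ge0 mf.
  have [N' [_ [r' _ _ _]]] := outer_residual (HS g).
  have rL := residual_lin sG GM m r' r.
  have r0 : residual P G (fun=> 0) (fun=> 0).
    split; [|exact: sqint_cst|].
      by under eq_fun do rewrite subrr; exact: (Gmeas_cst sG).
    by move=> A _; under eq_fun do rewrite mul0r; rewrite mean_cst.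
  have rR := residual_lin sG GM sg r0 rA.
  have eLR : (fun w => psum (fun u v => g u * (Z v w - Z u w)) s p2 + m * increment Z s t w) =
    (fun w => 0 + sg * psum (fun u v => f u * (Z v w - Z u w)) s p2).
    apply/funext => w; rewrite add0r -psumZ.
    have -> : increment Z s t w = psum (fun u v => Z v w - Z u w) s p2.
      rewrite /increment -l2; elim: (p2) (s) => [|x p IH] a /=; first by rewrite subrr.
      by rewrite -IH; ring.
    rewrite -psumZ; elim: (p2) (s) => [|x p IH] a /=; first by rewrite addr0.
    by rewrite -IH /g; ring.
  rewrite eLR in rL.
  have [_ sN' _] := r'.
  have ge : 0 <= mean P (fun w => N w * N' w).
    by apply: (residual_psum_ge0 g0 r pp2 _ _ r'); rewrite ?l2.
  have -> : vA = mean P (fun w => (N' w + m * N w) ^+ 2).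
    rewrite -ENA; apply: mean_ae.
    - by apply: measurable_funX; exact: residual_meas rA.
    - by apply: measurable_funX; exact: residual_meas rL.
    - apply: filterS (residual_uniq sG GM rL rR) => w ->.
      by rewrite add0r exprMn sg2 mul1r.
  rewrite mean_sqr_lin// EN.
  have -> : mean P (fun w => N' w * N w) = mean P (fun w => N w * N' w).
    by congr (mean P _); apply/funext => w; rewrite mulrC.
  have h1 : 0 <= mean P (fun w => N' w ^+ 2) by apply: mean_ge0 => w; exact: sqr_ge0.
  by rewrite lerDr addr_ge0// mulr_ge0// mulr_ge0.
(* All outer increments now have length 0, so K contains only 0 and the squared distance v is the
   full second moment. *)
- move=> sz tz; apply/ler_addgt0Pr => e e0; have [k Kk /ltW] := vlt e e0.
  have -> : (fun w => (increment Z s t w - k w) ^+ 2) = (fun w => increment Z s t w ^+ 2) => //.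
  suff -> : k = (fun=> 0) by apply/funext => w; rewrite subr0.
  elim: Kk => // a X Y [u [u' [u0 uu uS ust ->]]] _ ->.
  apply/funext => w; rewrite add0r /increment.
  have -> : u = u' by case: ust; rewrite ?sz ?tz => h; lra.
  by rewrite subrr mulr0.
Qed.

End outer_conditioning.

(** * Riemann sums of the process, its covariance variation and its L^2-continuity *)

Section process_sums.
Context {d} {T : measurableType d} {R : realType} (P : probability T R).
Variables (tmax : R) (Z : R -> {RV P >-> R}).
Hypotheses (Zgauss : gaussian_process tmax Z) (Zcentred : centred_process tmax Z).

Lemma eq_in_psum (phi psi : R -> R -> R) a p : path <%R a p ->
  (forall x y, a <= x -> x <= y -> y <= last a p -> phi x y = psi x y) ->
  psum phi a p = psum psi a p.
Proof.
elim: p a => //= x p IH a /andP[ax xp] e.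
have xl : x <= last x p by have := upper_point_le_last x xp; rewrite upper_point_id.
rewrite e ?(ltW ax)//; congr (_ + _); apply: IH => // y z xy yz zl.
by apply: e => //; exact: le_trans (ltW ax) xy.
Qed.

Lemma mem_partition a p (x : R) : path <%R a p -> x \in a :: p -> a <= x <= last a p.
Proof.
elim: p a => [|y p IH] a /=; first by move=> _; rewrite inE => /eqP ->; rewrite !lexx.
case/andP=> ay yp; have yl : y <= last y p.
  by have := upper_point_le_last y yp; rewrite upper_point_id.
rewrite inE => /predU1P[->|/(IH _ yp)/andP[yx xl]]; first by rewrite lexx (le_trans (ltW ay)).
by rewrite xl (le_trans (ltW ay)).
Qed.

Lemma sqint_process t : t \in `[0, tmax] -> sqint P (Z t).
Proof.
move=> tI; have [_ HG] := gaussian_space_process Zgauss Zcentred.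
by apply: (HG _ _).1; apply: span_gen; exists t.
Qed.

(* The process outside the time interval is irrelevant; replacing it there by 0 makes every
   variable square integrable. *)
Definition truncated_process t : T -> R := if t \in `[0, tmax] then (Z t : T -> R) else fun=> 0.

Let W := truncated_process.

Lemma sqint_truncated t : sqint P (W t).
Proof.
by rewrite /W /truncated_process; case: ifP => [/sqint_process//|_]; exact: sqint_cst.
Qed.

Lemma truncated_processE t : 0 <= t -> t <= tmax -> W t = (Z t : T -> R).
Proof. by move=> t0 tT; rewrite /W /truncated_process in_itv/= t0 tT. Qed.

Lemma increment_covE s t u v :
  increment_cov Z s t u v = mean P (fun w => (Z t w - Z s w) * (Z v w - Z u w)).
Proof. by rewrite /increment_cov unlock. Qed.

Lemma riemann_sum_truncated (f : R -> R) p : path <%R 0 p -> last 0 p <= tmax ->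
  riemann_sum W f p = (fun w => psum (fun u v => f u * (Z v w - Z u w)) 0 p).
Proof.
move=> pp pl; apply/funext => w; apply: eq_in_psum => // x y x0 xy yl.
have yT := le_trans yl pl.
by rewrite !truncated_processE// ?(le_trans x0 xy)// (le_trans xy).
Qed.

(** The double sum of covariances is the expanded square of the Riemann sum. *)
Lemma young2d_sum_truncated (f : R -> R) p : path <%R 0 p -> last 0 p <= tmax ->
  young2d_sum Z f p = nrm P (riemann_sum W f p) ^+ 2.
Proof.
move=> pp pl; rewrite nrm_sqr /young2d_sum.
have pE i : (i <= size p)%N -> 0 <= Defs.point 0 p i /\ Defs.point 0 p i <= tmax.
  move=> ip; have /andP[p0 pS] : 0 <= Defs.point 0 p i <= last 0 p.
    by apply: mem_partition => //; rewrite mem_nth.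
  by split => //; exact: le_trans pl.
pose h (i : 'I_(size p)) w :=
  f (Defs.point 0 p i) * (W (Defs.point 0 p i.+1) w - W (Defs.point 0 p i) w).
have sh i : sqint P (h i) by apply: sqintZ; apply: sqintB; exact: sqint_truncated.
have -> : (fun w => riemann_sum W f p w ^+ 2) =
    (fun w => \sum_(i < size p) \sum_(j < size p) h i w * h j w).
  apply/funext => w; rewrite /riemann_sum psumE expr2 mulr_suml; apply: eq_bigr => i _.
  by rewrite mulr_sumr.
rewrite mean_sum; last by move=> i; apply: integ_sum => j; exact: sqintM.
apply: eq_bigr => i _; rewrite mean_sum; last by move=> j; exact: sqintM.
apply: eq_bigr => j _; rewrite /cov_block increment_covE -meanZ; last first.
  by apply: sqintM; apply: sqintB; apply: sqint_process; rewrite in_itv/=;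
     apply/andP; apply: pE => //; exact: ltnW.
congr (mean P _); apply/funext => w; rewrite /h !truncated_processE; first by ring.
all: by case: (pE i (ltnW (ltn_ord i))); case: (pE _ (ltn_ord i));
        case: (pE j (ltnW (ltn_ord j))); case: (pE _ (ltn_ord j)).
Qed.

Lemma finite_variation_bound rho : finite_2d_variation rho tmax Z -> exists K,
  forall p q, path <%R 0 p -> last 0 p = tmax -> path <%R 0 q -> last 0 q = tmax ->
  psum (fun a b => psum (fun c d =>
    `|mean P (fun w => (W b w - W a w) * (W d w - W c w))| `^ rho) 0 q) 0 p <= K.
Proof.
rewrite /finite_2d_variation; set E := ereal_sup _ => Elt.
have EE p q : path <%R 0 p -> last 0 p = tmax -> path <%R 0 q -> last 0 q = tmax ->
    ((psum (fun a b => psum (fun c d =>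
    `|mean P (fun w => (W b w - W a w) * (W d w - W c w))| `^ rho) 0 q) 0 p)%:E <= E)%E.
  move=> pp pl qp ql; apply: ereal_sup_ubound => /=; exists (p, q) => /=.
    by split; split => //; apply/eqP.
  congr EFin; rewrite /rho_variation_sum; symmetry.
  rewrite (@eq_in_psum _ (fun a b => psum (fun c d => `|increment_cov Z a b c d| `^ rho) 0 q))//.
    by rewrite psumE; apply: eq_bigr => i _; rewrite psumE.
  move=> a b a0 ab bT; apply: eq_in_psum => // c e c0 ce eT.
  rewrite increment_covE !truncated_processE//; rewrite ?pl ?ql in bT eT *;
    by [lra|rewrite (le_trans a0)|rewrite (le_trans c0)|rewrite (le_trans ab)|rewrite (le_trans ce)|].
case: E Elt EE => [r| |] // _ H.
  by exists r => p q pp pl qp ql; have := H p q pp pl qp ql; rewrite lee_fin.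
(* A supremum equal to -oo would mean that there is no pair of partitions; any bound then holds. *)
by exists 0 => p q pp pl qp ql; have := H p q pp pl qp ql.
Qed.

(** Path continuity gives E[cos (Z_v - Z_u)] -> 1 by bounded convergence along sequences. For a
    centred Gaussian increment this mean is exp (- Var / 2), so the variance tends to 0 and no
    uniform integrability argument is required. *)
Lemma process_L2_continuous : continuous_process tmax Z ->
  forall u, 0 <= u <= tmax -> forall e, 0 < e -> exists2 dl, 0 < dl &
  forall v, 0 <= v <= tmax -> `|v - u| < dl -> nrm P (fun w => W v w - W u w) < e.
Proof.
move=> Zcont u /andP[u0 uT] e e0; apply: contrapT => h.
have {h} h n : exists v, [/\ 0 <= v <= tmax, `|v - u| < n.+1%:R^-1 &
    e <= nrm P (fun w => W v w - W u w)].
  apply: contrapT => h'; apply: h; exists n.+1%:R^-1; first by rewrite invr_gt0 ltr0n.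
  move=> v vI vu; rewrite ltNge; apply/negP => le; apply: h'; by exists v.
have {h} [v_ hv] := choice h.
have vT n : 0 <= v_ n <= tmax by case: (hv n).
have vu : v_ n @[n --> \oo] --> u.
  apply/cvgrPdist_lt => ep ep0; have := @near_infty_natSinv_lt R (PosNum ep0).
  apply: filterS => n /= hn; rewrite distrC; apply: lt_trans hn.
  by case: (hv n).
have charf n : mean P (fun w => cos (W (v_ n) w - W u w + 0)) =
    expR (- mean P (fun w => (W (v_ n) w - W u w) ^+ 2) / 2).
  have /andP[v0 vT'] := vT n.
  have [lH HG] := gaussian_space_process Zgauss Zcentred.
  have HX : process_space tmax Z (fun w => W (v_ n) w - W u w).
    rewrite !truncated_processE//; apply: lin_subspaceB => //; apply: span_gen.
      by exists (v_ n) => //; rewrite in_itv/= v0.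
    by exists u => //; rewrite in_itv/= u0.
  by rewrite (HG _ HX).2 cos0 mul1r.
have mcos v : measurable_fun setT (fun w => cos (W v w - W u w + 0)).
  apply: (measurableT_comp (@measurable_cos R)); apply: measurable_funD => //.
  by apply: measurable_funB; apply: sqint_meas; exact: sqint_truncated.
have c1 : mean P (fun w => cos (W (v_ n) w - W u w + 0)) @[n --> \oo] -->
    mean P (fun w => cos (W u w - W u w + 0)).
  apply: (mean_dct (Y := fun=> 1)).
  - by move=> n; exact: mcos.
  - exact: mcos.
  - apply: filterS Zcont => w /subspace_continuousP Zw.
    have uI : `[0, tmax]%classic u by rewrite /= in_itv/= u0.
    have Zv : Z (v_ n) w @[n --> \oo] --> Z u w.
      apply: (cvg_comp _ _ _ (Zw u uI)) => A hA.
      have hB : \forall n \near \oo, v_ n \in `[0, tmax] -> A (v_ n) := vu _ hA.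
      change (\forall n \near \oo, A (v_ n)).
      by apply: filterS hB => n; apply; rewrite in_itv/= vT.
    have -> : (fun n => cos (W (v_ n) w - W u w + 0)) = (fun n => cos (Z (v_ n) w - Z u w + 0)).
      by apply/funext => n; rewrite !truncated_processE//; case/andP: (vT n).
    rewrite truncated_processE//.
    have cz : Z (v_ n) w - Z u w + 0 @[n --> \oo] --> Z u w - Z u w + 0.
      by apply: cvgD; [apply: cvgB; [exact: Zv|exact: cvg_cst]|exact: cvg_cst].
    exact: (cvg_comp _ _ cz (@continuous_cos R _)).
  - exact: integ_cst.
  - by move=> n w; rewrite ler_norml cos_geN1 cos_le1.
have E1 : mean P (fun w => cos (W u w - W u w + 0)) = 1.
  rewrite -[RHS](mean_cst P); congr (mean P _); apply/funext => w.
  by rewrite subrr addr0 cos0.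
(* Norms at least e along the sequence keep the means below exp (- e^2 / 2), although they tend to
   1. *)
rewrite E1 in c1; have : 1 <= expR (- e ^+ 2 / 2).
  rewrite -[leLHS](cvg_lim (@Rhausdorff R) c1); apply: limr_le; first by apply/cvg_ex; exists 1.
  apply: nearW => n; rewrite charf ler_expR ler_pM2r ?invr_gt0// lerN2 -nrm_sqr.
  by case: (hv n) => _ _ h; rewrite ler_sqr ?nnegrE// ?nrm_ge0// ltW.
have : expR (- e ^+ 2 / 2) < expR 0 :> R.
  by rewrite ltr_expR pmulr_llt0 ?invr_gt0// oppr_lt0 exprn_gt0.
by rewrite expR0 => /lt_le_trans /[apply]; rewrite ltxx.
Qed.

End process_sums.

(** * Hoelder functions near a maximum of the absolute value *)

Section hoelder_functions.
Context {R : realType}.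
Variables (gamma : R) (f : R -> R).
Hypothesis gamma0 : 0 < gamma.

Lemma hoelder_norm_mono S T : S <= T -> (hoelder_norm gamma f S <= hoelder_norm gamma f T)%E.
Proof.
move=> ST; apply: ereal_sup_le => x [s [t [s0 st tS ->]]].
by exists s, t; split => //; exact: le_trans ST.
Qed.

Lemma hoelder_norm_fin S : 0 < S -> (hoelder_norm gamma f S < +oo)%E ->
  exists L, [/\ hoelder_norm gamma f S = L%:E, 0 <= L &
    forall s t, 0 <= s <= S -> 0 <= t <= S -> `|f t - f s| <= L * `|t - s| `^ gamma].
Proof.
rewrite /hoelder_norm => S0; set E := ereal_sup _ => Elt.
have EE s t : 0 <= s -> s < t -> t <= S -> ((`|f t - f s| / `|t - s| `^ gamma)%:E <= E)%E.
  by move=> s0 st tS; apply: ereal_sup_ubound; exists s, t.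
case: E Elt EE => [L| |] // _ EE; last by have := EE _ _ (lexx _) S0 (lexx _).
have L0 : 0 <= L.
  by have := EE _ _ (lexx _) S0 (lexx _); rewrite lee_fin; apply: le_trans;
     rewrite divr_ge0// powR_ge0.
have lt s t : 0 <= s -> s < t -> t <= S -> `|f t - f s| <= L * `|t - s| `^ gamma.
  move=> s0 st tS; have := EE _ _ s0 st tS; rewrite lee_fin ler_pdivrMr// powR_gt0//.
  by rewrite normr_gt0 subr_eq0 gt_eqF.
exists L; split => // s t /andP[s0 sS] /andP[t0 tS].
case: (ltgtP s t) => [st|ts|->]; first exact: lt.
  by rewrite distrC [`|t - s|]distrC; exact: lt.
by rewrite subrr normr0 mulr_ge0 ?powR_ge0.
Qed.

Variables (S L : R).
Hypotheses (S0 : 0 < S) (L0 : 0 <= L).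
Hypothesis fL : forall s t, 0 <= s <= S -> 0 <= t <= S -> `|f t - f s| <= L * `|t - s| `^ gamma.

Lemma hoelder_continuous : {within `[0, S], continuous f}.
Proof.
apply/subspace_continuousP => x; rewrite /= in_itv/= => xI.
apply/cvgrPdist_lt => e e0; have L1 : 0 < L + 1 by rewrite ltr_wpDl.
(* L + 1 in place of L, since L may vanish. *)
pose dl := (e / (L + 1)) `^ gamma^-1.
have dl0 : 0 < dl by rewrite powR_gt0// divr_gt0.
rewrite /within/=; apply/nbhs_ballP; exists dl => //= y; rewrite /ball/= => xy.
rewrite in_itv/= => yI; apply: le_lt_trans (fL yI xI) _.
apply: (@le_lt_trans _ _ (L * (e / (L + 1)))).
  apply: ler_wpM2l => //; apply: (@le_trans _ _ (dl `^ gamma)).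
    by apply: ge0_ler_powR; rewrite ?nnegrE ?normr_ge0// ltW.
  by rewrite /dl -powRrM mulVf ?gt_eqF// powRr1// divr_ge0// ltW.
by rewrite mulrCA -[ltRHS]mulr1 ltr_pM2l// ltr_pdivrMr// mul1r ltrDl.
Qed.

Lemma sup_norm_attained : exists2 x0, 0 <= x0 <= S &
  sup_norm f S = `|f x0|%:E /\ forall x, 0 <= x <= S -> `|f x| <= `|f x0|.
Proof.
have cf : {within `[0, S], continuous (fun x => `|f x|)}.
  by move=> x; apply: continuous_comp; [exact: hoelder_continuous|exact: norm_continuous].
have [x0 x0I x0max] := EVT_max (ltW S0) cf; rewrite in_itv/= in x0I.
exists x0 => //; split=> [|x xI]; last by apply: x0max; rewrite in_itv.
apply/eqP; rewrite eq_le; apply/andP; split.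
  by apply: ub_ereal_sup => _ [x /= xI <-]; rewrite lee_fin; exact: x0max.
by apply: ereal_sup_ubound; exists x0 => //=; rewrite in_itv.
Qed.

(** The radius is the distance r at which the Hoelder bound L r^gamma reaches |f x0| / 2: up to
    there f keeps its sign and at least half of |f x0|. *)
Lemma hoelder_near_max x0 : 0 <= x0 <= S -> 0 < L -> f x0 != 0 ->
  forall x, 0 <= x <= S -> `|x - x0| <= (`|f x0| / (2 * L)) `^ gamma^-1 ->
  `|f x0| / 2 <= Num.sg (f x0) * f x.
Proof.
move=> x0I Lgt fx0 x xI xd; set M := `|f x0|.
have M0 : 0 < M by rewrite normr_gt0.
have h : `|f x - f x0| <= M / 2.
  apply: (le_trans (fL x0I xI)).
  have -> : M / 2 = L * (((M / (2 * L)) `^ gamma^-1) `^ gamma).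
    rewrite -powRrM mulVf ?gt_eqF// powRr1; last by rewrite divr_ge0// ?mulr_ge0// ltW.
    by field; rewrite gt_eqF.
  apply: ler_wpM2l => //; apply: ge0_ler_powR; rewrite ?nnegrE ?normr_ge0 ?powR_ge0//.
  exact: ltW.
have -> : Num.sg (f x0) * f x = M + Num.sg (f x0) * (f x - f x0).
  by rewrite mulrBr -normrEsg addrC subrK.
have : `|Num.sg (f x0) * (f x - f x0)| <= M / 2 by rewrite normrM normr_sg fx0 mul1r.
by rewrite ler_norml => /andP[h1 _]; move: h1; set a := Num.sg _ * _; lra.
Qed.

End hoelder_functions.

(** * Lower bounds for the Young integral *)

Section young_bounds.
Context {d} {Omega : measurableType d} {R : realType} (P : probability Omega R).
Variables (T : R) (Z : R -> {RV P >-> R}) (rho gamma L S : R) (f : R -> R).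
Hypotheses (Zgauss : gaussian_process T Z) (Zcentred : centred_process T Z).
Hypotheses (Zcont : continuous_process T Z) (rho1 : 1 <= rho).
Hypothesis Rvar : finite_2d_variation rho T Z.
Hypotheses (gamma0 : 0 < gamma) (gamma_rho : 1 < gamma + rho^-1).
Hypotheses (S0 : 0 < S) (ST : S <= T) (L0 : 0 <= L).
Hypothesis fL : forall s t, 0 <= s <= S -> 0 <= t <= S -> `|f t - f s| <= L * `|t - s| `^ gamma.

(** The integral is defined by [lim], which means something only once a limit exists; here it is the
    square of the limit of the L^2 norms. *)
Lemma young2d_sum_cvg : young2d_sum Z f @ mesh_to0 0 S --> young2d_integral Z f S.
Proof.
have [K varK] := finite_variation_bound Rvar.
have fL' s t : 0 <= s -> s <= t -> t <= S -> `|f t - f s| <= L * (t - s) `^ gamma.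
  move=> s0 st tS; rewrite -[X in _ <= L * X `^ _]ger0_norm ?subr_ge0//.
  by apply: fL; rewrite ?s0 ?tS/= ?(le_trans st) ?(le_trans s0).
have Wcont u : 0 <= u <= S -> forall e, 0 < e -> exists2 dl, 0 < dl & forall v, 0 <= v <= S ->
    `|v - u| < dl -> nrm P (fun w => truncated_process T Z v w - truncated_process T Z u w) < e.
  move=> /andP[u0 uS] e e0; have uT : 0 <= u <= T by rewrite u0 (le_trans uS).
  have [dl dl0 h] := process_L2_continuous Zgauss Zcentred Zcont uT e0.
  by exists dl => // v /andP[v0 vS]; apply: h; rewrite v0 (le_trans vS).
have [l hl] := riemann_sum_cvg (sqint_truncated Zgauss Zcentred) S0 ST rho1 varK L0 gamma0
  gamma_rho fL' Wcont.
have pF := mesh_to0_proper S0.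
have ce : {near mesh_to0 0 S, (fun p => nrm P (riemann_sum (truncated_process T Z) f p) *
    nrm P (riemann_sum (truncated_process T Z) f p)) =1 young2d_sum Z f}.
  exists 1 => //= p [[pp /eqP pl] _]; by rewrite (young2d_sum_truncated Zgauss Zcentred)// pl.
have cl : young2d_sum Z f @ mesh_to0 0 S --> l * l.
  exact: cvg_trans (near_eq_cvg ce) (cvgM hl hl).
by rewrite /young2d_integral (cvg_lim (@Rhausdorff R) cl).
Qed.

(** Partitions through s and t are obtained by concatenation and have arbitrarily small mesh, so
    they meet every set of the filter. *)
Lemma young2d_integral_ge s t c : 0 <= s -> s <= t -> t <= S ->
  (forall p1 p2 p3, path <%R 0 p1 -> last 0 p1 = s -> path <%R s p2 -> last s p2 = t ->
     path <%R t p3 -> last t p3 = S -> c <= young2d_sum Z f (p1 ++ p2 ++ p3)) ->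
  c <= young2d_integral Z f S.
Proof.
move=> s0 st tS h; rewrite leNgt; apply/negP => lt.
have pF := mesh_to0_proper S0; have [e /= e0 He] := cvgr_lt _ young2d_sum_cvg _ lt.
have [p1 [pp1 l1 m1]] := exists_fine_partition e0 s0.
have [p2 [pp2 l2 m2]] := exists_fine_partition e0 st.
have [p3 [pp3 l3 m3]] := exists_fine_partition e0 tS.
have := h _ _ _ pp1 l1 pp2 l2 pp3 l3; rewrite leNgt => /negP; apply; apply: He; split.
  by split; rewrite ?cat_path ?last_cat l1 ?cat_path ?l2 ?last_cat ?l2 ?l3 ?pp1 ?pp2 ?pp3.
by apply: mesh_cat_lt => //; rewrite l1; apply: mesh_cat_lt => //; rewrite l2.
Qed.

Hypothesis Zcov : nonneg_cond_cov T Z.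

(** On the whole of [0, S] the last clause bounds v below by the variance of the increment, which is
    how the trivial conditioning is exploited. *)
Lemma young2d_integral_ge_cond_variance s t : 0 <= s -> s <= t -> t <= S -> exists v, [/\
  {ae P, forall w, cond_variance P (outer_sigma Z s t S) (increment Z s t) w = v},
  (forall sg m, sg ^+ 2 = 1 -> 0 <= m -> (forall u, s <= u -> u <= t -> m <= sg * f u) ->
    m ^+ 2 * v <= young2d_integral Z f S) &
  s = 0 -> t = S -> mean P (fun w => increment Z s t w ^+ 2) <= v].
Proof.
move=> s0 st tS; have [v [ev hv vS]] := outer_variance Zgauss Zcentred Zcov s0 st tS ST.
exists v; split => // sg m sg2 m0 hm; apply: (young2d_integral_ge s0 st tS).
move=> p1 p2 p3 pp1 l1 pp2 l2 pp3 l3.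
have pp : path <%R 0 (p1 ++ p2 ++ p3) by rewrite cat_path l1 pp1/= cat_path l2 pp2.
have pl : last 0 (p1 ++ p2 ++ p3) <= T by rewrite last_cat l1 last_cat l2 l3.
rewrite (young2d_sum_truncated Zgauss Zcentred)// nrm_sqr riemann_sum_truncated//.
exact: (hv f sg m).
Qed.

End young_bounds.

(** Take a partition whose first interval is [0, S], and test its covariance matrix on the first
    unit vector. *)
Lemma nondegenerate_variance {d} {Omega : measurableType d} {R : realType}
    (P : probability Omega R) (T S : R) (Z : R -> {RV P >-> R}) :
  nondegenerate_process T Z -> 0 < S -> S <= T ->
  0 < mean P (fun w => increment Z 0 S w ^+ 2).
Proof.
move=> nd S0 ST.
have [q [qT q0]] : exists q, itv_partition 0 T (S :: q) /\ Defs.point 0 (S :: q) 1 = S.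
  move: ST; rewrite le_eqVlt => /predU1P[<-|ST].
    by exists [::]; split => //; split; rewrite /= ?S0.
  by exists [:: T]; split => //; split; rewrite /= ?S0 ?ST.
have := nd _ qT (delta_mx 0 ord0); rewrite -rowE trmx_delta -colE !mxE /cov_block q0.
rewrite {1 2}/Defs.point/= increment_covE; move=> h.
have : (delta_mx 0 ord0 : 'rV[R]_(size q).+1) != 0.
  by apply/eqP => /matrixP/(_ 0 ord0)/eqP; rewrite !mxE !eqxx oner_eq0.
move=> /h; congr (_ < mean P _); apply/funext => w; by rewrite expr2.
Qed.

(* [Z0]: the process starts at 0. All hypotheses and both integrals involve Z
   only through its increments, whereas the bound in the first alternative uses
   the variance of Z_S itself. *)
Theorem theorem6p9 (R : realType) (d : measure_display) (Omega : measurableType d)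
    (P : probability Omega R) (T : R) (Z : R -> {RV P >-> R})
    (rho gamma : R) (f : R -> R)
    (Zgauss : gaussian_process T Z)
    (Zcentred : centred_process T Z)
    (Zcont : continuous_process T Z)
    (Z0 : {ae P, forall w, Z 0 w = 0})
    (rho_ge1 : 1 <= rho) (rho_lt2 : rho < 2)
    (Rvar : finite_2d_variation rho T Z)
    (Znondeg : nondegenerate_process T Z)
    (Zcov : nonneg_cond_cov T Z)
    (gamma_gt0 : 0 < gamma) (gamma_lt1 : gamma < 1)
    (gamma_rho : 1 < gamma + rho^-1)
    (fgamma : (hoelder_norm gamma f T < +oo)%E)
    (S : R) (S_gt0 : 0 < S) (S_leT : S <= T) :
  (sup_norm f S <= 2%:E * 'E_P[fun w => (Z S w ^+ 2)%R] `^ (- 2^-1)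
                   * (young2d_integral Z f S)%:E `^ (2^-1))%E
  \/
  (exists s t : R,
    [/\ 0 <= s, s <= t, t <= S,
        ((sup_norm f S / (2%:E * hoelder_norm gamma f S)) `^ gamma^-1
           <= (t - s)%:E)%E &
        {ae P, forall w,
          ((4^-1)%:E * sup_norm f S ^+ 2
             * (cond_variance P (outer_sigma Z s t S) (increment Z s t) w)%:E
           <= (young2d_integral Z f S)%:E)%E}]).
Proof.
have [L [HE L0 fL]] := hoelder_norm_fin S_gt0
  (le_lt_trans (hoelder_norm_mono gamma f S_leT) fgamma).
have [x0 x0I [ME x0max]] := sup_norm_attained gamma_gt0 S_gt0 L0 fL.
rewrite ME HE; set M := `|f x0|; set Yg := young2d_integral Z f S.
have key s t (s0 : 0 <= s) (st : s <= t) (tS : t <= S) :=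
  young2d_integral_ge_cond_variance Zgauss Zcentred Zcont rho_ge1 Rvar gamma_gt0 gamma_rho
    S_gt0 S_leT L0 fL Zcov s0 st tS.
have M0 : 0 <= M := normr_ge0 _.
have M2 : 0 <= M / 2 by rewrite divr_ge0.
(* Splitting on what alternative (a) needs also absorbs f = 0 and L = 0: both satisfy the first
   case, so that the second has f x0 != 0 and L > 0. *)
have [[sg [sg2 whole]]|nwhole] := pselect (exists sg, sg ^+ 2 = 1 /\
    forall u, 0 <= u -> u <= S -> M / 2 <= sg * f u).
  left; have [v [_ vY /(_ erefl erefl) vS]] := key _ _ (lexx _) (ltW S_gt0) (lexx _).
  have := vY sg _ sg2 M2 whole; rewrite -/Yg => le.
  have sg0 := nondegenerate_variance Znondeg S_gt0 S_leT.
  have ZS : sqint P (Z S).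
    by apply: (sqint_process Zgauss Zcentred); rewrite in_itv/= S_leT ltW.
  have -> : ('E_P[fun w => (Z S w ^+ 2)%R] = (mean P (fun w => increment Z 0 S w ^+ 2))%:E)%E.
    rewrite unlock -EFin_mean; last by case: ZS.
    congr EFin; apply: mean_ae.
    - by apply: measurable_funX.
    - by apply: measurable_funX; exact: measurable_funB.
    - by apply: filterS Z0 => w Zw; rewrite /increment Zw subr0.
  set sigma := mean P _ in sg0 vS *.
  have s1 : 0 < Num.sqrt sigma by rewrite sqrtr_gt0.
  have le2 : (M / 2) ^+ 2 * sigma <= Yg.
    by apply: le_trans le; apply: ler_wpM2l => //; exact: sqr_ge0.
  have Y0 : 0 <= Yg by apply: le_trans le2; rewrite mulr_ge0 ?sqr_ge0// ltW.
  rewrite !poweR_EFin -!EFinM lee_fin powRN !powR12_sqrt// ?(ltW sg0)//.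
  have h : M / 2 * Num.sqrt sigma <= Num.sqrt Yg.
    by rewrite -[M / 2](ger0_norm M2) -sqrtr_sqr -sqrtrM ?sqr_ge0// ler_sqrt.
  rewrite mulrAC ler_pdivlMr//; lra.
right.
have fx0 : f x0 != 0.
  apply: contra_notN nwhole => /eqP fx0; exists 1; split=> [|u u0 uS]; first by rewrite expr1n.
  have := x0max u; rewrite u0 uS fx0 normr0 normr_le0 => /(_ isT) /eqP ->.
  by rewrite /M fx0 normr0 mulr0 mul0r.
have sg2 : Num.sg (f x0) ^+ 2 = 1 by rewrite sqr_sg fx0.
have L1 : 0 < L.
  rewrite lt_neqAle eq_sym L0 andbT; apply: contra_notN nwhole => /eqP L00.
  exists (Num.sg (f x0)); split => // u u0 uS.
  have : `|f u - f x0| <= 0 by have := fL x0 u x0I; rewrite L00 mul0r u0 uS; apply.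
  rewrite normr_le0 subr_eq0 => /eqP ->; rewrite -normrEsg -/M; lra.
pose dl := (M / (2 * L)) `^ gamma^-1.
have dl0 : 0 <= dl := powR_ge0 _ _.
have near u : 0 <= u -> u <= S -> `|u - x0| <= dl -> M / 2 <= Num.sg (f x0) * f u.
  by move=> u0 uS; apply: (hoelder_near_max gamma_gt0 L0 fL); rewrite ?u0.
(* The maximiser x0 is an endpoint of the interval, which extends to the right if it fits there and
   to the left otherwise. *)
have [s [t [s0 ts tS hu]]] : exists s t, [/\ 0 <= s, t - s = dl, t <= S &
    forall u, s <= u -> u <= t -> `|u - x0| <= dl].
  case/andP: (x0I) => x00 x0S; have [h1|h1] := leP (x0 + dl) S.
    exists x0, (x0 + dl); split => //; first by rewrite addrC addKr.
    by move=> u u1 u2; rewrite ger0_norm ?subr_ge0//; lra.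
  have [h2|h2] := leP dl x0.
    exists (x0 - dl), x0; split => //; [by rewrite subr_ge0|by rewrite subKr|].
    by move=> u u1 u2; rewrite ler0_norm ?subr_le0//; lra.
  (* If neither side has room, every point of [0, S] is within dl of x0, and the first case would
     apply. *)
  exfalso; apply: nwhole; exists (Num.sg (f x0)); split => // u u0 uS.
  by apply: near => //; rewrite ler_norml; apply/andP; split; lra.
have st : s <= t by rewrite -subr_ge0 ts.
have [v [ev vY _]] := key _ _ s0 st tS; exists s, t; split => //.
  (* As L > 0, the extended inverse of 2 L is the real one, and the required length is exactly
     [dl]. *)
  by rewrite ts -EFinM inver ifF -?EFinM ?poweR_EFin// mulf_eq0 pnatr_eq0/= gt_eqF.
have := vY _ _ sg2 M2; rewrite -/Yg => le.
apply: filterS ev => w ->; rewrite -EFin_expe -!EFinM lee_fin.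
have -> : 4^-1 * M ^+ 2 * v = (M / 2) ^+ 2 * v by field.
apply: le => u su ut; apply: near; [exact: le_trans su|exact: le_trans tS|exact: hu].
Qed.
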